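(* For every fixed integer $k\geq1$, as $n\to\infty$, (i) $d_{\mathrm K}\bigl(\mathscr{L}\bigl(\mathrm{sp}^{k}_{\mathrm{Leaf}}(T^b_{2n-1})/\mu_{n-k-1}(1,2k)\bigr),\mathrm{GG}(2k,2)\bigr)=O(n^{-1/2})$, (ii) $d_{\mathrm K}\bigl(\mathscr{L}\bigl(\mathrm{sp}^{k}_{\mathrm{Node}}(T^b_{2n-1})/\mu_{n-k-1}(1,2k)\bigr),\mathrm{GG}(2k,2)\bigr)=O(n^{-1/2})$, (iii) $d_{\mathrm K}\bigl(\mathscr{L}\bigl(2\,\mathrm{sp}^{k}_{\mathrm{Node}}(T^p_{n})/\mu_{n-k-1}(1,2k)\bigr),\mathrm{GG}(2k,2)\bigr)=O(n^{-1/2}\log n)$.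
   Context: Trees: $T^p_n$ is a uniformly chosen rooted plane (ordered) tree with $n$ nodes. $T^b_{2n-1}$ is a uniformly chosen binary rooted plane tree with $2n-1$ nodes, i.e. with $n$ leaves and $n-1$ internal nodes, each internal node having exactly a left child and a right child. For a rooted tree $T$, $\mathrm{sp}^{k}_{\mathrm{Leaf}}(T)$ is the number of vertices in the minimal spanning tree (smallest connected subtree) spanned by the root and $k$ uniformly randomly chosen distinct leaves of $T$, and $\mathrm{sp}^{k}_{\mathrm{Node}}(T)$ is the number of vertices in the minimal spanning tree spanned by the root and $k$ uniformly randomly chosen distinct nodes of $T$. Urn: for integers $l\ge1$, $b\ge 0$, $w\ge1$, $n\ge0$, an urn initially contains $b$ black and $w$ white balls. At each draw, a ball is drawn uniformly at random and replaced together with another ball of the same color; in addition, after every $l$th draw (draws $l,2l,3l,\dots$) one additional black ball is added. $\mathcal{P}^l_n(b,w)$ denotes the distribution of the number of white balls after $n$ draws. Normalization: $\mu_m(l,w)=\bigl(\frac{l+1}{w}\mathbb{E}N^{l+1}\bigr)^{1/(l+1)}$ where $N\sim\mathcal{P}^l_m(1,w)$; here it is used with $l=1$ and $w=2k$, so $\mu_m(1,2k)=\bigl(\frac1k\mathbb{E}N^2\bigr)^{1/2}$ with $N\sim\mathcal{P}^1_m(1,2k)$. For $\alpha,\beta>0$, $\mathrm{GG}(\alpha,\beta)$ is the distribution with density $\frac{\beta x^{\alpha-1}e^{-x^\beta}}{\Gamma(\alpha/\beta)}$, $x>0$. $\mathscr{L}(X)$ is the law of $X$; $d_{\mathrm K}$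 is the Kolmogorov distance (supremum distance of cumulative distribution functions). *)

(* Defs.v *)
From HB Require Import structures.
From mathcomp Require Import all_boot all_order all_algebra finmap.
From mathcomp Require Import all_classical all_reals all_analysis.

Set Implicit Arguments.
Unset Strict Implicit.
Unset Printing Implicit Defensive.

Import Order.TTheory GRing.Theory Num.Theory.
Import numFieldNormedType.Exports.

Local Open Scope classical_set_scope.
Local Open Scope ring_scope.

(* Rooted plane trees in Ulam-Harris-Neveu form: a tree is the finite set of
   its nodes, and a node is the word of child ranks read along the path from
   the root. The root is [::]; child number i of u is rcons u i. *)
Notation word := (seq nat).

(* Holds iff v = rcons u i for some i. *)
Definition parent (u v : word) : bool := v == rcons u (last 0%N v).

Definition plane_tree (T : {fset word}) : Prop :=
  [::] \in T /\
  forall (u : word) (i : nat), rcons u i \in T ->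
    u \in T /\ forall j : nat, (j < i)%N -> rcons u j \in T.

Definition nodes (T : {fset word}) : {fset word} := T.

Definition children (T : {fset word}) (u : word) : {fset word} :=
  [fset v in T | parent u v]%fset.

Definition leaves (T : {fset word}) : {fset word} :=
  [fset u in T | #|` children T u| == 0%N]%fset.

(* The two children of an internal node are distinguished by their ranks:
   0 for the left child and 1 for the right child. *)
Definition binary (T : {fset word}) : Prop :=
  forall u : word, u \in T ->
    #|` children T u| = 0%N \/ #|` children T u| = 2%N.

Definition plane_trees (n : nat) : {fset {fset word}} :=
  fset_set [set T : {fset word} | plane_tree T /\ #|` nodes T| = n].

Definition binary_trees (n : nat) : {fset {fset word}} :=
  fset_set
    [set T : {fset word} | [/\ plane_tree T, binary T & #|` nodes T| = n]].

Lemma plane_tree_size (T : {fset word}) (u : word) :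
  plane_tree T -> u \in T -> (size u < #|` T|)%N.
Proof.
move=> [_ hT] uT.
have pT i : take i u \in T.
  rewrite -(cat_take_drop i u) in uT; move: uT.
  elim/last_ind: (drop i u) => [|v j IH]; first by rewrite cats0.
  by rewrite -rcons_cat => /hT[/IH].
have <- : size [seq take i u | i <- iota 0 (size u).+1] = (size u).+1.
  by rewrite size_map size_iota.
apply: uniq_leq_size => [|v /mapP[i _ ->]]; last exact: pT.
rewrite map_inj_in_uniq ?iota_uniq// => i j.
rewrite !mem_iota !add0n !ltnS => /andP[_ hi] /andP[_ hj] e.
by rewrite -(size_takel hi) e size_takel.
Qed.

Lemma plane_tree_rank (T : {fset word}) (u : word) :
  plane_tree T -> u \in T -> all (ltn^~ #|` T|) u.
Proof.
move=> [_ hT]; elim/last_ind: u => [//|u i IH] uiT.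
have [uT uj] := hT _ _ uiT.
rewrite all_rcons IH// andbT /=.
have <- : size [seq rcons u j | j <- iota 0 i.+1] = i.+1.
  by rewrite size_map size_iota.
apply: uniq_leq_size => [|v /mapP[j + ->]].
  by rewrite map_inj_uniq ?iota_uniq// => a b /rcons_inj[].
by rewrite mem_iota add0n ltnS /= leq_eqVlt => /orP[/eqP->|/uj].
Qed.

Lemma finite_plane_trees (n : nat) :
  finite_set [set T : {fset word} | plane_tree T /\ #|` nodes T| = n].
Proof.
pose box := [fset map val (val b) | b in [set: n.-bseq 'I_n]%SET]%fset : {fset word}.
apply: (@sub_finite_set _ _ [set` fpowerset box]); last exact: finite_fset.
move=> T [pT cT] /=; rewrite fpowersetE; apply/fsubsetP => u uT.
have su : (size u <= n)%N by rewrite -cT ltnW ?plane_tree_size.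
have := plane_tree_rank pT uT; rewrite [#|` T|]cT => /allP ru.
have sv : (size (pmap insub u : seq 'I_n) <= n)%N.
  by apply: leq_trans su; rewrite size_pmap count_size.
apply/imfsetP; exists (Bseq sv); first by rewrite /= finset.in_setT.
rewrite /= (pmap_filter (insubK _)) [RHS](_ : _ = u)//.
by apply/all_filterP/allP => i /ru; rewrite isSome_insub.
Qed.

(* fset_set is junk on infinite sets; the two membership lemmas rule it out. *)
Lemma plane_treesP (n : nat) (T : {fset word}) :
  T \in plane_trees n <-> plane_tree T /\ #|` nodes T| = n.
Proof.
by rewrite /plane_trees in_fset_set ?inE//; exact: finite_plane_trees.
Qed.

Lemma binary_treesP (n : nat) (T : {fset word}) :
  T \in binary_trees n <-> [/\ plane_tree T, binary T & #|` nodes T| = n].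
Proof.
rewrite /binary_trees in_fset_set ?inE//.
by apply: sub_finite_set (finite_plane_trees n) => U [].
Qed.

(* The subgraph induced by the vertex set A is connected. *)
Definition induced_connected (A : {fset word}) : bool :=
  [forall u : A, forall v : A,
    connect (fun x y : A => parent (val x) (val y) || parent (val y) (val x))
      u v].

(* Number of vertices of the smallest connected subtree of T containing the
   root and S. T itself is such a subtree, hence the default value. *)
Definition spanning_size (T S : {fset word}) : nat :=
  \big[minn/#|` T|]_(A <- fpowerset T |
    [&& [::] \in A, fsubset S A & induced_connected A]) #|` A|.

Section laws.
Context {R : realType}.

(* Law of the outcome of a two-stage experiment: x uniform in A, then an
   outcome of law m x. *)
Definition uniform_mixture (T : choiceType) (A : {fset T})
    (m : T -> set R -> \bar R) : set R -> \bar R :=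
  fun B => ((#|` A|%:R^-1)%:E * \sum_(x <- enum_fset A) m x B)%E.

Definition subsets_of_card (k : nat) (A : {fset word}) : {fset {fset word}} :=
  [fset S in fpowerset A | #|` S| == k]%fset.

(* Law of g (sp), sp being the number of vertices of the subtree spanned by the
   root and k distinct elements of V T chosen uniformly, T uniform in trees. *)
Definition sp_law (V : {fset word} -> {fset word}) (k : nat) (g : nat -> R)
    (trees : {fset {fset word}}) : set R -> \bar R :=
  uniform_mixture trees (fun T =>
    uniform_mixture (subsets_of_card k (V T)) (fun S =>
      \d_(g (spanning_size T S)))).

(* Law of the number of white balls after n more draws when i draws were made
   already and the urn holds b black and w white balls. *)
Fixpoint urn_from (l i n b w : nat) : {measure set nat -> \bar R} :=
  if n is n'.+1 then
    let extra : nat := (l %| i.+1)%N in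
    measure_add
      (mscale (b%:R / (b + w)%:R)%:nng (urn_from l i.+1 n' (b + 1 + extra) w))
      (mscale (w%:R / (b + w)%:R)%:nng (urn_from l i.+1 n' (b + extra) (w + 1)))
  else \d_w.

Definition urn (l n b w : nat) : {measure set nat -> \bar R} :=
  urn_from l 0 n b w.

Definition urn_norm (m l w : nat) : R :=
  (l.+1%:R / w%:R *
     fine (\int[urn l m 1 w]_N (N%:R ^+ l.+1)%:E)) `^ (l.+1%:R^-1).

Definition Gamma (s : R) : R :=
  \int[lebesgue_measure]_(t in `]0, +oo[) (t `^ (s - 1) * expR (- t)).

Definition GG_pdf (a b x : R) : R :=
  if 0 < x then b * x `^ (a - 1) * expR (- x `^ b) / Gamma (a / b) else 0.

Definition GG (a b : R) : set R -> \bar R :=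
  fun B => (\int[lebesgue_measure]_(x in B) (GG_pdf a b x)%:E)%E.

Definition kolmogorov (mu nu : set R -> \bar R) : R :=
  sup (range (fun x : R =>
    `|fine (mu `]-oo, x]%classic) - fine (nu `]-oo, x]%classic)|)).

End laws.

(* Main.v *)
(* A plane tree with a set S of marked nodes is a marked ordered tree, in which
   the subtree spanned by the root and S consists of the root and the nodes that
   have a marked descendant or are marked. So the law of the spanning size s is
   N(s) / sum N, where N(s) is the number of trees with k marks and span s.
   The generating function M of the trees with at least one mark solves
   M = P + Q M + R M^2, with P, Q, R explicit in the marking variables and the
   Catalan series C = 1 + x C^2; expanding the solution, N(s) is a sum of
   products of binomials and a ballot number. Up to a constant factor and terms
   of lower order this is W(s) g(s), with W(s) = s^(2k-1) (1 + O(1/s)) and g a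
   product of ratios close to exp(-s^2/(4n)) (binary trees) or exp(-s^2/n)
   (plane trees).
   In the urn, N (N + 1) has mean 2k(2n - 1) and N has mean O(sqrt n), hence
   mu^2 = 4n + O(sqrt n). With lam = 1/mu (or 2/mu), N(s) is thus proportional
   to h(s) = lam f(lam s) + O(lam^2 exp(-lam s)), f being the density of
   GG(2k,2). As 2k is even, the tail of GG(2k,2) at x is the elementary function
   exp(-x^2) sum_(i < k) x^(2i) / i!, and comparing its increments with h gives
   partial sums of h within O(lam) of the distribution function; in particular
   sum h = 1 + O(lam), so the constant of proportionality need not be known. *)

Require Import Defs.
From HB Require Import structures.
From mathcomp Require Import all_boot all_order all_algebra finmap.
From mathcomp Require Import all_classical all_reals all_analysis.
From mathcomp Require Import zify ring lra.

Set Implicit Arguments.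
Unset Strict Implicit.
Unset Printing Implicit Defensive.

Import Order.TTheory GRing.Theory Num.Theory.
Import numFieldNormedType.Exports.

Local Open Scope classical_set_scope.
Local Open Scope ring_scope.

(** * Marked trees *)

(** A uniform tree followed by uniform marks is a uniform marked tree because all trees of a class
    offer equally many candidates for marks (n leaves or 2n - 1 nodes for binary trees). Series are
    never formed: finite lists of trees satisfy the equations for C and M modulo a power of x, which
    is enough to read off a coefficient. The obstacle is uniformity in s: the ratios of ballot
    numbers look Gaussian for s of order sqrt n, while s runs up to order n. Every error is
    therefore made to carry a factor exp(-lam s). The profiles are approximated with error exp(-2
    lam s); one half absorbs the powers of lam s in the weight, the other makes the sum of lam^2
    exp(-lam s) of order lam. A profile lies below some exp(-tau q), with relative defect O(tau^2
    s^3); this is O(lam) for s of order 1/lam, and beyond that range the Gaussian pays for it. For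
    marked nodes of binary trees the count is a sum over the number l + 1 of ends of the spanned
    tree, and only the largest l matters to leading order. *)

(* Ordered forests with marked nodes: [Fcons b c r] consists of a first tree,
   whose root has mark b and whose subtrees form the forest c, and of the
   forest r of the remaining trees. *)
Inductive forest := Fnil | Fcons of bool & forest & forest.

Fixpoint forest_encode f : GenTree.tree unit :=
  if f is Fcons b c r then
    GenTree.Node b [:: forest_encode c; forest_encode r]
  else GenTree.Leaf tt.

Fixpoint forest_decode (t : GenTree.tree unit) :=
  if t is GenTree.Node b [:: c; r] then
    if forest_decode c is Some c' then
      if forest_decode r is Some r' then Some (Fcons (b == 1%N) c' r')
      else None
    else None
  else Some Fnil.

Lemma forest_encodeK : pcancel forest_encode forest_decode.
Proof. by elim=> //= -[] c -> r ->. Qed.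

HB.instance Definition _ := Countable.copy forest (pcan_type forest_encodeK).

Fixpoint forest_size f :=
  if f is Fcons _ c r then (forest_size c + forest_size r).+1 else 0%N.

Fixpoint forest_marks f :=
  if f is Fcons b c r then (b + forest_marks c + forest_marks r)%N else 0%N.

(* Number of nodes that are marked or have a marked descendant. *)
Fixpoint forest_span f :=
  if f is Fcons b c r then
    ((0 < b + forest_marks c) + forest_span c + forest_span r)%N
  else 0%N.

Fixpoint degree f := if f is Fcons _ _ r then (degree r).+1 else 0%N.

(** Preorder list of (mark, number of children), in the order of [fnodes]. Being binary, the number
    of leaves and the places of the marks are all read off it. *)
Fixpoint profile f :=
  if f is Fcons b c r then (b, degree c) :: profile c ++ profile r else [::].

(* In fnodes, fmarked and fspan, i is the rank of the first tree of the forest. *)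
Fixpoint fnodes (i : nat) f : seq (seq nat) :=
  if f is Fcons b c r then
    [:: i] :: map (cons i) (fnodes 0 c) ++ fnodes i.+1 r
  else [::].

Fixpoint fmarked (i : nat) f : seq (seq nat) :=
  if f is Fcons b c r then
    nseq b [:: i] ++ map (cons i) (fmarked 0 c) ++ fmarked i.+1 r
  else [::].

Fixpoint fspan (i : nat) f : seq (seq nat) :=
  if f is Fcons b c r then
    nseq (0 < b + forest_marks c)%N [:: i] ++
      map (cons i) (fspan 0 c) ++ fspan i.+1 r
  else [::].

Lemma mem_cons_map (T : eqType) (a b : T) v s :
  (a :: v \in map (cons b) s) = (a == b) && (v \in s).
Proof.
apply/mapP/andP => [[w ws [-> ->]]|[/eqP-> vs]]; last by exists v.
by rewrite eqxx.
Qed.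

Lemma nil_cons_map (T : eqType) (b : T) s : ([::] \in map (cons b) s) = false.
Proof. by apply/mapP => -[]. Qed.

Lemma mem_nseq1 (T : eqType) (b : bool) (x y : T) :
  (x \in nseq b y) = b && (x == y).
Proof. by case: b; rewrite //= inE. Qed.

(** * Common properties of the three listings of nodes *)

Section listings.
Variable L : nat -> forest -> seq (seq nat).
Hypothesis LE : forall i, L i Fnil = [::].
Hypothesis LN : forall i b c r, exists b' : bool,
  L i (Fcons b c r) = nseq b' [:: i] ++ map (cons i) (L 0 c) ++ L i.+1 r.

(** [fnodes], [fmarked] and [fspan] differ in whether the root [[:: i]] of the first tree is
    emitted, which is the bit [b']; the facts of this section are shared by all three. *)
Lemma listing_nil i f : ([::] \in L i f) = false.
Proof.
elim: f i => [|b c _ r IH] i; first by rewrite LE.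
have [b' ->] := LN i b c r.
by rewrite !mem_cat mem_nseq1 andbF nil_cons_map IH.
Qed.

Lemma listing_ge i f a v : a :: v \in L i f -> (i <= a)%N.
Proof.
elim: f i => [|b c _ r IH] i; first by rewrite LE.
have [b' ->] := LN i b c r.
rewrite !mem_cat mem_nseq1 mem_cons_map => /or3P[/andP[_ /eqP[->]]//||].
  by case/andP=> /eqP->.
by move/IH/ltnW.
Qed.

Lemma listing_uniq i f : uniq (L i f).
Proof.
elim: f i => [|b c IHc r IHr] i; first by rewrite LE.
have [b' ->] := LN i b c r.
rewrite !cat_uniq map_inj_uniq ?IHc ?IHr; last by move=> ? ? [].
have -> : uniq (nseq b' [:: i]) by case: b'.
rewrite andbT /=; apply/andP; split.
  apply/hasPn => v; rewrite mem_cat mem_nseq1 negb_and.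
  case: eqP => [->|]; last by rewrite orbT.
  rewrite mem_cons_map listing_nil andbF /= => /listing_ge.
  by rewrite ltnn.
apply/hasPn => -[|a v]; first by rewrite listing_nil.
move=> /listing_ge h; rewrite mem_cons_map; apply/negP => /andP[/eqP e _].
by rewrite e ltnn in h.
Qed.

End listings.

Lemma fnodesN i b c r : exists b' : bool,
  fnodes i (Fcons b c r) =
    nseq b' [:: i] ++ map (cons i) (fnodes 0 c) ++ fnodes i.+1 r.
Proof. by exists true. Qed.

Lemma fmarkedN i b c r : exists b' : bool,
  fmarked i (Fcons b c r) =
    nseq b' [:: i] ++ map (cons i) (fmarked 0 c) ++ fmarked i.+1 r.
Proof. by exists b. Qed.

Lemma fspanN i b c r : exists b' : bool,
  fspan i (Fcons b c r) =
    nseq b' [:: i] ++ map (cons i) (fspan 0 c) ++ fspan i.+1 r.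
Proof. by eexists. Qed.

Notation listed lem H := (lem _ (fun=> erefl) H).

Lemma size_fnodes i f : size (fnodes i f) = forest_size f.
Proof.
by elim: f i => //= b c IHc r IHr i; rewrite size_cat size_map IHc IHr.
Qed.

Lemma size_fmarked i f : size (fmarked i f) = forest_marks f.
Proof.
elim: f i => //= b c IHc r IHr i.
by rewrite !size_cat size_nseq size_map IHc IHr addnA.
Qed.

Lemma size_fspan i f : size (fspan i f) = forest_span f.
Proof.
elim: f i => //= b c IHc r IHr i.
by rewrite !size_cat size_nseq size_map IHc IHr addnA.
Qed.

Lemma fmarked_sub i f : {subset fmarked i f <= fnodes i f}.
Proof.
elim: f i => //= b c IHc r IHr i v.
rewrite inE !mem_cat mem_nseq1 => /or3P[/andP[_ ->]//|/mapP[w /IHc h ->]|/IHr->].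
  by rewrite map_f ?orbT.
by rewrite !orbT.
Qed.

(** Turns the recursive notion of span into prefix closure of the marked words. The empty word is
    excluded because a forest has no root of its own; [mem_tspan] restores it for trees. *)
Lemma mem_fspan i f (v : seq nat) : reflect
  (v != [::] /\ exists2 u, u \in fmarked i f & prefix v u) (v \in fspan i f).
Proof.
elim: f i v => [|b c IHc r IHr] i v; first by right; case=> _ [].
apply: (iffP idP).
  rewrite /= !mem_cat mem_nseq1 => /or3P[/andP[+ /eqP->]|/mapP[w + ->]|].
  - rewrite addn_gt0; case: b => /= [_|].
      by split=> //; exists [:: i]; rewrite ?inE /= ?eqxx.
    rewrite -(size_fmarked 0); case e : (fmarked 0 c) => [//|u s] _.
    split=> //; exists (i :: u); last by rewrite /= ?eqxx ?prefix0s.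
    by rewrite mem_cat mem_cons_map inE !eqxx.
  - move=> /IHc[_ [u uc wu]]; split=> //; exists (i :: u).
      by rewrite !mem_cat mem_cons_map eqxx uc orbT.
    by rewrite /= eqxx.
  - move=> /IHr[v0 [u ur vu]]; split=> //; exists u => //.
    by rewrite !mem_cat ur !orbT.
case=> v0 [u]; rewrite /= !mem_cat !mem_nseq1.
case/or3P=> [/andP[b1 /eqP->]|/mapP[w wc ->]|ur] vu; last first.
- apply/or3P; apply: Or33; apply/IHr; split=> //; by exists u.
- case: v v0 vu => [//|a v] _ /= /andP[/eqP-> vw].
  have [->|v0] := eqVneq v [::].
    rewrite eqxx andbT addn_gt0 orbC -(size_fmarked 0).
    by case: (fmarked 0 c) wc => //= *; rewrite !orbT.
  rewrite mem_cons_map eqxx /= (_ : v \in fspan 0 c) ?orbT//.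
  by apply/IHc; split=> //; exists w.
- rewrite b1 /=; case: v v0 vu => [//|a [|a' v]] _ /=; last by rewrite andbF.
  by case/andP=> /eqP->; rewrite eqxx.
Qed.

Lemma parent_cons_map i j u s : [::] \notin s ->
  count (parent (j :: u)) (map (cons i) s) = ((i == j) * count (parent u) s)%N.
Proof.
elim: s => [|v s IH]; first by rewrite muln0.
rewrite inE negb_or => /andP[v0 /IH /= ->]; rewrite mulnDr; congr (_ + _)%N.
case: v v0 => // a v _.
by rewrite /parent /= eqseq_cons /=; case: eqP => //=; rewrite mul1n.
Qed.

Lemma count_parent_nil i f : count (parent [::]) (fnodes i f) = degree f.
Proof.
elim: f i => //= b c IHc r IHr i; rewrite count_cat IHr.
rewrite /parent /= eqxx add1n; congr _.+1.
rewrite [X in (X + _)%N](_ : _ = 0%N)//; apply/eqP; rewrite -leqn0 leqNgt -has_count.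
apply/hasPn => v /mapP[w wc ->]; rewrite eqseq_cons.
rewrite negb_and; apply/orP; right; apply: contraTneq wc => ->.
by rewrite (listed listing_nil fnodesN).
Qed.

Lemma count_parent_other i f j u :
  (j < i)%N -> count (parent (j :: u)) (fnodes i f) = 0%N.
Proof.
move=> ji; apply/eqP; rewrite -leqn0 leqNgt -has_count.
apply/hasPn => -[|a v]; first by rewrite (listed listing_nil fnodesN).
move=> /(listed listing_ge fnodesN) ia; apply/negP => /eqP/= [e _].
by move: ia; rewrite e leqNgt ji.
Qed.

Lemma parent_short u v : (0 < size u)%N -> size v = 1%N -> parent u v = false.
Proof.
move=> u0 v1; apply/negP => /eqP/(congr1 size).
by rewrite v1 size_rcons => -[e]; rewrite -e in u0.
Qed.

(** Prepending [i] preserves parenthood and marks inside the first tree, and words of later trees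
    begin with larger ranks, so neither block contributes to the counts of the other. *)
Lemma fnodes_profile i f :
  [seq (u \in fmarked i f, count (parent u) (fnodes i f)) | u <- fnodes i f]
  = profile f.
Proof.
elim: f i => //= b c IHc r IHr i.
have nilc : [::] \notin fnodes 0 c by rewrite (listed listing_nil fnodesN).
congr (_ :: _).
  rewrite !mem_cat mem_nseq1 eqxx andbT mem_cons_map eqxx /=.
  rewrite (listed listing_nil fmarkedN) /=; congr pair.
    case: b => //=; apply/negP => /(listed listing_ge fmarkedN).
    by rewrite ltnn.
  rewrite count_cat parent_cons_map// eqxx mul1n count_parent_nil.
  rewrite count_parent_other// addn0 /parent /= eqseq_cons.
  by case: eqP.
rewrite map_cat -map_comp; congr (_ ++ _).
  rewrite -(IHc 0%N); apply/eq_in_map => v vc /=.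
  rewrite !mem_cat mem_nseq1 mem_cons_map eqxx /= count_cat parent_cons_map//.
  rewrite eqxx mul1n count_parent_other// addn0.
  rewrite parent_short// add0n eqseq_cons [X in _ && (_ && X)](_ : _ = false).
    rewrite !andbF; congr (_ || _, _); rewrite -[RHS]orbF; congr orb.
    by apply/negP => /(listed listing_ge fmarkedN); rewrite ltnn.
  by apply/negP => /eqP e; rewrite -e vc in nilc.
rewrite -(IHr i.+1); apply/eq_in_map => -[|a v].
  by rewrite (listed listing_nil fnodesN).
move=> /(listed listing_ge fnodesN) ia.
have ai : (a == i) = false by apply/negP => /eqP e; rewrite e ltnn in ia.
rewrite !mem_cat mem_nseq1 mem_cons_map eqseq_cons ai andbF /= count_cat.
by rewrite parent_cons_map// eq_sym ai mul0n parent_short.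
Qed.

Definition tree := (bool * forest)%type.
Definition tree_size (t : tree) := (forest_size t.2).+1.
Definition tree_marks (t : tree) := (t.1 + forest_marks t.2)%N.
Definition tree_span (t : tree) := ((0 < t.1 + forest_marks t.2) + forest_span t.2)%N.
Definition tprofile (t : tree) := (t.1, degree t.2) :: profile t.2.
Definition tnodes (t : tree) : seq word := [::] :: fnodes 0 t.2.
Definition tmarked (t : tree) : seq word := nseq t.1 [::] ++ fmarked 0 t.2.
Definition tspan (t : tree) : seq word :=
  nseq (0 < t.1 + forest_marks t.2)%N [::] ++ fspan 0 t.2.
Definition node_set (t : tree) : {fset word} := [fset u in tnodes t]%fset.
Definition mark_set (t : tree) : {fset word} := [fset u in tmarked t]%fset.

Lemma mem_node_set t u : (u \in node_set t) = (u \in tnodes t).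
Proof. by rewrite in_fset. Qed.

Lemma mem_mark_set t u : (u \in mark_set t) = (u \in tmarked t).
Proof. by rewrite in_fset. Qed.

Lemma tnodes_uniq t : uniq (tnodes t).
Proof.
by rewrite /= (listed listing_nil fnodesN) (listed listing_uniq fnodesN).
Qed.

Lemma nseq_cat_uniq (b : bool) (s : seq word) :
  [::] \notin s -> uniq s -> uniq (nseq b [::] ++ s).
Proof. by case: b => //= -> ->. Qed.

Lemma tmarked_uniq t : uniq (tmarked t).
Proof.
by rewrite nseq_cat_uniq ?(listed listing_nil fmarkedN)
  ?(listed listing_uniq fmarkedN).
Qed.

Lemma tspan_uniq t : uniq (tspan t).
Proof.
by rewrite nseq_cat_uniq ?(listed listing_nil fspanN)
  ?(listed listing_uniq fspanN).
Qed.

Lemma tnodes_profile t :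
  [seq (u \in tmarked t, count (parent u) (tnodes t)) | u <- tnodes t]
  = tprofile t.
Proof.
case: t => b f; rewrite /tprofile -(fnodes_profile 0) /=; congr (_ :: _).
  rewrite mem_cat mem_nseq1 eqxx andbT (listed listing_nil fmarkedN) orbF.
  by rewrite count_parent_nil /parent.
apply/eq_in_map => u uf; have u0 : u != [::].
  by apply: contraTneq uf => ->; rewrite (listed listing_nil fnodesN).
rewrite mem_cat mem_nseq1 (negPf u0) andbF /=; congr (_, _).
by rewrite -[RHS]add0n; congr addn; apply/eqP; rewrite eqb0 /parent; case: u u0 uf.
Qed.

Lemma mem_fnodes_cons a v i b c r :
  (a :: v \in fnodes i (Fcons b c r)) =
  (a == i) && ((v == [::]) || (v \in fnodes 0 c)) || (a :: v \in fnodes i.+1 r).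
Proof.
rewrite /= inE mem_cat mem_cons_map eqseq_cons orbA; congr orb.
by case: (a == i).
Qed.

Lemma mem_fmarked_cons a v i b c r :
  (a :: v \in fmarked i (Fcons b c r)) =
  (a == i) && (b && (v == [::]) || (v \in fmarked 0 c))
    || (a :: v \in fmarked i.+1 r).
Proof.
rewrite /= !mem_cat mem_nseq1 mem_cons_map eqseq_cons orbA; congr orb.
by case: (a == i); rewrite ?andbF.
Qed.

Lemma node_set_plane t : plane_tree (node_set t).
Proof.
(* Roots of [fnodes i f] are numbered from [i], so for the empty word [u] only siblings of rank at
   least [i] can be claimed. *)
have P f : forall i u j, rcons u j \in fnodes i f ->
    (u != [::] -> u \in fnodes i f) /\
    forall l, (l < j)%N -> (if u is [::] then i <= l else true)%N ->
      rcons u l \in fnodes i f.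
  elim: f => // b c IHc r IHr i [|a u] j.
    change (rcons [::] j) with [:: j]; rewrite mem_fnodes_cons eqxx andbT.
    move=> h; split=> // l lj il; change (rcons [::] l) with [:: l].
    case/orP: h lj => [/eqP->|h] lj.
      by move: lj; rewrite ltnNge il.
    rewrite mem_fnodes_cons eqxx andbT; case: eqP => //= /eqP li.
    by apply: (IHr i.+1 [::] j h).2 => //; rewrite ltn_neqAle eq_sym li.
  rewrite rcons_cons mem_fnodes_cons.
  have -> : rcons u j == [::] = false by case: (u).
  rewrite orFb; case/orP=> [/andP[/eqP-> h]|h]; last first.
    have [h1 h2] := IHr i.+1 (a :: u) j h; split.
      by move=> _; rewrite mem_fnodes_cons h1 ?orbT.
    by move=> l lj _; rewrite rcons_cons mem_fnodes_cons h2// orbT.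
  have [h1 h2] := IHc 0%N u j h; split.
    move=> _; rewrite mem_fnodes_cons eqxx.
    by have [//|u0] := eqVneq u [::]; rewrite h1 ?orbT.
  move=> l lj _; rewrite rcons_cons mem_fnodes_cons eqxx h2 ?orbT//.
  by case: (u).
split; first by rewrite !inE.
move=> u i; rewrite !inE => /orP[/eqP/(congr1 size)|/P[h1 h2]].
  by rewrite size_rcons.
split; first by case: eqP => //= /eqP.
by move=> j ji; rewrite !inE h2 ?orbT//; case: (u).
Qed.

Lemma card_node_set t : #|` node_set t| = tree_size t.
Proof.
by rewrite card_fseq undup_id ?tnodes_uniq//= size_fnodes.
Qed.

Lemma card_mark_set t : #|` mark_set t| = tree_marks t.
Proof.
rewrite card_fseq undup_id ?tmarked_uniq// size_cat size_nseq.
by rewrite size_fmarked.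
Qed.

Lemma card_filter_fset (s : seq word) (P : pred word) : uniq s ->
  #|` [fset v in [fset u in s] | P v]%fset| = count P s.
Proof.
move=> us; rewrite (_ : [fset v in _ | P v]%fset = [fset v in [seq v <- s | P v]]%fset).
  by rewrite card_fseq undup_id ?filter_uniq// size_filter.
by apply/fsetP => v; rewrite !inE mem_filter /= andbC.
Qed.

Lemma card_children t u :
  #|` children (node_set t) u| = count (parent u) (tnodes t).
Proof. exact: card_filter_fset (tnodes_uniq t). Qed.

Lemma mark_set_sub t : fsubset (mark_set t) (node_set t).
Proof.
apply/fsubsetP => u; rewrite mem_node_set mem_mark_set mem_cat mem_nseq1 inE.
by case/orP=> [/andP[_ ->]//|/fmarked_sub ->]; rewrite orbT.
Qed.

(** Words starting with [i] belong to the first tree and all others to the rest, so membership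
    determines the two parts separately. *)
Lemma forest_inj i f f' : fnodes i f =i fnodes i f' ->
  fmarked i f =i fmarked i f' -> f = f'.
Proof.
elim: f f' i => [|b c IHc r IHr] [|b' c' r'] i //.
- by move/(_ [:: i]); rewrite mem_fnodes_cons !eqxx.
- by move/(_ [:: i]); rewrite mem_fnodes_cons !eqxx.
move=> en em; have nr g v : i :: v \in fnodes i.+1 g = false.
  by apply/negP => /(listed listing_ge fnodesN); rewrite ltnn.
have mr g v : i :: v \in fmarked i.+1 g = false.
  by apply/negP => /(listed listing_ge fmarkedN); rewrite ltnn.
have n0 g j : [::] \in fnodes j g = false by rewrite (listed listing_nil fnodesN).
have m0 g j : [::] \in fmarked j g = false.
  by rewrite (listed listing_nil fmarkedN).
congr Fcons.
- have := em [:: i]; rewrite !mem_fmarked_cons !mr !m0 eqxx !orbF !andbT.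
  by [].
- apply: (IHc _ 0%N) => -[|a v]; rewrite ?n0 ?m0//.
    have := en [:: i, a & v]; rewrite !mem_fnodes_cons !nr eqxx !orbF.
    by [].
  have := em [:: i, a & v]; rewrite !mem_fmarked_cons !mr eqxx !orbF !andbF.
  by [].
- apply: (IHr _ i.+1) => -[|a v]; rewrite ?n0 ?m0//.
    have := en (a :: v); rewrite !mem_fnodes_cons.
    by case: (a =P i) => // ->; rewrite !nr.
  have := em (a :: v); rewrite !mem_fmarked_cons.
  by case: (a =P i) => // ->; rewrite !mr.
Qed.

Lemma tree_inj t t' :
  node_set t = node_set t' -> mark_set t = mark_set t' -> t = t'.
Proof.
case: t t' => [b f] [b' f'] /fsetP en /fsetP em; congr pair.
  have := em [::]; rewrite !mem_mark_set !mem_cat !mem_nseq1.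
  by rewrite !(listed listing_nil fmarkedN) !eqxx !orbF !andbT.
apply: (@forest_inj 0) => -[|a v].
- by rewrite !(listed listing_nil fnodesN).
- by have := en (a :: v); rewrite !mem_node_set !inE.
- by rewrite !(listed listing_nil fmarkedN).
- by have := em (a :: v); rewrite !mem_mark_set !mem_cat !mem_nseq1 !andbF.
Qed.

(** * Every plane tree with marked nodes comes from a marked tree *)

Definition extension (T : {fset word}) (u : word) (i : nat) (w : word) : bool :=
  if w is j :: _ then (i <= j)%N && (u ++ w \in T) else false.

Lemma plane_prefix (T : {fset word}) u v :
  plane_tree T -> u ++ v \in T -> u \in T.
Proof.
move=> [_ hT]; elim/last_ind: v => [|v i IH]; first by rewrite cats0.
by rewrite -rcons_cat => /hT[/IH].
Qed.

Lemma plane_contiguous (T : {fset word}) u i w :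
  plane_tree T -> extension T u i w -> rcons u i \in T.
Proof.
move=> pT; case: w => // j w /= /andP[ij].
rewrite -cat_rcons => /(plane_prefix pT) h.
have := (pT.2 _ _ h).2 i; rewrite leq_eqVlt in ij.
by case/orP: ij h => [/eqP->//|ij _]; apply.
Qed.

Lemma card_fset_lt (K : choiceType) (A B : {fset K}) x :
  x \notin A -> x \in B -> {subset A <= B} -> (#|` A| < #|` B|)%N.
Proof.
move=> xA xB AB; apply: fproper_ltn_card; rewrite fproperE.
apply/andP; split; first exact/fsubsetP.
by apply/negP => /fsubsetP/(_ _ xB); exact/negP.
Qed.

(** A finite set of words offers no structural recursion, so the induction is on the number of nodes
    below [u] through children of rank at least [i]. Descending to [rcons u i] and moving on to rank
    [i.+1] both lose the node [rcons u i]. *)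
Lemma plane_tree_forest (T S : {fset word}) u i : plane_tree T ->
  exists f, (forall w, (w \in fnodes i f) = extension T u i w) /\
    (forall w, (w \in fmarked i f) = extension T u i w && (u ++ w \in S)).
Proof.
move=> pT.
pose below u i := [fset v in T | [&& prefix u v, (size u < size v)%N
  & (i <= nth 0%N v (size u))%N]]%fset.
have [m] := ubnP #|` below u i|; elim: m u i => // m IH u i.
rewrite ltnS => cm.
case: (boolP (rcons u i \in T)) => uiT; last first.
  have no w : extension T u i w = false.
    by apply/negP => /(plane_contiguous pT); exact/negP.
  by exists Fnil; split=> w; rewrite no.
have ui_in : rcons u i \in below u i.
  by rewrite !inE uiT prefix_rcons size_rcons nth_rcons ltnn eqxx /= ltnSn leqnn.
have [|c [cn cm']] := IH (rcons u i) 0%N.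
  apply: leq_trans cm; apply: card_fset_lt ui_in _ => [|v].
    by rewrite !inE ltnn !andbF.
  rewrite !inE size_rcons /= andbT => /and3P[-> /prefixP[s ->] _].
  rewrite cat_rcons prefix_prefix size_cat /= addnS ltnS leq_addr /=.
  by rewrite nth_cat ltnn subnn /=.
have [|r [rn rm]] := IH u i.+1.
  apply: leq_trans cm; apply: card_fset_lt ui_in _ => [|v].
    by rewrite !inE nth_rcons ltnn eqxx ltnn !andbF.
  by rewrite !inE /= => /and4P[-> -> -> /ltnW ->].
exists (Fcons (rcons u i \in S) c r); split=> -[|a w].
- by rewrite (listed listing_nil fnodesN).
- rewrite mem_fnodes_cons cn rn /=.
  have [->|ai] := eqVneq a i.
    rewrite ltnn orbF leqnn /= -cat_rcons.
    by case: w => [|b w]; rewrite ?cats0 ?uiT.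
  by rewrite /= ltn_neqAle eq_sym ai.
- by rewrite (listed listing_nil fmarkedN).
- rewrite mem_fmarked_cons cm' rm /=.
  have [->|ai] := eqVneq a i.
    rewrite ltnn orbF leqnn /= -cat_rcons.
    by case: w => [|b w]; rewrite ?cats0 ?uiT /= ?andbT ?orbF// andbF.
  by rewrite /= ltn_neqAle eq_sym ai.
Qed.

Lemma tree_surj (T S : {fset word}) : plane_tree T -> fsubset S T ->
  exists t, node_set t = T /\ mark_set t = S.
Proof.
move=> pT /fsubsetP ST; have [f [fn fm]] := plane_tree_forest S [::] 0 pT.
exists ([::] \in S, f); split; apply/fsetP => -[|a w].
- by rewrite mem_node_set inE eqxx pT.1.
- by rewrite mem_node_set inE fn.
- rewrite mem_mark_set mem_cat mem_nseq1 eqxx andbT.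
  by rewrite (listed listing_nil fmarkedN) orbF.
- rewrite mem_mark_set mem_cat mem_nseq1 andbF fm /=.
  by case: (boolP (a :: w \in S)) => [/ST ->|]; rewrite ?andbF.
Qed.

(** * The spanned subtree as a prefix closure *)

Lemma mem_tspan t v : reflect
  (exists2 u, u \in tmarked t & prefix v u) (v \in tspan t).
Proof.
rewrite mem_cat mem_nseq1; apply: (iffP orP).
  case=> [/andP[+ /eqP->]|/mem_fspan[_ [u ut vu]]]; last first.
    by exists u => //; rewrite mem_cat ut orbT.
  move=> h; have : (0 < size (tmarked t))%N.
    by rewrite size_cat size_nseq size_fmarked.
  by case e : (tmarked t) => [//|u s] _; exists u; rewrite ?inE ?eqxx ?prefix0s.
case=> u ut vu; have [->|v0] := eqVneq v [::].
  left; rewrite andbT -(size_fmarked 0) -[X in (X + _)%N](size_nseq _ ([::] : word)).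
  by rewrite -size_cat -/(tmarked t); case: (tmarked t) ut.
right; apply/mem_fspan; split=> //.
move: ut; rewrite mem_cat mem_nseq1 => /orP[/andP[_ /eqP u0]|]; last by exists u.
by move: vu; rewrite u0 prefixs0 (negPf v0).
Qed.

Lemma prefix_rconsE (v u : word) i :
  prefix v (rcons u i) = (v == rcons u i) || prefix v u.
Proof.
elim: u v => [|a u IH] [|b v] //=.
  by rewrite eqseq_cons orbF; case: v.
by rewrite eqseq_cons IH; case: (b == a).
Qed.

Lemma bigmin_leq (I : eqType) (s : seq I) (P : pred I) (F : I -> nat) m i :
  i \in s -> P i -> (\big[minn/m]_(j <- s | P j) F j <= F i)%N.
Proof.
elim: s => // j s IH; rewrite inE big_cons => /orP[/eqP<- ->|/IH h Pi].
  exact: geq_minl.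
by case: ifP => _; rewrite ?geq_min h ?orbT.
Qed.

Lemma leq_bigmin (I : eqType) (s : seq I) (P : pred I) (F : I -> nat) m n :
  (n <= m)%N -> {in s, forall i, P i -> n <= F i}%N ->
  (n <= \big[minn/m]_(j <- s | P j) F j)%N.
Proof.
move=> nm nF; rewrite big_seq_cond.
elim/big_ind: _ => // [x y nx ny|i /andP[/nF]]; last exact.
by rewrite leq_min nx.
Qed.

(** The prefix closure of S is connected, as each of its words can be shortened letter by letter
    down to the root. It is minimal because a connected set containing the root and [u] contains
    every prefix of [u]. *)
Lemma spanning_size_prefixes (T S A : {fset word}) :
  plane_tree T -> fsubset S T -> S != fset0 ->
  (forall v, reflect (exists2 u, u \in S & prefix v u) (v \in A)) ->
  spanning_size T S = #|` A|.
Proof.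
move=> pT /fsubsetP ST S0 memA; have AT : fsubset A T.
  apply/fsubsetP => v /memA[u /ST uT /prefixP[w e]].
  by apply: (@plane_prefix _ _ w) => //; rewrite -e.
have rootA : [::] \in A.
  by case/fset0Pn: S0 => u uS; apply/memA; exists u; rewrite ?prefix0s.
apply/eqP; rewrite eqn_leq; apply/andP; split.
  apply: (@bigmin_leq _ _ _ (fun A : {fset word} => #|` A|)).
    by rewrite fpowersetE.
  rewrite rootA /=; apply/andP; split.
    by apply/fsubsetP => u uS; apply/memA; exists u => //; exact: prefix_refl.
  pose e (x y : A) := parent (val x) (val y) || parent (val y) (val x).
  have sym_e : connect_sym e.
    by apply: sym_connect_sym => x y; rewrite /e orbC.
  have toroot (x : A) : connect e x [` rootA]%fset.
    case: x => x xA.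
    elim/last_ind: x xA => [|x i IH] xA; first by rewrite (bool_irrelevance xA rootA).
    have xA' : x \in A.
      by case/memA: (xA) => u uS /(prefix_trans (prefix_rcons x i)) h; apply/memA; exists u.
    apply: connect_trans (IH xA'); apply: connect1.
    by rewrite /e /parent /= last_rcons eqxx orbT.
  apply/forallP => x; apply/forallP => y; change (is_true (connect e x y)).
  by apply: connect_trans (toroot x) _; rewrite sym_e.
apply: leq_bigmin => [|B _ /and3P[rootB /fsubsetP SB /forallP conB]].
  exact: fsubset_leq_card.
apply: fsubset_leq_card; apply/fsubsetP => v /memA[u /SB uB vu].
have [//|vB] := boolP (v \in B).
pose e (x y : B) := parent (val x) (val y) || parent (val y) (val x).
have /forallP/(_ [` rootB]%fset) con := conB [` uB]%fset.
change (is_true (connect e [` uB]%fset [` rootB]%fset)) in con.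
(* An edge leaving the set of extensions of [v] has [v] itself as an end, and [v] is not in [B]; so
   within [B] no path leads from [u] to the root. *)
have cl : fingraph.closed e [pred x : B | prefix v (val x)].
  move=> x y; rewrite /e /parent !inE.
  have nx (z : B) : (v == val z) = false.
    by apply: contraNF vB => /eqP->; exact: valP.
  case/orP=> /eqP E; first by rewrite [in RHS]E prefix_rconsE -E nx.
  by rewrite [in LHS]E prefix_rconsE -E nx.
have := closed_connect cl con; rewrite !inE /= vu.
by case: v vB {vu cl} => //; rewrite rootB.
Qed.

Lemma spanning_size_tree t : (0 < tree_marks t)%N ->
  spanning_size (node_set t) (mark_set t) = tree_span t.
Proof.
move=> m0; rewrite (@spanning_size_prefixes _ _ [fset u in tspan t]%fset).
- by rewrite card_fseq undup_id ?tspan_uniq// size_cat size_nseq size_fspan.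
- exact: node_set_plane.
- exact: mark_set_sub.
- by rewrite -cardfs_gt0 card_mark_set.
- move=> v; rewrite in_fset; apply: (iffP (mem_tspan _ _)) => -[u ut vu].
    by exists u; rewrite ?mem_mark_set.
  by exists u; rewrite -?mem_mark_set.
Qed.

(** * The law of the spanning size as a list of marked trees *)

Lemma card_subsets_of_card k (A : {fset word}) :
  #|` subsets_of_card k A| = 'C(#|` A|, k).
Proof.
pose F (B : {set A}) : {fset word} := [fset val x | x in B]%fset.
have FI : injective F.
  move=> B B' /fsetP E; apply/setP => x; have := E (val x).
  by rewrite !mem_imfset//=; exact: val_inj.
rewrite (_ : subsets_of_card k A = [fset F B | B in [set B : {set A} | #|B| == k]%SET]%fset).
  rewrite card_imfset//= -cardE card_draws; congr ('C(_, k)).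
  by rewrite cardfE.
apply/fsetP => S; apply/idP/imfsetP => /=.
  rewrite !inE /= fpowersetE => /andP[SA cS].
  have SE : S = F [set x : A | val x \in S]%SET.
    apply/fsetP => u; apply/idP/imfsetP => /= [uS|[x]]; last by rewrite inE => ? ->.
    by exists [` fsubsetP SA u uS]%fset => //; rewrite inE.
  exists [set x : A | val x \in S]%SET => //; rewrite inE.
  move: cS; rewrite {1}SE card_imfset//=; last exact: val_inj.
  by rewrite -cardE.
case=> B; rewrite inE => cB ->; rewrite !inE /= fpowersetE; apply/andP; split.
  by apply/fsubsetP => u /imfsetP[x /= _ ->]; exact: valP.
by rewrite card_imfset//= -?cardE//; exact: val_inj.
Qed.

Section law_as_list.
Variables (R : realType) (V : {fset word} -> {fset word}) (k v : nat).
Variables (Ts : {fset {fset word}}) (L : seq tree).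
Hypothesis k0 : (0 < k)%N.
Hypothesis uL : uniq L.
Hypothesis memL : forall t, t \in L <->
  node_set t \in Ts /\ fsubset (mark_set t) (V (node_set t)).
Hypothesis plane : forall T, T \in Ts -> plane_tree T.
Hypothesis Vsub : forall T, T \in Ts -> fsubset (V T) T.
Hypothesis cardV : forall T, T \in Ts -> #|` V T| = v.

(** The pairs (T, S) and the marked trees with k marks are in bijection, by [tree_inj] and
    [tree_surj]. *)
Lemma sum_marked_trees (F : {fset word} -> {fset word} -> R) :
  \sum_(T <- enum_fset Ts) \sum_(S <- enum_fset (subsets_of_card k (V T))) F T S
  = \sum_(t <- L | tree_marks t == k) F (node_set t) (mark_set t).
Proof.
rewrite -(big_allpairs_dep (I2 := fun=> {fset word}) (h := fun T S => (T, S))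
  (F := fun x => F x.1 x.2)).
rewrite -[RHS]big_filter.
rewrite -[RHS](big_map (fun t => (node_set t, mark_set t)) xpredT
  (fun x => F x.1 x.2)).
apply: perm_big; apply: uniq_perm.
- apply: allpairs_uniq_dep; first exact: fset_uniq.
    by move=> T _; exact: fset_uniq.
  by move=> [T S] [T' S'] _ _ /= [-> ->].
- rewrite map_inj_in_uniq ?filter_uniq// => t t' _ _ [].
  exact: tree_inj.
move=> [T S]; apply/allpairsPdep/mapP => /=.
  move=> [T' [S' [TT]]]; rewrite !inE /= fpowersetE => /andP[SV cS] [-> ->].
  have [t [tT tS]] := tree_surj (plane TT) (fsubset_trans SV (Vsub TT)).
  exists t; last by rewrite tT tS.
  by rewrite mem_filter -card_mark_set tS cS; apply/memL; rewrite tT tS.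
move=> [t]; rewrite mem_filter => /andP[/eqP mt /memL[tT tV]] [-> ->].
exists (node_set t), (mark_set t); split=> //.
by rewrite !inE /= fpowersetE tV card_mark_set mt eqxx.
Qed.

(** Since every [V T] has cardinality [v], each tree carries the same number C(v, k) of mark sets,
    and the two-stage experiment is uniform on pairs. *)
Lemma sp_law_list (g : nat -> R) (B : set R) :
  sp_law V k g Ts B =
    ((\sum_(t <- L | tree_marks t == k) \1_B (g (tree_span t))) /
     \sum_(t <- L | tree_marks t == k) 1)%:E.
Proof.
have cs T : T \in Ts -> #|` subsets_of_card k (V T)| = 'C(v, k).
  by move=> /cardV <-; exact: card_subsets_of_card.
rewrite /sp_law /uniform_mixture.
have -> : \sum_(t <- L | tree_marks t == k) (1 : R) = #|` Ts|%:R * ('C(v, k))%:R.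
  rewrite -(sum_marked_trees (fun _ _ => 1)).
  rewrite (eq_big_seq (fun=> ('C(v, k))%:R)) => [|T TT]; rewrite -?(cs _ TT).
    by rewrite big_const_seq count_predT iter_addr_0 mulr_natl.
  by rewrite big_const_seq count_predT iter_addr_0.
have -> : \sum_(t <- L | tree_marks t == k) \1_B (g (tree_span t)) =
    \sum_(t <- L | tree_marks t == k)
      \1_B (g (spanning_size (node_set t) (mark_set t))) :> R.
  by apply: eq_bigr => t /eqP mt; rewrite spanning_size_tree// mt.
rewrite -(sum_marked_trees (fun T S => \1_B (g (spanning_size T S)))).
rewrite (_ : (\sum_(T <- _) _)%E = \sum_(T <- enum_fset Ts) 
   (('C(v, k))%:R^-1 * \sum_(S <- enum_fset (subsets_of_card k (V T)))
     \1_B (g (spanning_size T S)))%:E)%E; last first.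
  apply: eq_big_seq => T TT; rewrite (cs _ TT) EFinM -sumEFin.
  by congr (_ * _)%E; apply: eq_bigr => S _; rewrite diracE indicE.
by rewrite sumEFin -EFinM -mulr_sumr invfM mulrA mulrC.
Qed.

End law_as_list.

(** * Catalan series and quadratic equations *)

(* ballot n a is the coefficient of x^n in C(x)^a, C = 1 + x C^2. *)
Fixpoint ballot n : nat -> nat :=
  if n is n'.+1 then
    fix ballotS a := if a is a'.+1 then (ballotS a' + ballot n' a'.+2)%N else 0%N
  else fun=> 1%N.

Section truncated_series.
Variables (A : comNzRingType) (x : A).
Implicit Types (p q r s : A) (N : nat).

(** Congruence modulo [x ^+ N]: power series in x are represented by ring elements known up to a
    power of x. *)
Definition eqm N p q := exists r, p - q = x ^+ N * r.

Lemma eqmxx N p : eqm N p p.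
Proof. by exists 0; rewrite subrr mulr0. Qed.

Lemma eqm_sym N p q : eqm N p q -> eqm N q p.
Proof. by case=> r e; exists (- r); rewrite mulrN -e opprB. Qed.

Lemma eqm_trans N q p r : eqm N p q -> eqm N q r -> eqm N p r.
Proof. by case=> u e [v f]; exists (u + v); rewrite mulrDr -e -f; ring. Qed.

Lemma eqmD N p q r s : eqm N p q -> eqm N r s -> eqm N (p + r) (q + s).
Proof. by case=> u e [v f]; exists (u + v); rewrite mulrDr -e -f; ring. Qed.

Lemma eqmM N p q r s : eqm N p q -> eqm N r s -> eqm N (p * r) (q * s).
Proof.
case=> u e [v f]; exists (u * r + q * v).
by rewrite mulrDr mulrA -e mulrCA -f; ring.
Qed.

Lemma eqm_sum N (I : Type) (t : seq I) (P : pred I) (F G : I -> A) :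
  (forall i, P i -> eqm N (F i) (G i)) ->
  eqm N (\sum_(i <- t | P i) F i) (\sum_(i <- t | P i) G i).
Proof. move=> FG; elim/big_ind2: _ => // [|? ? ? ?]; [exact: eqmxx|exact: eqmD]. Qed.

Lemma eqmX N p q n : eqm N p q -> eqm N (p ^+ n) (q ^+ n).
Proof.
by move=> pq; elim: n => [|n IH]; [exact: eqmxx|rewrite !exprS; exact: eqmM].
Qed.

Lemma eqm_weaken N N' p q : (N <= N')%N -> eqm N' p q -> eqm N p q.
Proof.
by move=> NN [r e]; exists (x ^+ (N' - N) * r); rewrite e mulrA -exprD subnKC.
Qed.

Lemma eqm0M N n p q : eqm n p 0 -> eqm N q 0 -> eqm (n + N) (p * q) 0.
Proof.
case=> u; rewrite subr0 => -> [v]; rewrite subr0 => ->; exists (u * v).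
by rewrite subr0 exprD; ring.
Qed.

Lemma eqm_subr0 N p q : eqm N (p - q) 0 -> eqm N p q.
Proof. by case=> r e; exists r; rewrite -e ?subr0. Qed.

Lemma eqm_sub0 N p q : eqm N p q -> eqm N (p - q) 0.
Proof. by case=> r e; exists r; rewrite -e ?subr0. Qed.

Lemma eqm0X N p : eqm 1 p 0 -> eqm N (p ^+ N) 0.
Proof.
move=> p0; elim: N => [|N IH]; last by rewrite exprS -add1n; exact: eqm0M.
by exists 1; rewrite subr0 mulr1.
Qed.

(** Iteration gives p = p e^N modulo x^N, and e^N is divisible by x^N. This replaces division by the
    unit 1 - e. *)
Lemma eqm_contract N p e : eqm 1 e 0 -> eqm N p (p * e) -> eqm N p 0.
Proof.
move=> e0 pe; have pj j : eqm N p (p * e ^+ j).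
  elim: j => [|j IH]; first by rewrite expr0 mulr1; exact: eqmxx.
  apply: eqm_trans pe _; rewrite exprS mulrA mulrAC.
  exact: eqmM IH (eqmxx _ _).
apply: eqm_trans (pj N) _; rewrite -[X in eqm _ _ X](mulr0 p).
by apply: eqmM (eqmxx _ _) _; exact: eqm0X.
Qed.

(** Picard iterate of C = 1 + w C^2. For w = x it is exactly the generating polynomial of the
    unmarked members of [forests h], see [unmarked_forests]. *)
Fixpoint catp (w : A) h := if h is h'.+1 then 1 + w * catp w h' ^+ 2 else 1.

Lemma catpE (w : A) h : eqm 1 w 0 ->
  eqm h.+1 (catp w h) (1 + w * catp w h ^+ 2).
Proof.
move=> w0; elim: h => [|h IH].
  rewrite /= expr1n mulr1 -[X in eqm _ X _]addr0.
  by apply: eqmD (eqmxx _ _) (eqm_sym w0).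
rewrite [X in eqm _ X _]/=; apply: eqmD (eqmxx _ _) _; apply: eqm_subr0.
rewrite -mulrBr -(add1n h.+1); apply: eqm0M => //; apply: eqm_sub0.
exact: eqmX.
Qed.

(* Truncation of C(w)^a at w^N. *)
Definition cat_trunc (w : A) N a := \sum_(n < N) w ^+ n *+ ballot n a.

Lemma cat_trunc0 w N : cat_trunc w N.+1 0 = 1.
Proof.
rewrite /cat_trunc big_ord_recl /= expr0 mulr1n big1 ?addr0//.
Qed.

Lemma cat_truncS w N a :
  cat_trunc w N.+1 a.+1 = cat_trunc w N.+1 a + w * cat_trunc w N a.+2.
Proof.
rewrite /cat_trunc !big_ord_recl /= -addrA mulr_sumr -big_split /=.
congr (_ + _); apply: eq_bigr => i _.
by rewrite mulrnDr exprS mulrnAr.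
Qed.

(** C^(b+1) = C^b + w C^(b+2) is the recursion of [ballot]. The exponent grows in the last term, but
    its factor w gains one power of x; hence an outer induction on the precision j and an inner one
    on b. *)
Lemma catpX (w : A) h a : eqm 1 w 0 ->
  eqm h.+1 (catp w h ^+ a) (cat_trunc w h.+1 a).
Proof.
move=> w0; suff H j b : (j <= h.+1)%N -> eqm j (catp w h ^+ b) (cat_trunc w h.+1 b).
  exact: H.
elim: j b => [|j IH] b jh; first by exists (catp w h ^+ b - cat_trunc w h.+1 b); rewrite mul1r.
elim: b => [|b IHb]; first by rewrite cat_trunc0; exact: eqmxx.
rewrite cat_truncS.
have h1 : eqm j.+1 (catp w h ^+ b.+1) (catp w h ^+ b + w * catp w h ^+ b.+2).
  rewrite (_ : _ + _ = catp w h ^+ b * (1 + w * catp w h ^+ 2)); last by rewrite !exprS; ring.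
  rewrite exprSr; apply: eqmM (eqmxx _ _) _.
  by apply: eqm_weaken jh _; exact: catpE.
apply: eqm_trans h1 _; apply: eqmD IHb _; apply: eqm_subr0; rewrite -mulrBr.
rewrite -(add1n j); apply: eqm0M => //; apply: eqm_sub0.
(* The truncations at [h.+1] and at [h] differ by a multiple of w^h, which vanishes modulo x^j
   because j <= h. *)
apply: eqm_trans (IH _ (ltnW jh)) _; rewrite /cat_trunc big_ord_recr /=.
apply: eqm_subr0; rewrite addrAC subrr add0r.
rewrite -mulr_natl; rewrite -[X in eqm _ _ X](mulr0 (ballot h b.+2)%:R).
apply: eqmM (eqmxx _ _) _; apply: eqm_weaken (_ : j <= h)%N _ => //.
exact: eqm0X.
Qed.

(* Truncation of (1 - q)^-(r + 1) at q^N. *)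
Definition geom (q : A) N (r : nat) := \sum_(i < N) q ^+ i *+ 'C(i + r, r).

Lemma geomS q N (r : nat) :
  geom q N r.+1 * (1 - q) = geom q N r - q ^+ N *+ 'C(N + r, r.+1).
Proof.
elim: N => [|N IH].
  by rewrite /geom !big_ord0 mul0r add0n bin_small// mulr0n subr0.
rewrite /geom !big_ord_recr /= mulrDl -/(geom q N r.+1) IH -/(geom q N r).
by rewrite addnS addSn binS !mulrnDr exprS; ring.
Qed.

(** [geom q N 0] inverts [1 - q] modulo [x ^+ N], so [geomS] can be solved for the next power. *)
Lemma geomX q N (r : nat) : eqm 1 q 0 -> eqm N (geom q N 0 ^+ r.+1) (geom q N r).
Proof.
move=> q0; have qN c : eqm N (q ^+ N *+ c) 0.
  rewrite -mulr_natl -[X in eqm _ _ X](mulr0 c%:R).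
  exact: eqmM (eqmxx _ _) (eqm0X N q0).
have geom1 : eqm N (geom q N 0 * (1 - q)) 1.
  apply: eqm_subr0; rewrite (_ : _ - 1 = - (q ^+ N *+ 1)).
    rewrite -mulN1r -[X in eqm _ _ X](mulr0 (-1)); exact: eqmM (eqmxx _ _) _.
  elim: N {qN} => [|N IH]; first by rewrite /geom big_ord0 mul0r; ring.
  rewrite /geom big_ord_recr /= mulrDl -/(geom q N 0) -[geom q N 0 * _](subrK 1) IH.
  by rewrite bin0 exprS; ring.
have V s : eqm N s (s * (1 - q) * geom q N 0).
  rewrite -mulrA [(1 - q) * _]mulrC -[X in eqm _ X _]mulr1.
  by apply: eqmM (eqmxx _ _) (eqm_sym geom1).
elim: r => [|r IH]; first exact: eqmxx.
rewrite exprSr; apply: eqm_sym; apply: eqm_trans (V _) _.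
apply: eqmM (eqmxx _ _); apply: eqm_sym; apply: eqm_trans IH _.
rewrite geomS -[X in eqm _ X _]subr0; apply: eqmD (eqmxx _ _) _.
have [u e] := qN 'C(N + r, r.+1); exists u.
by rewrite opprK addrC -e; ring.
Qed.

Lemma geom0 q N : geom q N 0 * (1 - q) = 1 - q ^+ N.
Proof.
elim: N => [|N IH]; first by rewrite /geom big_ord0 mul0r subrr.
rewrite /geom big_ord_recr /= mulrDl -/(geom q N 0) IH.
by rewrite bin0 exprS; ring.
Qed.

(* The difference of two solutions is itself times q + r (m + m'), which is
   divisible by x. *)
Lemma quadratic_unique N (p q r m m' : A) :
  eqm 1 q 0 -> eqm 1 m 0 -> eqm 1 m' 0 ->
  eqm N m (p + q * m + r * m ^+ 2) ->
  eqm N m' (p + q * m' + r * m' ^+ 2) -> eqm N m m'.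
Proof.
move=> q0 m0 m'0 [u me] [v m'e]; apply: eqm_subr0.
apply: (@eqm_contract _ _ (q + r * (m + m'))).
  case: q0 m0 m'0 => a; rewrite subr0 => -> [b]; rewrite subr0 => -> [c].
  by rewrite subr0 => ->; exists (a + r * (b + c)); rewrite expr1; ring.
exists (u - v); rewrite mulrBr -me -m'e; ring.
Qed.

(** With V = 1/(1 - q) and w = p r V^2, the substitution m = p V C(w) reduces the equation to C = 1
    + w C^2, and [quadratic_unique] selects this root. The term l of C(w) carries V^(2l+1), whose
    expansion in q gives the binomial. *)
Lemma quadratic_solution N (p q r m : A) :
  eqm 1 p 0 -> eqm 1 q 0 -> eqm 1 m 0 ->
  eqm N.+1 m (p + q * m + r * m ^+ 2) ->
  eqm N.+1 m (\sum_(l < N.+1) \sum_(i < N.+1)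
    p ^+ l.+1 * r ^+ l * q ^+ i *+ (ballot l 1 * 'C(i + 2 * l, 2 * l))).
Proof.
move=> p0 q0 m0 me; pose V := geom q N.+1 0; pose w := p * r * V ^+ 2.
have w0 : eqm 1 w 0.
  rewrite /w -mulrA -[X in eqm _ _ X](mul0r (r * V ^+ 2)).
  exact: eqmM p0 (eqmxx _ _).
pose m' := p * V * catp w N.
have m'0 : eqm 1 m' 0.
  rewrite /m' -mulrA -[X in eqm _ _ X](mul0r (V * catp w N)).
  exact: eqmM p0 (eqmxx _ _).
have VE : eqm N.+1 V (1 + q * V).
  have [u qN] := eqm0X N.+1 q0; exists (- u).
  rewrite mulrN -qN subr0 -[q ^+ _](subKr 1) -geom0 /V.
  by ring.
have m'e : eqm N.+1 m' (p + q * m' + r * m' ^+ 2).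
  have h1 : eqm N.+1 m' (p * (1 + q * V) * catp w N).
    exact: eqmM (eqmM (eqmxx _ _) VE) (eqmxx _ _).
  apply: eqm_trans h1 _.
  rewrite (_ : p * _ * _ = p * catp w N + q * m'); last by rewrite /m'; ring.
  rewrite (_ : p + _ + _ = p * (1 + w * catp w N ^+ 2) + q * m').
    by apply: eqmD (eqmxx _ _); apply: eqmM (eqmxx _ _) (catpE _ w0).
  by rewrite /m' /w; ring.
apply: eqm_trans (quadratic_unique q0 m0 m'0 me m'e) _.
have h2 := catpX N 1 w0; rewrite expr1 in h2.
apply: eqm_trans (eqmM (eqmxx _ (p * V)) h2) _.
rewrite /cat_trunc mulr_sumr; apply: eqm_sum => l _.
have h3 := geomX N.+1 (2 * l) q0; rewrite -/V in h3.
rewrite (_ : _ * (_ *+ _) = p ^+ l.+1 * r ^+ l * V ^+ (2 * l).+1 *+ ballot l 1).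
  rewrite (_ : \sum_(i < _) _ =
      p ^+ l.+1 * r ^+ l * geom q N.+1 (2 * l) *+ ballot l 1).
    rewrite -mulr_natr -[X in eqm _ _ X]mulr_natr.
    exact: eqmM (eqmM (eqmxx _ _) h3) (eqmxx _ _).
  rewrite /geom mulr_sumr -sumrMnl; apply: eq_bigr => i _.
  by rewrite mulrnAr -mulrnA mulnC.
rewrite mulrnAr /w exprMn [(p * r) ^+ l]exprMn -exprM [p ^+ _]exprS.
by rewrite [V ^+ _.+1]exprS; congr (_ *+ _); ring.
Qed.

End truncated_series.

(** * Enumeration of marked trees *)

Definition trees_of (F : seq forest) : seq tree :=
  [seq (b, f) | b <- [:: true; false], f <- F].

(** Contains all forests of size at most h and some larger ones; the latter disappear when trees are
    filtered by size or the coefficient of x^n is taken. *)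
Fixpoint forests h : seq forest :=
  if h is h'.+1 then
    Fnil :: [seq Fcons t.1 t.2 r | t <- trees_of (forests h'), r <- forests h']
  else [:: Fnil].

Lemma mem_trees_of F t : (t \in trees_of F) = (t.2 \in F).
Proof.
case: t => b f; apply/allpairsP/idP => [[[b' f']] /= [_ h [_ ->]]//|h].
by exists (b, f); split=> //=; case: (b).
Qed.

Lemma trees_of_uniq F : uniq F -> uniq (trees_of F).
Proof. by move=> uF; apply: allpairs_uniq => // -[b f] [b' f'] _ _ [-> ->]. Qed.

Lemma forests_uniq h : uniq (forests h).
Proof.
elim: h => //= h IH; apply/andP; split.
  by apply/negP => /allpairsP[[[b c] r]] [].
by apply: allpairs_uniq => [||[[b c] r] [[b' c'] r'] _ _ /= [-> -> ->]] //;
  exact: trees_of_uniq.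
Qed.

Lemma mem_forests h f : (forest_size f <= h)%N -> f \in forests h.
Proof.
elim: h f => [|h IH] [|b c r] //=; rewrite ltnS => fh.
rewrite inE /=; apply/allpairsP; exists ((b, c), r); split=> //=.
  by rewrite mem_trees_of IH//; apply: leq_trans fh; exact: leq_addr.
by rewrite IH//; apply: leq_trans fh; exact: leq_addl.
Qed.

(* Binary trees of height at most h; the internal nodes may carry marks only
   if m is true. *)
Fixpoint btrees (m : bool) h : seq tree :=
  if h is h'.+1 then
    [seq (b, Fnil) | b <- [:: true; false]] ++
    [seq (b, Fcons p.1.1 p.1.2 (Fcons p.2.1 p.2.2 Fnil)) |
       b <- (if m then [:: true; false] else [:: false]),
       p <- [seq (t, u) | t <- btrees m h', u <- btrees m h']]
  else [::].

Definition bprofile (m : bool) (p : bool * nat) :=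
  ((p.2 == 0) || (p.2 == 2)%N) && (p.1 ==> m || (p.2 == 0))%N.

Definition tleaves (t : tree) := count (fun p => p.2 == 0)%N (tprofile t).

Lemma btrees_uniq m h : uniq (btrees m h).
Proof.
elim: h => //= h IH; apply/andP; split.
  by rewrite inE /=; apply/negP => /allpairsP[[b p] []].
apply/andP; split.
  by apply/negP => /allpairsP[[b p] []].
apply: allpairs_uniq; first by case: (m).
  by apply: allpairs_uniq => // -[t u] [t' u'] _ _ [-> ->].
move=> [b [[b1 f1] [b2 f2]]] [b' [[b1' f1'] [b2' f2']]] _ _ /=.
by move=> [-> -> -> -> ->].
Qed.

Lemma profile_leaves f : f != Fnil ->
  (0 < count (fun p => p.2 == 0) (profile f))%N.
Proof.
elim: f => // b c IHc r IHr _ /=; rewrite count_cat.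
case: c IHc => [|b' c r'] IHc; first by rewrite add1n.
by rewrite addnA addn_gt0 addn_gt0 IHc ?orbT.
Qed.

Lemma tleaves_gt0 t : (0 < tleaves t)%N.
Proof.
case: t => b [|b' c r]; first by [].
by rewrite /tleaves [tprofile _]/= /= addn_gt0 orbC (@profile_leaves (Fcons b' c r)).
Qed.

Lemma tprofile_two b b1 f1 b2 f2 :
  tprofile (b, Fcons b1 f1 (Fcons b2 f2 Fnil)) =
  (b, 2%N) :: tprofile (b1, f1) ++ tprofile (b2, f2).
Proof. by rewrite /tprofile /= cats0. Qed.

Lemma tleaves_two b b1 f1 b2 f2 :
  tleaves (b, Fcons b1 f1 (Fcons b2 f2 Fnil)) =
  (tleaves (b1, f1) + tleaves (b2, f2))%N.
Proof. by rewrite /tleaves tprofile_two -cat1s !count_cat. Qed.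

(** The height bound is met because each of the two subtrees has at least one leaf, hence the other
    has strictly fewer leaves than the whole. *)
Lemma mem_btrees m h t : (tleaves t <= h)%N ->
  (t \in btrees m h) = all (bprofile m) (tprofile t).
Proof.
elim: h t => [|h IH] [b f] lh.
  by move: (tleaves_gt0 (b, f)); rewrite ltnNge lh.
have E g : (b, g) \in btrees m h.+1 = (g == Fnil) ||
    ((b, g) \in [seq (b, Fcons p.1.1 p.1.2 (Fcons p.2.1 p.2.2 Fnil)) |
       b <- (if m then [:: true; false] else [:: false]),
       p <- [seq (t, u) | t <- btrees m h, u <- btrees m h]]).
  by rewrite [btrees _ _]/= !inE !xpair_eqE orbA -andb_orl; case: b lh.
rewrite E {E}; case: f lh => [|b1 f1 [|b2 f2 [|b3 f3 r]]] lh.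
- by rewrite eqxx /bprofile /= orbT implybT.
- by rewrite /=; apply/negP => /allpairsP[[b' p] []].
- rewrite tleaves_two in lh.
  have l1 : (tleaves (b1, f1) <= h)%N by have := tleaves_gt0 (b2, f2); lia.
  have l2 : (tleaves (b2, f2) <= h)%N by have := tleaves_gt0 (b1, f1); lia.
  rewrite tprofile_two -[(b, 2%N) :: _]cat1s !all_cat -(IH _ l1) -(IH _ l2) all_seq1 orFb.
  rewrite /bprofile orbF; apply/allpairsP/and3P => /=.
    case=> [[b' [t u]]] /= [mb /allpairsP[[t' u'] /= [tm um [-> ->]]]].
    case: t' u' tm um => [b1' f1'] [b2' f2'] tm um [-> -> -> -> ->].
    split=> //; case: (m) mb => [_|]; first by rewrite implybT.
    by rewrite inE => /eqP->.
  case=> mb h1 h2; exists (b, ((b1, f1), (b2, f2))); split=> //=.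
    by case: (m) (b) mb => -[].
  by apply/allpairsP; exists ((b1, f1), (b2, f2)); split.
- by rewrite /=; apply/negP => /allpairsP[[b' p] []].
Qed.

Lemma tree_size_binary m t : all (bprofile m) (tprofile t) ->
  (tree_size t).+1 = (2 * tleaves t)%N.
Proof.
have [h] := ubnP (tleaves t); elim: h t => // h IH [b f].
rewrite ltnS => lh; case: f lh => [|b1 f1 [|b2 f2 [|b3 f3 r]]] lh //.
rewrite tprofile_two -[(b, 2%N) :: _]cat1s !all_cat => /and3P[_ h1 h2].
rewrite tleaves_two in lh *.
have l1 := tleaves_gt0 (b1, f1); have l2 := tleaves_gt0 (b2, f2).
have e1 : (tree_size (b1, f1)).+1 = (2 * tleaves (b1, f1))%N by apply: IH => //; lia.
have e2 : (tree_size (b2, f2)).+1 = (2 * tleaves (b2, f2))%N by apply: IH => //; lia.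
by move: e1 e2; rewrite /tree_size /=; lia.
Qed.

Section lists_of_trees.
Variable n : nat.
Hypothesis n0 : (0 < n)%N.

Definition plane_list := [seq t <- trees_of (forests n) | tree_size t == n].
(** Binary trees are indexed by their number n of leaves, as [tree_size_binary] turns this into 2n -
    1 nodes; accordingly x records leaves in [btree_weight]. *)
Definition btree_list m := [seq t <- btrees m n | tleaves t == n].

Lemma mem_plane_list t : t \in plane_list <->
  node_set t \in plane_trees n /\ fsubset (mark_set t) (nodes (node_set t)).
Proof.
rewrite mem_filter mem_trees_of plane_treesP /nodes card_node_set.
split=> [/andP[/eqP e _]|[[_ e] _]].
  by split; [split=> //; exact: node_set_plane|exact: mark_set_sub].
by rewrite e eqxx mem_forests// -e ltnW.
Qed.

Lemma all_tprofile (P : pred (bool * nat)) t : reflect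
  (forall u, u \in tnodes t -> P (u \in tmarked t, #|` children (node_set t) u|))
  (all P (tprofile t)).
Proof.
rewrite -tnodes_profile all_map; apply: (iffP allP) => h u ut.
  by rewrite card_children; exact: h.
by have := h u ut; rewrite card_children.
Qed.

Lemma binary_node_set t : binary (node_set t) <-> all (bprofile true) (tprofile t).
Proof.
split=> [h|/all_tprofile h u].
  apply/all_tprofile => u ut; have := h u; rewrite mem_node_set => /(_ ut).
  by rewrite /bprofile /= implybT andbT => -[->|->].
rewrite mem_node_set => /h; rewrite /bprofile /= implybT andbT.
by case/orP=> /eqP; [left|right].
Qed.

Lemma leaves_node_set t : #|` leaves (node_set t)| = tleaves t.
Proof.
rewrite /leaves (card_filter_fset _ (tnodes_uniq t)).
rewrite /tleaves -tnodes_profile count_map; apply: eq_count => u /=.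
by rewrite card_children.
Qed.

Lemma mem_leaves T u :
  (u \in leaves T) = (u \in T) && (#|` children T u| == 0)%N.
Proof. by rewrite /leaves !inE. Qed.

Lemma mem_btree_list (m : bool) t : t \in btree_list m <->
  node_set t \in binary_trees (2 * n - 1) /\
  fsubset (mark_set t) ((if m then nodes else leaves) (node_set t)).
Proof.
rewrite mem_filter binary_treesP /nodes card_node_set.
split=> [/andP[/eqP e]|[[_ bt e] st]].
  rewrite mem_btrees ?e// => ab; have := tree_size_binary ab; rewrite e => s.
  split; first split.
  - exact: node_set_plane.
  - apply/binary_node_set; apply: sub_all ab => p.
    by rewrite /bprofile => /andP[-> _]; rewrite implybT.
  - by lia.
  case: m ab => ab; first exact: mark_set_sub.
  apply/fsubsetP => u; rewrite mem_mark_set => um.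
  have ut : u \in node_set t.
    by move/fsubsetP: (mark_set_sub t); apply; rewrite mem_mark_set.
  rewrite mem_leaves ut /=; move/all_tprofile: ab => /(_ u).
  by rewrite -mem_node_set ut um => /(_ isT) /andP[_].
have ab : all (bprofile m) (tprofile t).
  move/binary_node_set: bt => /all_tprofile bt; apply/all_tprofile => u ut.
  have := bt u ut; rewrite /bprofile /= implybT andbT => -> /=.
  case: m st => // st; first by rewrite implybT.
  apply/implyP => um; move/fsubsetP: st => /(_ u).
  by rewrite mem_mark_set um mem_leaves => /(_ isT) /andP[].
have := tree_size_binary ab; rewrite e => s; have en : tleaves t = n by lia.
by rewrite en eqxx mem_btrees ?en.
Qed.

End lists_of_trees.

(** * Generating functions *)

Section weights.
Variables (A : comNzRingType) (x y z : A).

Definition forest_weight f :=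
  x ^+ forest_size f * z ^+ forest_span f * y ^+ forest_marks f.
Definition tree_weight t :=
  x ^+ tree_size t * z ^+ tree_span t * y ^+ tree_marks t.
Definition btree_weight t :=
  x ^+ tleaves t * z ^+ tree_span t * y ^+ tree_marks t.

Lemma forest_weight_cons t r :
  forest_weight (Fcons t.1 t.2 r) = tree_weight t * forest_weight r.
Proof.
case: t => b c; rewrite /forest_weight /tree_weight /tree_size /tree_span.
by rewrite /tree_marks /= -!addSn !exprD; ring.
Qed.

Lemma sum_trees_of F (G : tree -> A) : \sum_(t <- trees_of F) G t =
  \sum_(f <- F) G (true, f) + \sum_(f <- F) G (false, f).
Proof. by rewrite big_allpairs_dep !big_cons big_nil /= addr0. Qed.

Lemma unmarked_trees_of F :
  \sum_(t <- trees_of F | tree_marks t == 0%N) tree_weight t =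
  x * \sum_(f <- F | forest_marks f == 0%N) forest_weight f.
Proof.
rewrite big_mkcond sum_trees_of /= big1 ?add0r => [|f _]; last by [].
rewrite mulr_sumr [RHS]big_mkcond; apply: eq_bigr => f _.
rewrite /tree_marks /= add0n; case: eqP => // m0.
rewrite /tree_weight /forest_weight /tree_size /tree_span /tree_marks /=.
by rewrite !add0n m0 exprS; ring.
Qed.

(** Below a marked root any forest is allowed, below an unmarked root the forest must contain a
    mark. Either way the root lies in the span, whence the common factor x z. *)
Lemma marked_trees_of F :
  \sum_(t <- trees_of F | tree_marks t != 0%N) tree_weight t =
  x * z * (y * \sum_(f <- F | forest_marks f == 0%N) forest_weight f +
    (1 + y) * \sum_(f <- F | forest_marks f != 0%N) forest_weight f).
Proof.
rewrite big_mkcond sum_trees_of /=.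
rewrite (_ : \sum_(f <- F) _ = x * z * y * \sum_(f <- F) forest_weight f).
  rewrite (bigID (fun f => forest_marks f == 0%N)) /=.
  rewrite (_ : \sum_(f <- F) _ =
      x * z * \sum_(f <- F | forest_marks f != 0%N) forest_weight f).
    by ring.
  rewrite mulr_sumr [RHS]big_mkcond; apply: eq_bigr => f _.
  rewrite /tree_marks /= add0n; case: eqP => //= /eqP; rewrite -lt0n => m0.
  rewrite /tree_weight /forest_weight /tree_size /tree_span /tree_marks /=.
  by rewrite !add0n m0 !exprS; ring.
rewrite mulr_sumr; apply: eq_bigr => f _.
rewrite /tree_marks /= /tree_weight /forest_weight /tree_size /tree_span.
by rewrite /tree_marks /= !exprD !exprS; ring.
Qed.

Lemma sum_forestsS h (P : pred forest) :
  P Fnil -> (forall t r, P (Fcons t.1 t.2 r) = P (Fcons t.1 t.2 Fnil) && P r) ->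
  \sum_(f <- forests h.+1 | P f) forest_weight f = 1 +
  (\sum_(t <- trees_of (forests h) | P (Fcons t.1 t.2 Fnil)) tree_weight t) *
  \sum_(r <- forests h | P r) forest_weight r.
Proof.
move=> P0 PS; rewrite [forests _]/= big_cons P0.
congr (_ + _); first by rewrite /forest_weight /= !expr0 !mulr1.
rewrite big_mkcond big_allpairs_dep big_distrlr /= [RHS]big_mkcond.
apply: eq_bigr => t _; case: ifP => Pt; last first.
  by apply: big1 => r _; rewrite PS Pt.
rewrite [RHS]big_mkcond; apply: eq_bigr => r _; rewrite PS Pt /=.
by rewrite forest_weight_cons.
Qed.

Lemma unmarked_forests h :
  \sum_(f <- forests h | forest_marks f == 0%N) forest_weight f = catp x h.
Proof.
elim: h => [|h IH].
  by rewrite big_cons big_nil /= addr0 /forest_weight /= !expr0 !mulr1.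
rewrite sum_forestsS//; last first.
  by move=> t r /=; rewrite addn0 addn_eq0.
rewrite (eq_bigl (fun t => tree_marks t == 0%N)) => [|t]; last first.
  by rewrite /= addn0.
by rewrite unmarked_trees_of IH /=; ring.
Qed.

Let C h := catp x h.
Let W h := \sum_(f <- forests h) forest_weight f.
Let M h := x * z * (y * C h + (1 + y) * (W h - C h)).

Lemma marked_trees_of_forests h :
  \sum_(t <- trees_of (forests h) | tree_marks t != 0%N) tree_weight t = M h.
Proof.
rewrite marked_trees_of unmarked_forests /M /W.
rewrite [X in _ = _ * (_ + _ * (X - _))](bigID (fun f => forest_marks f == 0%N)).
rewrite /= unmarked_forests /C.
by ring.
Qed.

Lemma all_forestsS h : W h.+1 = 1 + (x * C h + M h) * W h.
Proof.
rewrite /W sum_forestsS//; congr (_ + _ * _).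
rewrite (bigID (fun t => tree_marks t == 0%N)) /=.
by rewrite unmarked_trees_of unmarked_forests marked_trees_of_forests.
Qed.

Lemma eqm1x N a : eqm x N a 0 -> eqm x N.+1 (x * a) 0.
Proof.
move=> a0; rewrite -add1n; apply: eqm0M => //.
by exists 1; rewrite subr0 mulr1 expr1.
Qed.

Lemma eqm1xx : eqm x 1 x 0.
Proof. by exists 1; rewrite subr0 mulr1 expr1. Qed.

(** The right-hand side is W (h + 1). Both x C and M carry a factor x, so each round improves the
    agreement of consecutive iterates by one power of x. *)
Lemma all_forests_eqm h : eqm x h.+1 (W h) (1 + (x * C h + M h) * W h).
Proof.
elim: h => [|h [u IH]].
  rewrite /W big_seq1 {1}/forest_weight /= !expr0 !mul1r.
  exists (- (1 + z * (y * C 0%N + (1 + y) * (W 0%N - C 0%N))) * W 0%N).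
  by rewrite /M expr1 /W big_seq1 /C /=; ring.
have [v e] := catpE h eqm1xx.
have eW : W h = W h.+1 + x ^+ h.+1 * u by rewrite -IH all_forestsS; ring.
have eC : C h = C h.+1 + x ^+ h.+1 * v by rewrite -e /C /=; ring.
exists ((C h + z * (y * C h + (1 + y) * (W h - C h))) * u
  + (v + z * (y * v + (1 + y) * (u - v))) * W h.+1).
rewrite {1}all_forestsS /M exprS.
move: (W h.+1) (W h) (C h.+1) (C h) eW eC => w' w c' c -> ->; ring.
Qed.

(** Elimination of W: from 1/C = 1 - x C and 1/W = 1 - x C - M follows W - C = C M W, while the
    definition of M reads x z (1 + y) W = M + x z C. Inserting both in M = x z (y C + (1 + y)(W -
    C)) gives the quadratic. *)
Lemma plane_quadratic h : eqm x h.+1 (M h)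
  (x * z * y * C h + x * z * C h ^+ 2 * M h + C h * M h ^+ 2).
Proof.
have [u e1] := all_forests_eqm h; have [v e2] := catpE h eqm1xx.
rewrite -/(C h) in e2.
exists (x * z * (1 + y) * (C h * u - W h * v)).
transitivity (x * z * (1 + y) * (C h * (x ^+ h.+1 * u) - W h * (x ^+ h.+1 * v))).
  by rewrite -e1 -e2 /M; ring.
ring.
Qed.

Variable m : bool.
Let B h := \sum_(t <- btrees m h | tree_marks t == 0%N) btree_weight t.
Let N h := \sum_(t <- btrees m h | tree_marks t != 0%N) btree_weight t.

Let two b (t u : tree) : tree := (b, Fcons t.1 t.2 (Fcons u.1 u.2 Fnil)).

Lemma tree_marks_two b t u :
  tree_marks (two b t u) = (b + tree_marks t + tree_marks u)%N.
Proof. by rewrite /tree_marks /= addn0 !addnA. Qed.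

Lemma btree_weight_two b t u : btree_weight (two b t u) =
  z ^+ (0 < tree_marks (two b t u))%N * y ^+ b *
    (btree_weight t * btree_weight u).
Proof.
rewrite /btree_weight tree_marks_two.
case: t u => [b1 f1] [b2 f2]; rewrite /two tleaves_two.
by rewrite /tree_span /tree_marks /= !addn0 !addnA !exprD; ring.
Qed.

Lemma sum_btreesS h (G : tree -> A) :
  \sum_(t <- btrees m h.+1) G t = G (true, Fnil) + G (false, Fnil) +
  (if m then
     \sum_(t <- btrees m h) \sum_(u <- btrees m h) G (two true t u) else 0) +
  \sum_(t <- btrees m h) \sum_(u <- btrees m h) G (two false t u).
Proof.
have E b : \sum_(p <- [seq (t, u) | t <- btrees m h, u <- btrees m h])
    G (b, Fcons p.1.1 p.1.2 (Fcons p.2.1 p.2.2 Fnil)) =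
    \sum_(t <- btrees m h) \sum_(u <- btrees m h) G (two b t u).
  by rewrite big_allpairs_dep.
rewrite [btrees _ _]/= !big_cons big_allpairs_dep -!addrA; congr (_ + (_ + _)).
by case: (m) E => E; rewrite !big_cons big_nil /= addr0 -!E ?add0r.
Qed.

Lemma unmarked_btreesS h : B h.+1 = x + B h ^+ 2.
Proof.
rewrite /B big_mkcond sum_btreesS.
rewrite [X in _ + X + _](_ : _ = 0) ?addr0; last first.
  by case: (m) => //; apply: big1 => t _; apply: big1.
congr (_ + _).
  by rewrite /btree_weight /tleaves /tree_span /tree_marks /= add0r !mulr1.
rewrite expr2 big_distrlr /= [RHS]big_mkcond; apply: eq_bigr => t _.
rewrite [X in if _ then X else _]big_mkcond; case: eqP => t0; last first.
  apply: big1 => u _; rewrite tree_marks_two add0n addn_eq0.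
  by case: eqP t0.
apply: eq_bigr => u _; rewrite btree_weight_two tree_marks_two add0n t0 add0n.
by case: eqP => // ->; rewrite !mul1r.
Qed.

(** The terms stand for a marked leaf, an unmarked root with a mark in at least one subtree, and a
    marked root above two arbitrary subtrees. *)
Lemma marked_btreesS h : N h.+1 = x * z * y + z * (2 * B h * N h + N h ^+ 2) +
  (if m then z * y * (B h + N h) ^+ 2 else 0).
Proof.
have BN : \sum_(t <- btrees m h) btree_weight t = B h + N h.
  by rewrite (bigID (fun t => tree_marks t == 0%N)).
rewrite /N big_mkcond sum_btreesS -/(N h).
rewrite -addrA [X in _ + X]addrC addrA; congr (_ + _ + _).
- rewrite /btree_weight /tleaves /tree_span /tree_marks /= !addn0 !expr1.
  by rewrite addr0.
- transitivity (z * ((B h + N h) ^+ 2 - B h ^+ 2)); last by ring.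
  rewrite -BN !expr2 !big_distrlr /= [X in _ - X]big_mkcond mulrBr.
  apply/eqP; rewrite eq_sym subr_eq; apply/eqP.
  rewrite !mulr_sumr -big_split; apply: eq_bigr => t _ /=.
  rewrite [X in if _ then X else _]big_mkcond /= mulr_sumr; case: eqP => t0.
    rewrite mulr_sumr -big_split; apply: eq_bigr => u _ /=.
    rewrite btree_weight_two tree_marks_two t0 !add0n.
    have [u0|u0] := posnP (tree_marks u); first by rewrite add0r.
    by rewrite /= expr1 expr0 mulr1 mulr0 addr0.
  rewrite mulr0 addr0; apply: eq_bigr => u _ /=.
  rewrite btree_weight_two tree_marks_two add0n addn_eq0 addn_gt0.
  by move/eqP: t0; rewrite eqn0Ngt negbK => -> /=; rewrite expr1 expr0 mulr1.
- case: (m) BN => // BN; rewrite -BN expr2 big_distrlr /= mulr_sumr.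
  apply: eq_bigr => t _; rewrite mulr_sumr; apply: eq_bigr => u _.
  by rewrite btree_weight_two tree_marks_two /= !expr1; ring.
Qed.

Lemma unmarked_btrees h : B h.+1 = x * C h.
Proof.
elim: h => [|h IH]; rewrite unmarked_btreesS /C /=.
  by rewrite /B big_nil expr0n addr0 mulr1.
by rewrite IH /C; ring.
Qed.

Lemma unmarked_btrees_eqm h : eqm x h.+1 (B h) (x * C h).
Proof.
case: h => [|h].
  exists (-1); rewrite /B big_nil /C /=; ring.
rewrite unmarked_btrees; apply: eqm_subr0; rewrite -mulrBr; apply: eqm1x.
apply: eqm_sub0; exact: catpE eqm1xx.
Qed.

Let zeta := if m then z * y else 0.

Lemma marked_btrees_x h : eqm x 1 (N h) 0.
Proof.
elim: h => [|h [u]].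
  by exists 0; rewrite /N big_nil mulr0 subrr.
rewrite subr0 expr1 => e; have [v] := unmarked_btrees_eqm h.
rewrite exprS => e'; have {}e' : B h = x * (C h + x ^+ h * v).
  by rewrite mulrDr mulrA -e'; ring.
exists (z * y + z * (2 * (C h + x ^+ h * v) * (x * u) + x * u ^+ 2) +
  zeta * x * (C h + x ^+ h * v + u) ^+ 2).
rewrite marked_btreesS e e' subr0 expr1 /zeta.
by move: (C h + x ^+ h * v) => c; case: (m); ring.
Qed.

Lemma marked_btrees_eqm h : eqm x h.+1 (N h)
  (x * z * y + z * (2 * B h * N h + N h ^+ 2) + zeta * (B h + N h) ^+ 2).
Proof.
have zE g : (if m then z * y * (B g + N g) ^+ 2 else 0) = zeta * (B g + N g) ^+ 2.
  by rewrite /zeta; case: (m); rewrite ?mul0r.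
elim: h => [|h [u IH]].
  by exists (- (z * y)); rewrite /B /N !big_nil; ring.
have eN : N h = N h.+1 + x ^+ h.+1 * u by rewrite -IH marked_btreesS zE; ring.
have [b0 e0] := unmarked_btrees_eqm h.
have [v e] := catpE h eqm1xx.
have eB1 : B h.+1 = x * C h := unmarked_btrees h.
have eB : B h = B h.+1 + x ^+ h.+1 * b0 by rewrite eB1 -e0; ring.
have [n0] := marked_btrees_x h; rewrite subr0 expr1 => N0.
have [n1] := marked_btrees_x h.+1; rewrite subr0 expr1 => N1.
have eBx : B h = x * (C h + x ^+ h * b0) by rewrite eB eB1 exprS; ring.
(* [x * T] is the sum of the total weights at heights h and h + 1; in the difference of two squares
   it supplies the additional power of x. *)
pose T := C h + x ^+ h * b0 + n0 + (C h + n1).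
exists ((z + zeta) * (b0 + u) * T - z * b0 * (C h + x ^+ h * b0 + C h)).
rewrite {1}marked_btreesS zE /T.
transitivity ((z + zeta) * (B h - B h.+1 + (N h - N h.+1)) * ((B h + N h) + (B h.+1 + N h.+1))
   - z * (B h - B h.+1) * (B h + B h.+1)); first by ring.
have -> : B h - B h.+1 = x ^+ h.+1 * b0 by rewrite eB addrAC subrr add0r.
have -> : N h - N h.+1 = x ^+ h.+1 * u by rewrite eN addrAC subrr add0r.
have -> : B h + N h + (B h.+1 + N h.+1) = x * T by rewrite eBx N0 eB1 N1 /T; ring.
have -> : B h + B h.+1 = x * (C h + x ^+ h * b0 + C h) by rewrite eBx eB1; ring.
by rewrite [x ^+ h.+2]exprS /T; ring.
Qed.

(** B becomes x C, and B^2 = x^2 C^2 becomes x C - x. For marked nodes the constant term then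
    collapses to the monomial z y x C: an end of the spanned tree is a marked node with an unmarked
    subtree. *)
Lemma binary_quadratic h : eqm x h.+1 (N h)
  (x * z * y + zeta * (x * C h - x) + 2 * (z + zeta) * (x * C h) * N h +
   (z + zeta) * N h ^+ 2).
Proof.
apply: eqm_trans (marked_btrees_eqm h) _.
have [b0 e0] := unmarked_btrees_eqm h.
have [v e] := catpE h eqm1xx.
exists ((z + zeta) * 2 * b0 * N h + zeta * b0 * (B h + x * C h) - x * zeta * v).
rewrite [RHS](_ : _ = (z + zeta) * 2 * (x ^+ h.+1 * b0) * N h +
  zeta * (x ^+ h.+1 * b0) * (B h + x * C h) - x * zeta * (x ^+ h.+1 * v)); last by ring.
by rewrite -e0 -e -/(C h); ring.
Qed.

End weights.

Lemma plane_monomial (A : comNzRingType) (x y z c : A) l i :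
  (x * z * y * c) ^+ l.+1 * c ^+ l * (x * z * c ^+ 2) ^+ i =
  x ^+ (l + i + 1) * c ^+ (l + l + 1 + i + i) *
    (z ^+ (l + i + 1) * y ^+ (l + 1)).
Proof. by rewrite !exprMn !exprD !exprS; ring. Qed.

Lemma leaf_monomial (A : comNzRingType) (x y z c : A) l i :
  (x * z * y) ^+ l.+1 * z ^+ l * (2 * z * (x * c)) ^+ i =
  x ^+ (l + i + 1) * c ^+ i * (z ^+ (2 * l + i + 1) * y ^+ (l + 1)) *+ 2 ^ i.
Proof.
rewrite -[RHS]mulr_natr natrX !exprMn mul2n -addnn !exprD !exprS; ring.
Qed.

Lemma node_monomial (A : comNzRingType) (x y z c : A) l i :
  (z * y * (x * c)) ^+ l.+1 * (z * (1 + y)) ^+ l *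
    (2 * (z * (1 + y)) * (x * c)) ^+ i =
  x ^+ (l + i + 1) * c ^+ (l + i + 1) *
    (z ^+ (2 * l + i + 1) * (y ^+ (l + 1) * (1 + y) ^+ (l + i))) *+ 2 ^ i.
Proof.
rewrite -[RHS]mulr_natr natrX !exprMn mul2n -addnn !exprD !exprS.
move: ((1 + y) ^+ l) ((1 + y) ^+ i) => u v; ring.
Qed.

Section quadratics.
Variables (A : comNzRingType) (x y z : A) (h : nat).
Let C := catp x h.
Let N m := \sum_(t <- btrees m h | tree_marks t != 0%N) btree_weight x y z t.

Lemma leaf_quadratic : eqm x h.+1 (N false)
  (x * z * y + 2 * z * (x * C) * N false + z * N false ^+ 2).
Proof.
have := binary_quadratic x y z false h; rewrite /= => -[u e]; exists u.
by rewrite -e -/(N false) -/C; ring.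
Qed.

Lemma node_quadratic : eqm x h.+1 (N true)
  (z * y * (x * C) + 2 * (z * (1 + y)) * (x * C) * N true +
   z * (1 + y) * N true ^+ 2).
Proof.
have := binary_quadratic x y z true h; rewrite /= => -[u e]; exists u.
by rewrite -e -/(N true) -/C; ring.
Qed.
End quadratics.

(** * Exact counts *)

Section counting.
Variable R : comNzRingType.
Local Notation A := {poly {poly R}}.
Local Notation x := ('X : {poly A}).
Local Notation z := (('X : {poly {poly R}})%:P : {poly A}).
Local Notation y := (('X : {poly R})%:P%:P : {poly A}).

Lemma coef_eqm N n (p q : {poly A}) : eqm x N p q -> (n < N)%N -> p`_n = q`_n.
Proof.
move=> [r e] nN; apply/eqP; rewrite -subr_eq0 -coefB e mulrC coefMXn nN.
exact: eqxx.
Qed.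

Lemma coef_catp h n a : (n <= h)%N -> (catp x h ^+ a)`_n = (ballot n a)%:R.
Proof.
move=> nh; rewrite (coef_eqm (catpX h a (eqm1xx x)))// /cat_trunc coef_sum.
rewrite (bigD1 (Ordinal (nh : (n < h.+1)%N)))//= coefMn coefXn eqxx.
rewrite big1 ?addr0 => [|i ni]; first by [].
rewrite coefMn coefXn eq_sym; move: ni; rewrite -val_eqE /= => /negPf ->.
by rewrite mul0rn.
Qed.

Lemma coef_catp_mono h n a b (g : A) : (n <= h)%N ->
  (x ^+ a * catp x h ^+ b * g%:P)`_n =
  if (a <= n)%N then g *+ ballot (n - a) b else 0.
Proof.
move=> nh; rewrite coefMC coefXnM ltnNge; case: leqP => an; last by rewrite mul0r.
by rewrite /= coef_catp ?mulr_natl// (leq_trans (leq_subr _ _)).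
Qed.

Lemma coef_mono n s k a b c :
  ((x ^+ a * z ^+ b * y ^+ c)`_n)`_s`_k =
  [&& n == a, s == b & k == c]%:R :> R.
Proof.
rewrite -!rmorphXn -mulrA -rmorphM /= coefMC coefXn.
case: eqP => _; last by rewrite mul0r !coef0.
rewrite mul1r coefMC coefXn; case: eqP => _; last by rewrite mul0r coef0.
by rewrite mul1r coefXn.
Qed.

Lemma yz_monoE b c e : z ^+ b * y ^+ c *+ e =
  (('X^b * ('X^c)%:P) *+ e : {poly {poly R}})%:P.
Proof. by rewrite -!rmorphXn -rmorphM -rmorphMn. Qed.

Lemma coef_yz_mono s k b c e d :
  ((('X^b * ('X^c)%:P) *+ e *+ d : {poly {poly R}})`_s)`_k =
  if (s == b) && (k == c) then (e * d)%:R else 0 :> R.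
Proof.
rewrite -mulrnA coefMn coefMC coefXn coefMn.
case: eqP => _; last by rewrite mul0r coef0 mul0rn.
by rewrite mul1r coefXn; case: eqP => _; rewrite ?mul0rn.
Qed.

Definition tree_count (L : seq tree) k s : R :=
  \sum_(t <- L | (tree_marks t == k) && (tree_span t == s)) 1.

Lemma coef_plane_trees n k s : (0 < k)%N ->
  ((\sum_(t <- trees_of (forests n) | tree_marks t != 0%N)
     tree_weight x y z t)`_n)`_s`_k = tree_count (plane_list n) k s.
Proof.
move=> k0; rewrite /tree_count /plane_list big_filter_cond !coef_sum.
rewrite [LHS]big_mkcond [RHS]big_mkcond; apply: eq_bigr => t _.
rewrite /tree_weight coef_mono ![_ == tree_size t]eq_sym ![_ == tree_marks t]eq_sym.
rewrite ![_ == tree_span t]eq_sym.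
case: (tree_size t =P n) => //= _; last by case: ifP.
case: (tree_marks t =P k) => [->|_]; rewrite ?andbF ?andbT; last by case: ifP.
by rewrite -lt0n k0; case: eqP.
Qed.

Lemma coef_btrees m n k s : (0 < k)%N ->
  ((\sum_(t <- btrees m n | tree_marks t != 0%N)
     btree_weight x y z t)`_n)`_s`_k = tree_count (btree_list n m) k s.
Proof.
move=> k0; rewrite /tree_count /btree_list big_filter_cond !coef_sum.
rewrite [LHS]big_mkcond [RHS]big_mkcond; apply: eq_bigr => t _.
rewrite /btree_weight coef_mono ![_ == tleaves t]eq_sym ![_ == tree_marks t]eq_sym.
rewrite ![_ == tree_span t]eq_sym.
case: (tleaves t =P n) => //= _; last by case: ifP.
case: (tree_marks t =P k) => [->|_]; rewrite ?andbF ?andbT; last by case: ifP.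
by rewrite -lt0n k0; case: eqP.
Qed.

Lemma sum_ord_pick N (F : nat -> R) j :
  (forall i, i != j -> F i = 0) ->
  \sum_(i < N) F i = if (j < N)%N then F j else 0.
Proof.
move=> F0; case: ltnP => jN.
  rewrite (bigD1 (Ordinal jN))//= big1 ?addr0// => i.
  by rewrite -val_eqE => /= /F0.
apply: big1 => i _; apply: F0; apply: contraTneq (ltn_ord i) => ->.
by rewrite -leqNgt.
Qed.

(** The term (l, i) of the expansion is a multiple of x^(l+i+1) z^(l+i+1) y^(l+1) C^(2(l+i+1)-1).
    Reading off y^k and z^s forces l = k - 1 and i = s - k, which leaves the coefficient of x^(n-s)
    in C^(2s-1). *)
Lemma plane_count n k s : (0 < k)%N -> tree_count (plane_list n) k s =
  if (k <= s <= n)%N then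
    (ballot (k - 1) 1 * 'C(s + k - 2, 2 * k - 2) *
      ballot (n - s) (2 * s - 1))%:R
  else 0.
Proof.
move=> k0; have xm : eqm x 1 x 0 := eqm1xx x.
rewrite -coef_plane_trees// marked_trees_of_forests.
set M := x * z * _; set C := catp x n.
pose p := x * z * y * C; pose q := x * z * C ^+ 2.
have x1 (w : {poly A}) : eqm x 1 (x * w) 0.
  by exists w; rewrite subr0 expr1.
have p0 : eqm x 1 p 0 by rewrite /p -!mulrA.
have q0 : eqm x 1 q 0 by rewrite /q -!mulrA.
have m0 : eqm x 1 M 0 by rewrite /M -!mulrA.
rewrite (coef_eqm (quadratic_solution p0 q0 m0 (plane_quadratic x y z n)))//.
rewrite !coef_sum.
pose G (l i : nat) : R := if [&& l + i + 1 == s & l + 1 == k]%N && (s <= n)%N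
  then (ballot l 1 * 'C(i + 2 * l, 2 * l) * ballot (n - s) (2 * s - 1))%:R
  else 0.
rewrite (eq_bigr (fun l : 'I_n.+1 => \sum_(i < n.+1) G l i)); last first.
  move=> l _; rewrite !coef_sum; apply: eq_bigr => i _.
  rewrite (_ : p ^+ l.+1 * _ * _ *+ _ = x ^+ (l + i + 1) * C ^+ (2 * (l + i + 1) - 1) *
     (('X^(l + i + 1) * ('X^(l + 1))%:P) *+ (ballot l 1 * 'C(i + 2 * l, 2 * l)))%:P).
    rewrite coef_catp_mono// (fun_if (fun g : {poly {poly R}} => g`_s`_k)).
    rewrite coef_yz_mono !coef0 eq_sym [k == _]eq_sym.
    rewrite /G; case: eqP => [->|_]; last by rewrite if_same.
    by rewrite /=; case: (leqP s n) => _; rewrite ?andbT ?andbF.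
  rewrite -yz_monoE.
  rewrite (_ : 2 * (l + i + 1) - 1 = l + l + 1 + i + i)%N; last by lia.
  by rewrite -/C mulrnAr /p /q plane_monomial.
rewrite (sum_ord_pick _ (F := fun l => \sum_(i < n.+1) G l i) (j := (k - 1)%N))
  => [|l lk]; last first.
  apply: big1 => i _; rewrite /G; case: ifP => // /andP[/andP[_ /eqP e] _].
  by move: lk; rewrite -e addnK eqxx.
have [/andP[ks sn]|ksn] := boolP (k <= s <= n)%N; last first.
  rewrite big1 ?if_same// => i _; rewrite /G; case: ifP => // /andP[/andP[/eqP e _] sn].
  by move: ksn; rewrite sn andbT -e; lia.
rewrite (_ : k - 1 < n.+1)%N; last by lia.
rewrite (sum_ord_pick _ (F := G (k - 1)%N) (j := (s - k)%N)) => [|i ik]; last first.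
  rewrite /G; case: ifP => // /andP[/andP[/eqP e _] _].
  by move: ik; rewrite -e; lia.
rewrite (_ : s - k < n.+1)%N /G; last by lia.
rewrite (_ : [&& _ & _] && _); last by rewrite sn andbT; lia.
congr (_ * 'C(_, _) * _)%:R; lia.
Qed.
(** Here the term (l, i) is a multiple of x^(l+i+1) z^(2l+i+1) y^(l+1) C^i: the span has l + 1
    marked leaves, l branchings and i nodes with one child in the span. So l = k - 1 and i = s + 1 -
    2k, and 2^i chooses left or right at the i nodes. *)
Lemma leaf_count n k s : (0 < k)%N -> tree_count (btree_list n false) k s =
  if (2 * k - 1 <= s)%N && (s - k + 1 <= n)%N then
    (ballot (k - 1) 1 * 'C(s - 1, 2 * k - 2) * 2 ^ (s + 1 - 2 * k) *
      ballot (n - (s - k + 1)) (s + 1 - 2 * k))%:R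
  else 0.
Proof.
move=> k0; rewrite -coef_btrees//; set M := \sum_(t <- _ | _) _.
set C := catp x n.
pose p := x * z * y; pose q := 2 * z * (x * C).
have x1 (w : {poly A}) : eqm x 1 (x * w) 0.
  by exists w; rewrite subr0 expr1.
have p0 : eqm x 1 p 0 by rewrite /p -!mulrA.
have q0 : eqm x 1 q 0 by rewrite /q mulrCA.
have m0 : eqm x 1 M 0 := marked_btrees_x x y z false n.
have me : eqm x n.+1 M (p + q * M + z * M ^+ 2).
  exact: leaf_quadratic.
rewrite (coef_eqm (quadratic_solution p0 q0 m0 me))// !coef_sum.
pose G (l i : nat) : R :=
  if [&& 2 * l + i + 1 == s & l + 1 == k]%N && (l + i + 1 <= n)%N
  then (ballot l 1 * 'C(i + 2 * l, 2 * l) * 2 ^ i * ballot (n - (l + i + 1)) i)%:R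
  else 0.
rewrite (eq_bigr (fun l : 'I_n.+1 => \sum_(i < n.+1) G l i)); last first.
  move=> l _; rewrite !coef_sum; apply: eq_bigr => i _.
  rewrite (_ : p ^+ l.+1 * _ * _ *+ _ = x ^+ (l + i + 1) * C ^+ i *
     (('X^(2 * l + i + 1) * ('X^(l + 1))%:P) *+
      (ballot l 1 * 'C(i + 2 * l, 2 * l) * 2 ^ i))%:P).
    rewrite coef_catp_mono// (fun_if (fun g : {poly {poly R}} => g`_s`_k)).
    rewrite coef_yz_mono !coef0 eq_sym [k == _]eq_sym /G.
    by case: (leqP (l + i + 1) n) => _; rewrite ?andbT ?andbF.
  by rewrite -yz_monoE mulrnAr /p /q leaf_monomial -mulrnA [(2 ^ i * _)%N]mulnC.
rewrite (sum_ord_pick _ (F := fun l => \sum_(i < n.+1) G l i) (j := (k - 1)%N))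
  => [|l lk]; last first.
  apply: big1 => i _; rewrite /G; case: ifP => // /andP[/andP[_ /eqP e] _].
  by move: lk; rewrite -e addnK eqxx.
have [/andP[ks sn]|ksn] := boolP ((2 * k - 1 <= s)%N && (s - k + 1 <= n)%N);
    last first.
  rewrite big1 ?if_same// => i _; rewrite /G.
  case: ifP => // /andP[/andP[/eqP e _] sn].
  by move: ksn sn; rewrite -e; lia.
rewrite (_ : k - 1 < n.+1)%N; last by lia.
rewrite (sum_ord_pick _ (F := G (k - 1)%N) (j := (s + 1 - 2 * k)%N)) => [|i ik];
    last first.
  rewrite /G; case: ifP => // /andP[/andP[/eqP e _] _].
  by move: ik; rewrite -e; lia.
rewrite (_ : s + 1 - 2 * k < n.+1)%N /G; last by lia.
rewrite (_ : [&& _ & _] && _); last by lia.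
congr (_ * 'C(_, _) * _ * ballot _ _)%:R; lia.
Qed.

Lemma coef_yz_binom s k b c f e d :
  ((('X^b * (('X^c) * (1 + 'X) ^+ f)%:P) *+ e *+ d : {poly {poly R}})`_s)`_k =
  if (s == b) && (c <= k)%N then (e * d * 'C(f, k - c))%:R else 0 :> R.
Proof.
rewrite -mulrnA coefMn coefMC coefXn coefMn.
case: eqP => _; last by rewrite mul0r coef0 mul0rn.
rewrite mul1r coefXnM ltnNge; case: leqP => ck; last by rewrite mul0rn.
rewrite /= addrC exprD1n coef_sum natrM mulr_natl; congr (_ *+ _).
have [kf|kf] := ltnP f (k - c).
  rewrite bin_small// big1// => i _; rewrite coefMn coefXn.
  case: eqP => [e'|_]; last by rewrite mul0rn.
  by move: (ltn_ord i); rewrite -e' ltnS leqNgt kf.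
rewrite (bigD1 (Ordinal (kf : (k - c < f.+1)%N)))//= coefMn coefXn eqxx.
rewrite big1 ?addr0 => [|i ni]; first by [].
rewrite coefMn coefXn eq_sym; move: ni; rewrite -val_eqE /= => /negPf ->.
by rewrite mul0rn.
Qed.

(** A span with l + 1 ends has all its ends marked, and the factor (1 + y)^(l+i) places the other k
    - l - 1 marks on its l + i inner nodes. Thus s determines i for each l, but l itself stays
    free. *)
Lemma node_count n k s : (0 < k <= n)%N ->
  tree_count (btree_list n true) k s = \sum_(l < k)
  if (2 * l + 1 <= s)%N && (s - l <= n)%N then
    (ballot l 1 * 'C(s - 1, 2 * l) * 'C(s - l - 1, k - l - 1) *
      2 ^ (s - 2 * l - 1) * ballot (n - (s - l)) (s - l))%:R
  else 0.
Proof.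
move=> /andP[k0 kn]; rewrite -coef_btrees//; set M := \sum_(t <- _ | _) _.
set C := catp x n.
pose p := z * y * (x * C); pose q := 2 * (z * (1 + y)) * (x * C).
have x1 (w : {poly A}) : eqm x 1 (x * w) 0.
  by exists w; rewrite subr0 expr1.
have p0 : eqm x 1 p 0 by rewrite /p mulrCA.
have q0 : eqm x 1 q 0 by rewrite /q mulrCA.
have m0 : eqm x 1 M 0 := marked_btrees_x x y z true n.
have me : eqm x n.+1 M (p + q * M + z * (1 + y) * M ^+ 2).
  exact: node_quadratic.
rewrite (coef_eqm (quadratic_solution p0 q0 m0 me))// !coef_sum.
pose G (l i : nat) : R :=
  if [&& 2 * l + i + 1 == s & l + 1 <= k]%N && (l + i + 1 <= n)%N
  then (ballot l 1 * 'C(i + 2 * l, 2 * l) * 2 ^ i * ballot (n - (l + i + 1)) (l + i + 1)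
    * 'C(l + i, k - (l + 1)))%:R
  else 0.
rewrite (eq_bigr (fun l : 'I_n.+1 => \sum_(i < n.+1) G l i)); last first.
  move=> l _; rewrite !coef_sum; apply: eq_bigr => i _.
  rewrite (_ : p ^+ l.+1 * _ * _ *+ _ = x ^+ (l + i + 1) * C ^+ (l + i + 1) *
     (('X^(2 * l + i + 1) * ('X^(l + 1) * (1 + 'X) ^+ (l + i))%:P) *+
      (ballot l 1 * 'C(i + 2 * l, 2 * l) * 2 ^ i))%:P).
    rewrite coef_catp_mono// (fun_if (fun g : {poly {poly R}} => g`_s`_k)).
    rewrite coef_yz_binom !coef0 eq_sym /G.
    by case: (leqP (l + i + 1) n) => _; rewrite ?andbT ?andbF.
  rewrite [X in _ = _ * X](_ : _ = z ^+ (2 * l + i + 1) * (y ^+ (l + 1) * (1 + y) ^+ (l + i))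
     *+ (ballot l 1 * 'C(i + 2 * l, 2 * l) * 2 ^ i)); last first.
    have -> : 1 + y = (1 + 'X : {poly R})%:P%:P by rewrite !polyCD !polyC1.
    by rewrite -!rmorphXn -!rmorphM -rmorphMn.
  by rewrite mulrnAr /p /q node_monomial -mulrnA [(2 ^ i * _)%N]mulnC.
pose H (l : nat) : R := if (2 * l + 1 <= s)%N && (s - l <= n)%N then
    (ballot l 1 * 'C(s - 1, 2 * l) * 'C(s - l - 1, k - l - 1) *
      2 ^ (s - 2 * l - 1) * ballot (n - (s - l)) (s - l))%:R
  else 0.
rewrite -[RHS]/(\sum_(l < k) H l) (big_ord_widen n.+1 H (leqW kn)).
rewrite [RHS]big_mkcond; apply: eq_bigr => l _ /=; rewrite /H.
case: ltnP => lk; last first.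
  apply: big1 => i _; rewrite /G; case: ifP => // /andP[/andP[_ e] _].
  by move: lk; lia.
rewrite (sum_ord_pick _ (F := G l) (j := (s - 2 * l - 1)%N)) => [|i ik];
    last first.
  rewrite /G; case: ifP => // /andP[/andP[/eqP e _] _].
  by move: ik; rewrite -e; lia.
have [/andP[ks sn]|ksn] := boolP ((2 * l + 1 <= s)%N && (s - l <= n)%N);
    last first.
  case: ifP => // _; rewrite /G; case: ifP => // /andP[/andP[/eqP e _] sn].
  by move: ksn sn; lia.
rewrite (_ : s - 2 * l - 1 < n.+1)%N /G; last by lia.
rewrite (_ : [&& _ & _] && _); last by lia.
rewrite -!mulnA; congr (_ * _)%:R.
have -> : (s - 2 * l - 1 + 2 * l = s - 1)%N by lia.
have -> : (l + (s - 2 * l - 1) + 1 = s - l)%N by lia.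
have -> : (l + (s - 2 * l - 1) = s - l - 1)%N by lia.
by rewrite subnDA; congr (_ * _)%N; rewrite mulnA mulnC.
Qed.
End counting.

(** * Ballot numbers as products *)

(** Reflection formula, written additively to avoid truncated subtraction. *)
Lemma ballot_bin n a :
  (ballot n.+1 a + 'C(2 * n + a + 1, n) = 'C(2 * n + a + 1, n.+1))%N.
Proof.
elim: n a => [|n IHn] a.
  rewrite muln0 add0n bin0 bin1; congr (_ + _)%N.
  by elim: a => //= a ->; rewrite addn1.
elim: a => [|a IHa].
  by rewrite /= add0n addn0 -bin_sub; [congr 'C(_, _)|]; lia.
have {IHn} := IHn a.+2; rewrite [ballot n.+2 a.+1]/= -/(ballot n.+2 a) -/(ballot n.+1 a.+2).
have -> : (2 * n.+1 + a.+1 + 1 = (2 * n + a + 3).+1)%N by lia.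
have -> : (2 * n + a.+2 + 1 = 2 * n + a + 3)%N by lia.
move: IHa; have -> : (2 * n.+1 + a + 1 = 2 * n + a + 3)%N by lia.
by rewrite !binS; lia.
Qed.

Lemma ballotE n a : ((2 * n + a) * ballot n a = a * 'C(2 * n + a, n))%N.
Proof.
case: n => [|n]; first by rewrite bin0.
have -> : (2 * n.+1 + a = (2 * n + a + 1).+1)%N by lia.
rewrite binS -ballot_bin; have := mul_bin_left (2 * n + a + 1) n.
rewrite -ballot_bin; have -> : (2 * n + a + 1 - n = n + a + 1)%N by lia.
nia.
Qed.

Section product_profiles.
Variable R : realType.

(** By [ballot_binary], at (m - 1, i - 1) this is 2^i ballot(m - i, i) / i divided by its value at i
    = 1, written as a product of consecutive ratios. A zero factor makes it vanish for j > m, which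
    absorbs the range condition of the counts. *)
Definition binary_profile (m j : nat) : R :=
  \prod_(r < j) (2 * (m%:R - r%:R) / (2 * m%:R - r%:R)).

(** At j = s - 1 this plays the same role for ballot(n - s, 2s - 1) / (2s - 1). *)
Definition plane_profile (n j : nat) : R :=
  \prod_(r < j) ((n%:R - r.+1%:R) / (n%:R + r.+1%:R)).

Lemma binary_profile0 m j : (m < j)%N -> binary_profile m j = 0.
Proof.
move=> mj; rewrite /binary_profile (bigD1 (Ordinal mj))//=.
by rewrite subrr mulr0 !mul0r.
Qed.

Lemma plane_profile0 n j : (0 < n <= j)%N -> plane_profile n j = 0.
Proof.
case: n => // n /= nj; rewrite /plane_profile (bigD1 (Ordinal nj))//=.
by rewrite subrr !mul0r.
Qed.

Lemma ballot_binary m i : (0 < m)%N ->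
  (if (i <= m)%N then (2 ^ i * ballot (m - i) i)%:R else 0) =
  i%:R * (2 * ballot (m - 1) 1)%:R * binary_profile (m - 1) (i - 1) :> R.
Proof.
move=> m0; case: i => [|i].
  by case: m m0 => // m _; rewrite subn0 /= muln0 !mul0r.
rewrite [(i.+1 - 1)%N]subn1 [_.-1]/=; have [im|im] := leqP i.+1 m; last first.
  by rewrite binary_profile0 ?mulr0//; lia.
elim: i im => [|i IH] im.
  by rewrite /binary_profile big_ord0 mul1r mulr1 expn1.
rewrite /binary_profile big_ord_recr /= [RHS]mulrA -/(binary_profile _ _).
have im' : (i.+1 < m)%N by [].
have e := IH (ltnW im).
have i0 : (i.+1%:R : R) != 0 by rewrite pnatr_eq0.
have -> : i.+2%:R * (2 * ballot (m - 1) 1)%:R * binary_profile (m - 1) i =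
  i.+2%:R / i.+1%:R * (2 ^ i.+1 * ballot (m - i.+1) i.+1)%:R :> R.
  by rewrite e; field.
have d1 : (2 * (m - 1)%:R - i%:R : R) = (2 * m - i.+2)%:R.
  rewrite (_ : 2 * m - i.+2 = 2 * (m - 1) - i)%N; last by lia.
  by rewrite [RHS]natrB ?natrM//; lia.
have d0 : ((2 * m - i.+2)%:R : R) != 0 by rewrite pnatr_eq0; lia.
have d2 : ((m - 1)%:R - i%:R : R) = (m - i.+1)%:R.
  by rewrite (_ : m - i.+1 = m - 1 - i)%N; [rewrite [RHS]natrB//; lia|lia].
rewrite d1 d2; apply: (mulIf i0); apply: (mulIf d0).
transitivity ((2 ^ i.+1 * (2 * (m - i.+1) * ballot (m - i.+1) i.+1 * i.+2))%:R : R); last first.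
  rewrite !natrM; move: i0 d0; move: (i.+1%:R : R) ((2 * m - i.+2)%:R : R).
  by move=> a b a0 b0; field; rewrite a0 b0.
rewrite -!natrM; congr _%:R.
have := ballotE (m - i.+1) i.+1; have := ballotE (m - i.+2) i.+2.
have -> : (2 * (m - i.+1) + i.+1 = 2 * m - i.+1)%N by lia.
have -> : (2 * (m - i.+2) + i.+2 = 2 * m - i.+2)%N by lia.
have := mul_bin_diag (2 * m - i.+1) (m - i.+2).
have -> : ((2 * m - i.+1).-1 = 2 * m - i.+2)%N by lia.
have -> : ((m - i.+2).+1 = m - i.+1)%N by lia.
set b1 := ballot _ _; set b2 := ballot _ _; set c1 := 'C(_, _); set c2 := 'C(_, _).
move=> h1 h2 h3; rewrite [(2 ^ i.+2)%N]expnS; move: (2 ^ i.+1)%N => P.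
have N1 : (0 < 2 * m - i.+1)%N by lia.
move: (2 * m - i.+1)%N (2 * m - i.+2)%N (m - i.+1)%N N1 h1 h2 h3 => u v w u0 h1 h2 h3.
suff E : (b1 * v * i.+1 = w * b2 * i.+2)%N.
  transitivity (2 * P * (b1 * v * i.+1))%N; first by ring.
  by rewrite E; ring.
apply/eqP; rewrite -(eqn_pmul2l u0); apply/eqP.
transitivity (i.+1 * u * (v * b1))%N; first by ring.
rewrite h2; transitivity (i.+1 * i.+2 * (u * c1))%N; first by ring.
rewrite h1; transitivity (i.+2 * w * (i.+1 * c2))%N; first by ring.
by rewrite -h3; ring.
Qed.

Lemma ballot_plane n s : (0 < n)%N -> (0 < s)%N ->
  (if (s <= n)%N then (ballot (n - s) (2 * s - 1))%:R else 0) =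
  (2 * s - 1)%:R * (ballot (n - 1) 1)%:R * plane_profile n (s - 1) :> R.
Proof.
move=> n0; case: s => // s _; rewrite [(s.+1 - 1)%N]subn1 [_.-1]/=.
have [sn|sn] := leqP s.+1 n; last first.
  by rewrite plane_profile0 ?mulr0// n0.
elim: s sn => [|s IH] sn.
  by rewrite /plane_profile big_ord0 muln1 !mulr1 mul1r.
rewrite /plane_profile big_ord_recr /= [RHS]mulrA -/(plane_profile _ _).
have e := IH (ltnW sn).
have s0 : ((2 * s.+1 - 1)%:R : R) != 0 by rewrite pnatr_eq0; lia.
have -> : (2 * s.+2 - 1)%:R * (ballot (n - 1) 1)%:R * plane_profile n s =
  (2 * s.+2 - 1)%:R / (2 * s.+1 - 1)%:R * (ballot (n - s.+1) (2 * s.+1 - 1))%:R :> R.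
  by rewrite e; field.
have d0 : ((n + s.+1)%:R : R) != 0 by rewrite pnatr_eq0; lia.
rewrite -natrB ?(ltnW sn)// -natrD.
apply: (mulIf s0); apply: (mulIf d0).
transitivity (((2 * s.+2 - 1) * ballot (n - s.+1) (2 * s.+1 - 1) * (n - s.+1))%:R : R); last first.
  rewrite !natrM; move: s0 d0; move: ((2 * s.+1 - 1)%:R : R) ((n + s.+1)%:R : R).
  by move=> a b a0 b0; field; rewrite a0 b0.
rewrite -!natrM; congr _%:R.
have := ballotE (n - s.+1) (2 * s.+1 - 1); have := ballotE (n - s.+2) (2 * s.+2 - 1).
have -> : (2 * (n - s.+1) + (2 * s.+1 - 1) = 2 * n - 1)%N by lia.
have -> : (2 * (n - s.+2) + (2 * s.+2 - 1) = 2 * n - 1)%N by lia.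
have := mul_bin_left (2 * n - 1) (n - s.+2).
have -> : ((n - s.+2).+1 = n - s.+1)%N by lia.
have -> : (2 * n - 1 - (n - s.+2) = n + s.+1)%N by lia.
set b1 := ballot _ _; set b2 := ballot _ _; set c1 := 'C(_, _); set c2 := 'C(_, _).
have N1 : (0 < 2 * n - 1)%N by lia.
move: (2 * n - 1)%N (2 * s.+1 - 1)%N (2 * s.+2 - 1)%N (n - s.+1)%N (n + s.+1)%N N1.
move=> u v v' w t u0 h1 h2 h3; apply/eqP; rewrite -(eqn_pmul2l u0); apply/eqP.
transitivity (v * t * (u * b1))%N; first by ring.
rewrite h2; transitivity (v * v' * (t * c2))%N; first by ring.
rewrite -h1; transitivity (v' * w * (v * c1))%N; first by ring.
by rewrite -h3; ring.
Qed.

(** Weierstrass product inequality, from (1 - V)(1 - w) >= 1 - (V + w). Once V + w exceeds 1 the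
    lower bound is negative and nothing is left to show. *)
Lemma prod_bounds j (rho u v : nat -> R) :
  (forall r, (r < j)%N -> [/\ 0 <= rho r, 0 <= v r &
    expR (- u r) * (1 - v r) <= rho r <= expR (- u r)]) ->
  expR (- \sum_(r < j) u r) * (1 - \sum_(r < j) v r) <= \prod_(r < j) rho r
    <= expR (- \sum_(r < j) u r).
Proof.
elim: j => [|j IH] H; first by rewrite !big_ord0 oppr0 expR0 addr0 mulr1 lexx.
rewrite !big_ord_recr /=.
have {IH} /andP[lo hi] := IH (fun r rj => H r (leqW rj)).
have [r0 v0 /andP[lo' hi']] := H j (ltnSn j).
have P0 : 0 <= \prod_(r < j) rho r.
  by apply: prodr_ge0 => r _; have [] := H r (leqW (ltn_ord r)).
have V0 : 0 <= \sum_(r < j) v r.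
  by apply: sumr_ge0 => r _; have [] := H r (leqW (ltn_ord r)).
rewrite opprD expRD; move: lo hi lo' hi' (expR_gt0 (- u j)) P0 V0.
move: (expR_gt0 (- \sum_(r < j) u r)).
move: (expR (- \sum_(r < j) u r)) (expR (- u j)) (\prod_(r < j) rho r) (rho j) r0.
move: (\sum_(r < j) v r) (v j) v0.
move=> V w w0 E e P p p0 E0 lo hi lo' hi' e0 P0 V0.
apply/andP; split; last by apply: ler_pM.
have [V1|V1] := leP (V + w) 1; last first.
  apply: (@le_trans _ _ 0); last by apply: mulr_ge0.
  apply: mulr_ge0_le0; [by apply: mulr_ge0; apply: ltW|lra].
apply: (@le_trans _ _ ((E * (1 - V)) * (e * (1 - w)))).
  rewrite (_ : E * (1 - V) * _ = E * e * (1 - (V + w) + V * w)); last by ring.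
  apply: ler_wpM2l; first by apply: mulr_ge0; apply: ltW.
  have : 0 <= V * w by apply: mulr_ge0.
  lra.
by apply: ler_pM => //; apply: mulr_ge0; lra.
Qed.

End product_profiles.

(** * Gaussian and exponential estimates *)

Section exponential_bounds.
Variable R : realType.
Implicit Types (x u v w lam tau sigma g q c K : R).

Lemma pow_le_exp a : exists2 K, 0 <= K & forall x, 0 <= x ->
  x ^+ a <= K * expR x.
Proof.
(* The a-th power of x / a <= exp(x / a). *)
exists (a%:R ^+ a); first exact: exprn_ge0.
case: a => [|a] x x0; first by rewrite !expr0 mul1r -expR0 ler_expR.
have a0 : (0 : R) < a.+1%:R by [].
have h : x <= a.+1%:R * expR (x / a.+1%:R).
  rewrite -ler_pdivrMl// mulrC; apply: le_trans (expR_ge1Dx _).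
  by rewrite lerDr.
apply: (@le_trans _ _ ((a.+1%:R * expR (x / a.+1%:R)) ^+ a.+1)).
  by rewrite lerXn2r// nnegrE// mulr_ge0// expR_ge0.
by rewrite exprMn -expRM_natl [_ * (x / _)]mulrC divfK// gt_eqF.
Qed.

Lemma pow_gauss_bound a c : exists2 K, 0 <= K & forall x, 0 <= x ->
  x ^+ a * expR (- (x ^+ 2 / 2)) <= K * expR (- (c * x)).
Proof.
have [K K0 HK] := pow_le_exp a.
(* Completing the square: x - x^2/2 <= -c x + (c + 1)^2/2. *)
exists (K * expR ((c + 1) ^+ 2 / 2)); first by rewrite mulr_ge0// expR_ge0.
move=> x x0; apply: (@le_trans _ _ (K * expR x * expR (- (x ^+ 2 / 2)))).
  by rewrite ler_wpM2r ?expR_ge0// HK.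
rewrite -!mulrA -!expRD ler_wpM2l// ler_expR.
by have := sqr_ge0 (x - (c + 1)); nra.
Qed.

Lemma pow_gauss_bound1 a c : exists2 K, 0 <= K & forall x, 0 <= x ->
  x ^+ a * expR (- x ^+ 2) <= K * expR (- (c * x)).
Proof.
have [K K0 HK] := pow_gauss_bound a c; exists K => // x x0.
apply: le_trans (HK x x0); rewrite ler_wpM2l ?exprn_ge0// ler_expR.
by have := sqr_ge0 x; lra.
Qed.

Lemma expRN_dist u v w : w <= u -> w <= v ->
  `|expR (- u) - expR (- v)| <= `|u - v| * expR (- w).
Proof.
wlog uv : u v / u <= v => [H wu wv|wu wv].
  case: (leP u v) => [|/ltW] uv; first exact: H.
  by rewrite distrC [ `|u - v|]distrC; exact: H.
rewrite [ `|u - v|]distrC !ger0_norm ?subr_ge0 ?ler_expR ?lerN2//.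
have -> : expR (- v) = expR (- u) * expR (- (v - u)) by rewrite -expRD; congr expR; ring.
have h := expR_ge1Dx (- (v - u)).
apply: (@le_trans _ _ ((v - u) * expR (- u))); last first.
  by rewrite ler_wpM2l ?subr_ge0// ler_expR lerN2.
by have := expR_gt0 (- u); nra.
Qed.

(** Common form of both profiles: tau is 1/(4M) or 1/n, q is j(j - 1) or s(s - 1), and sigma is s.
    The rate exp(-2x) is chosen so that a factor exp(-x) survives multiplication by the polynomial
    weights. *)
Lemma profile_close c : 0 <= c -> exists2 K, 0 <= K &
  exists2 lam0, 0 < lam0 & forall lam tau q sigma g,
    0 < lam <= lam0 -> 1 <= sigma -> 0 <= tau ->
    `|tau - lam ^+ 2| <= c * lam ^+ 3 -> `|q - sigma ^+ 2| <= c * sigma ->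
    expR (- (tau * q)) * (1 - c * tau ^+ 2 * sigma ^+ 3) <= g
      <= expR (- (tau * q)) ->
    `|g - expR (- (lam * sigma) ^+ 2)| <= K * lam * expR (- (2 * (lam * sigma))).
Proof.
move=> c0; pose c' := c ^+ 2 + c.
have c'0 : 0 <= c' by rewrite addr_ge0 ?sqr_ge0.
have [K1 K10 H1] := pow_gauss_bound 1 2.
have [K2 K20 H2] := pow_gauss_bound 2 2.
have [K3 K30 H3] := pow_gauss_bound 3 2.
exists (expR 1 * (c' * (K1 + K2) + 4 * c * K3)).
  by rewrite mulr_ge0 ?expR_ge0// addr_ge0// !mulr_ge0// addr_ge0.
(* Ensures c' lam <= 1/4, hence tau q >= x^2/2 - 1: half of the Gaussian exponent remains to control
   the error terms. *)
exists (4 * c' + 1)^-1; first by rewrite invr_gt0; lra.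
move=> lam tau q sigma g /andP[lam0 lamle] sigma1 tau0 htau hq /andP[glo ghi].
have sigma0 : 0 <= sigma by lra.
set x := lam * sigma; have x0 : 0 <= x by rewrite mulr_ge0// ltW.
have lamc : lam * (4 * c' + 1) <= 1.
  by rewrite -ler_pdivlMr ?mul1r//; lra.
have lam1 : lam <= 1 by nra.
have clam : c * lam <= 1 by rewrite /c' in lamc; nra.
have htau' : tau <= 2 * lam ^+ 2.
  move: htau; rewrite ler_norml => /andP[_ h].
  have : c * lam ^+ 3 <= lam ^+ 2 by rewrite exprS mulrA ler_piMl// sqr_ge0.
  by lra.
have hx : `|tau * q - x ^+ 2| <= c' * lam * (x + x ^+ 2).
  have -> : tau * q - x ^+ 2 = (tau - lam ^+ 2) * q + lam ^+ 2 * (q - sigma ^+ 2).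
    by rewrite /x; ring.
  apply: le_trans (ler_normD _ _) _; rewrite (normrM (tau - _)).
  rewrite (normrM (lam ^+ 2)) (ger0_norm (sqr_ge0 lam)).
  have hq' : `|q| <= sigma ^+ 2 + c * sigma.
    rewrite -[q](subrK (sigma ^+ 2)); apply: le_trans (ler_normD _ _) _.
    by rewrite (ger0_norm (sqr_ge0 sigma)) addrC lerD2l.
  apply: (@le_trans _ _ (c * lam ^+ 3 * (sigma ^+ 2 + c * sigma) + lam ^+ 2 * (c * sigma))).
    apply: lerD; first by apply: ler_pM.
    by rewrite ler_wpM2l// sqr_ge0.
  rewrite (_ : _ + _ = lam * (c * x ^+ 2 + c ^+ 2 * lam * x + c * x)); last by rewrite /x; ring.
  rewrite [c' * lam]mulrC -(mulrA lam) ler_wpM2l ?(ltW lam0)// /c'.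
  have : c ^+ 2 * lam * x <= c ^+ 2 * x.
    by rewrite ler_wpM2r// ler_piMr// sqr_ge0.
  have : 0 <= c ^+ 2 * x ^+ 2 by rewrite mulr_ge0// sqr_ge0.
  by lra.
have hw : x ^+ 2 / 2 - 1 <= tau * q.
  move: hx; rewrite ler_norml => /andP[h _].
  have : c' * lam * (x + x ^+ 2) <= 4^-1 * (x + x ^+ 2).
    by rewrite ler_wpM2r ?addr_ge0 ?sqr_ge0//; lra.
  by have := sqr_ge0 (x - 1); nra.
set E := expR (- (x ^+ 2 / 2)).
have eE : expR (- (x ^+ 2 / 2 - 1)) = expR 1 * E.
  by rewrite -expRD; congr expR; ring.
have d1 : `|expR (- (tau * q)) - expR (- x ^+ 2)| <=
    c' * lam * (x + x ^+ 2) * (expR 1 * E).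
  rewrite -eE; apply: le_trans (expRN_dist hw _) _.
    by have := sqr_ge0 x; lra.
  by rewrite ler_wpM2r ?expR_ge0.
have d2 : `|g - expR (- (tau * q))| <= 4 * c * lam * x ^+ 3 * (expR 1 * E).
  rewrite distrC ger0_norm ?subr_ge0//.
  apply: (@le_trans _ _ (c * tau ^+ 2 * sigma ^+ 3 * expR (- (tau * q)))).
    by move: glo; lra.
  rewrite -eE; apply: ler_pM; rewrite ?expR_ge0//.
    by rewrite !mulr_ge0.
  - have t2 : tau ^+ 2 <= (2 * lam ^+ 2) ^+ 2 by rewrite lerXn2r// nnegrE mulr_ge0// sqr_ge0.
    rewrite (_ : 4 * c * lam * x ^+ 3 = c * (2 * lam ^+ 2) ^+ 2 * sigma ^+ 3);
      last by rewrite /x; ring.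
    by rewrite ler_wpM2r ?exprn_ge0// ler_wpM2l.
  - by rewrite ler_expR lerN2.
rewrite -[g](subrK (expR (- (tau * q)))) -addrA; apply: le_trans (ler_normD _ _) _.
apply: le_trans (lerD d2 d1) _.
rewrite [leLHS](_ : _ =
    expR 1 * lam * (4 * c * (x ^+ 3 * E) + c' * (x ^+ 1 * E + x ^+ 2 * E)));
  last by rewrite expr1; clearbody E x c'; ring.
rewrite [leRHS](_ : _ = expR 1 * lam * (4 * c * (K3 * expR (- (2 * x))) +
  c' * (K1 * expR (- (2 * x)) + K2 * expR (- (2 * x))))); last by ring.
apply: ler_wpM2l; first by rewrite mulr_ge0 ?expR_ge0// ltW.
apply: lerD; first by rewrite ler_wpM2l ?mulr_ge0// H3.
by rewrite ler_wpM2l// lerD// ?H1 ?H2.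
Qed.

End exponential_bounds.

(** * The generalized gamma law *)

Section gamma_tail.
Variable R : realType.
Implicit Types (x y lam : R).

Lemma is_deriveMf (f g : R -> R) (x df dg : R) :
  is_derive x 1 f df -> is_derive x 1 g dg ->
  is_derive x 1 (fun t => f t * g t) (df * g x + f x * dg).
Proof.
move=> hf hg; apply: (is_derive_eq (is_deriveM hf hg)).
by rewrite /GRing.scale /=; ring.
Qed.

Lemma is_derive_powf n (x : R) :
  is_derive x 1 (fun t : R => t ^+ n) (n%:R * x ^+ n.-1).
Proof.
have -> : (fun t : R => t ^+ n) = (id : R -> R) ^+ n.
  by apply/funext => t; rewrite exprfctE.
apply: (is_derive_eq (is_deriveX n (is_derive_id x (1 : R)))).
by rewrite /GRing.scale /= mulr1.
Qed.

Lemma is_derive_expRf (f : R -> R) (x df : R) : is_derive x 1 f df ->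
  is_derive x 1 (fun t => expR (f t)) (expR (f x) * df).
Proof. by move=> hf; exact: (@is_derive1_comp _ expR f). Qed.

Lemma is_derive_scalef (f : R -> R) (x c df : R) : is_derive x 1 f df ->
  is_derive x 1 (fun t => c * f t) (c * df).
Proof. by move=> hf; have := is_deriveZ c hf. Qed.

Lemma is_derive_gauss x :
  is_derive x 1 (fun t => expR (- t ^+ 2)) (expR (- x ^+ 2) * (- (2 * x))).
Proof.
apply: is_derive_expRf.
have := is_deriveN (is_derive_powf 2 x).
by rewrite /= expr1.
Qed.

(** Probability that a Poisson variable of mean x^2 is less than k. *)
Definition tail k x : R :=
  expR (- x ^+ 2) * \sum_(i < k) x ^+ (2 * i) / (i`!)%:R.

(** Density of GG(2k, 2) on the positive axis, with (k - 1)! for the value of the Gamma function at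
    k. *)
Definition dens k x : R :=
  2 / (k.-1`!)%:R * (x ^+ (2 * k - 1) * expR (- x ^+ 2)).

(** The derivative of each new summand cancels the density produced so far and creates the next
    one. *)
Lemma is_derive_tail k x : is_derive x 1 (tail k.+1) (- dens k.+1 x).
Proof.
elim: k => [|k IH].
  have -> : tail 1 = fun t => expR (- t ^+ 2).
    by apply/funext => t; rewrite /tail big_ord1 expr0 divr1 mulr1.
  apply: (is_derive_eq (is_derive_gauss x)).
  by rewrite /dens /= divr1 expr1; ring.
have -> : tail k.+2 = fun t => tail k.+1 t +
    ((k.+1)`!%:R)^-1 * (t ^+ (2 * k.+1) * expR (- t ^+ 2)).
  by apply/funext => t; rewrite /tail big_ord_recr /= mulrDr; congr (_ + _); ring.
have h := is_derive_scalef (((k.+1)`!%:R)^-1)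
  (is_deriveMf (is_derive_powf (2 * k.+1) x) (is_derive_gauss x)).
apply: (is_derive_eq (is_deriveD IH h)).
rewrite /dens.
have -> : (2 * k.+2 - 1 = (2 * k).+3)%N by lia.
have -> : (2 * k.+1 - 1 = (2 * k).+1)%N by lia.
have -> : ((2 * k.+1).-1 = (2 * k).+1)%N by lia.
have -> : (2 * k.+1 = (2 * k).+2)%N by lia.
rewrite [k.+2.-1]/= [k.+1.-1]/= factS natrM !exprS.
have -> : ((2 * k).+2%:R = 2 * k.+1%:R :> R) by rewrite -natrM; congr _%:R; lia.
have f0 : (k`!%:R : R) != 0 by rewrite pnatr_eq0 -lt0n fact_gt0.
have k0 : (k.+1%:R : R) != 0 by rewrite pnatr_eq0.
move: (k.+1%:R : R) (k`!%:R : R) k0 f0 (expR _) (x ^+ (2 * k)) => a b a0 b0 E p.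
by field; rewrite a0 b0.
Qed.

Lemma tail0 k : tail k.+1 0 = 1.
Proof.
rewrite /tail expr0n oppr0 expR0 mul1r big_ord_recl /= expr0 divr1.
by rewrite big1 ?addr0// => i _; rewrite expr0n mul0r.
Qed.

Lemma dens_ge0 k x : 0 <= x -> 0 <= dens k x.
Proof.
move=> x0; rewrite /dens mulr_ge0 ?divr_ge0//.
by rewrite mulr_ge0 ?exprn_ge0 ?expR_ge0.
Qed.

Lemma is_derive_continuous (f df : R -> R) (A : set R) :
  (forall x, is_derive x 1 f (df x)) -> {within A, continuous f}.
Proof.
move=> h; apply: continuous_subspaceT => x.
apply: differentiable_continuous; apply/derivable1_diffP.
by have [] := h x.
Qed.

Lemma tail_increment k x y : x <= y -> exists2 c, x <= c <= y &
  tail k.+1 x - tail k.+1 y = dens k.+1 c * (y - x).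
Proof.
move=> xy; have cont := is_derive_continuous (A := `[x, y]) (@is_derive_tail k).
have [c] := MVT_segment xy (fun z _ => is_derive_tail k z) cont.
rewrite in_itv /= => cxy e; exists c => //.
by rewrite -opprB e; ring.
Qed.

Definition ddens k x : R := 2 / (k.-1`!)%:R *
  ((2 * k - 1)%:R * x ^+ (2 * k - 1).-1 * expR (- x ^+ 2) +
   x ^+ (2 * k - 1) * (expR (- x ^+ 2) * (- (2 * x)))).

Lemma is_derive_dens k x : is_derive x 1 (dens k) (ddens k x).
Proof.
exact: is_derive_scalef (is_deriveMf (is_derive_powf _ x) (is_derive_gauss x)).
Qed.

Lemma dens_bound k : exists2 K, 0 <= K & forall x, 0 <= x ->
  dens k x <= K * expR (- x).
Proof.
have [K K0 HK] := @pow_gauss_bound1 R (2 * k - 1) 1.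
exists (2 / (k.-1`!)%:R * K); first by rewrite mulr_ge0 ?divr_ge0.
move=> x x0; rewrite /dens -(mulrA _ K) ler_wpM2l ?divr_ge0//.
by have := HK x x0; rewrite mul1r.
Qed.

Lemma ddens_bound k : exists2 K, 0 <= K & forall x, 0 <= x ->
  `|ddens k x| <= K * expR (- x).
Proof.
have [K K0 HK] := @pow_gauss_bound1 R (2 * k - 1).-1 1.
have [K' K'0 HK'] := @pow_gauss_bound1 R (2 * k - 1).+1 1.
exists (2 / (k.-1`!)%:R * ((2 * k - 1)%:R * K + 2 * K')).
  by rewrite mulr_ge0 ?divr_ge0// addr_ge0// mulr_ge0.
move=> x x0; rewrite /ddens normrM ger0_norm ?divr_ge0// -(mulrA (2 / _)).
rewrite ler_wpM2l ?divr_ge0// [leRHS]mulrDl; apply: le_trans (ler_normD _ _) _.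
have := HK x x0; have := HK' x x0; rewrite !mul1r => h' h.
apply: lerD.
  rewrite -!mulrA normrM ger0_norm// ler_wpM2l//.
  by rewrite ger0_norm// mulr_ge0 ?exprn_ge0 ?expR_ge0.
rewrite (_ : _ * _ = - (2 * (x ^+ (2 * k - 1).+1 * expR (- x ^+ 2)))); last first.
  by rewrite (exprS x (2 * k - 1)); ring.
rewrite normrN ger0_norm.
  by rewrite -mulrA ler_wpM2l.
by rewrite !mulr_ge0 ?exprn_ge0 ?expR_ge0.
Qed.

Lemma tail_ge0 k x : 0 <= tail k x.
Proof.
rewrite /tail mulr_ge0 ?expR_ge0//; apply: sumr_ge0 => i _.
by rewrite divr_ge0// exprM exprn_ge0// sqr_ge0.
Qed.

Lemma tail_bound k : exists2 K, 0 <= K & forall x, 0 <= x ->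
  tail k x <= K * expR (- x).
Proof.
elim: k => [|k [K K0 HK]].
  by exists 0 => // x _; rewrite /tail big_ord0 mulr0 mul0r.
have [K' K'0 HK'] := @pow_gauss_bound1 R (2 * k) 1.
exists (K + K' / (k`!)%:R); first by rewrite addr_ge0// divr_ge0.
move=> x x0; rewrite /tail big_ord_recr /= mulrDr mulrDl.
apply: lerD; first exact: HK.
rewrite mulrA [_ * x ^+ _]mulrC [X in _ <= X]mulrAC ler_wpM2r ?invr_ge0//.
by have := HK' x x0; rewrite mul1r.
Qed.

(** Mean value theorem for [tail], then for [dens]. The exponential factor is kept so that these
    errors sum to O(lam) over all s. *)
Lemma tail_step k : exists2 K, 0 <= K & forall lam s, 0 < lam ->
  `|tail k.+1 (lam * s%:R) - tail k.+1 (lam * s.+1%:R) - lam * dens k.+1 (lam * s%:R)|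
    <= K * lam ^+ 2 * expR (- (lam * s%:R)).
Proof.
have [K K0 HK] := ddens_bound k.+1; exists K => // lam s lam0.
set x := lam * s%:R; have x0 : 0 <= x by rewrite mulr_ge0// ltW.
have -> : lam * s.+1%:R = x + lam by rewrite -natr1 mulrDr mulr1.
have [|c /andP[xc cx] ->] := @tail_increment k x (x + lam).
  by rewrite lerDl ltW.
have cont := is_derive_continuous (A := `[x, c]) (@is_derive_dens k.+1).
have [d] := MVT_segment xc (fun z _ => is_derive_dens k.+1 z) cont.
rewrite in_itv /= => /andP[xd dc] e.
have -> : dens k.+1 c * (x + lam - x) - lam * dens k.+1 x = lam * (ddens k.+1 d * (c - x)).
  by rewrite -e; ring.
rewrite normrM gtr0_norm// normrM (_ : _ * expR _ = lam * (K * expR (- x) * lam)); last by ring.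
rewrite ler_wpM2l ?(ltW lam0)//; apply: ler_pM => //.
  apply: le_trans (HK d (le_trans x0 xd)) _.
  by rewrite ler_wpM2l// ler_expR lerN2.
by rewrite ger0_norm ?subr_ge0//; lra.
Qed.

Lemma sum_exp_bound lam m : 0 < lam ->
  \sum_(s < m) lam * expR (- (lam * s%:R)) <= lam + 1.
Proof.
move=> lam0; case: m => [|m]; first by rewrite big_ord0; lra.
(* This stronger bound telescopes: by exp(lam) >= 1 + lam, each term is at most the decrease of
   exp(-lam s) over the preceding step. *)
suff : \sum_(s < m.+1) lam * expR (- (lam * s%:R)) <= lam + 1 - expR (- (lam * m%:R)).
  by have := expR_gt0 (- (lam * m%:R)); lra.
elim: m => [|m IH].
  by rewrite big_ord1 mulr0 oppr0 expR0; lra.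
rewrite big_ord_recr /=; apply: le_trans (lerD IH (lexx _)) _.
have -> : expR (- (lam * m%:R)) = expR (- (lam * m.+1%:R)) * expR lam.
  by rewrite -expRD; congr expR; rewrite -natr1; ring.
have := expR_ge1Dx lam; have := expR_gt0 (- (lam * m.+1%:R)).
by nra.
Qed.

End gamma_tail.

(** * Gamma at integers and the distribution function of GG(2k, 2) *)

Section generalized_gamma.
Variable R : realType.
Implicit Types (x y t : R).
Local Notation mu := (@lebesgue_measure R).

(** [tail] in the variable t = x^2; being an antiderivative up to a constant, with limit 0 at
    infinity, it evaluates the integral [Gamma] at integers. *)
Definition gtail k t : R := expR (- t) * \sum_(i < k) t ^+ i / (i`!)%:R.

Lemma is_derive_gtail k t :
  is_derive t 1 (gtail k.+1) (- (t ^+ k * expR (- t) / (k`!)%:R)).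
Proof.
have e x : is_derive x 1 (fun y : R => expR (- y)) (expR (- x) * -1).
  exact: is_derive_expRf.
elim: k => [|k IH].
  have -> : gtail 1 = fun t => expR (- t).
    by apply/funext => x; rewrite /gtail big_ord1 expr0 divr1 mulr1.
  by apply: (is_derive_eq (e t)); rewrite expr0 divr1; ring.
have -> : gtail k.+2 = fun t => gtail k.+1 t +
    ((k.+1)`!%:R)^-1 * (t ^+ k.+1 * expR (- t)).
  by apply/funext => x; rewrite /gtail big_ord_recr /= mulrDr; congr (_ + _); ring.
have h := is_derive_scalef (((k.+1)`!%:R)^-1)
  (is_deriveMf (is_derive_powf k.+1 t) (e t)).
apply: (is_derive_eq (is_deriveD IH h)).
rewrite [k.+1.-1]/= factS natrM exprS.
have f0 : (k`!%:R : R) != 0 by rewrite pnatr_eq0 -lt0n fact_gt0.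
have k0 : (k.+1%:R : R) != 0 by rewrite pnatr_eq0.
move: (k.+1%:R : R) (k`!%:R : R) k0 f0 (expR _) (t ^+ k) => a b a0 b0 E p.
by field; rewrite a0 b0.
Qed.

Lemma gtail_bound k : exists2 K, 0 <= K & forall t, 0 < t -> gtail k t <= K / t.
Proof.
elim: k => [|k [K K0 HK]].
  by exists 0 => // t t0; rewrite /gtail big_ord0 mulr0 mul0r.
have [K' K'0 HK'] := pow_le_exp R k.+1.
exists (K + K' / (k`!)%:R); first by rewrite addr_ge0// divr_ge0.
move=> t t0; rewrite /gtail big_ord_recr /= mulrDr mulrDl.
apply: lerD; first exact: HK.
rewrite mulrA [leRHS]mulrAC ler_wpM2r ?invr_ge0// ler_pdivlMr//.
rewrite -mulrA -exprSr expRN mulrC ler_pdivrMr ?expR_gt0//.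
by apply: HK'; exact: ltW.
Qed.

Lemma gtail_ge0 k t : 0 <= t -> 0 <= gtail k t.
Proof.
move=> t0; rewrite /gtail mulr_ge0 ?expR_ge0//; apply: sumr_ge0 => i _.
by rewrite divr_ge0// exprn_ge0.
Qed.

Lemma gtail_cvg k : gtail k t @[t --> +oo] --> (0 : R).
Proof.
have [K K0 HK] := gtail_bound k.
apply/cvgrPdist_lt => /= e e0; near=> t.
have t0 : 0 < t by near: t; apply: nbhs_pinfty_gt; exact: num_real.
rewrite sub0r normrN ger0_norm ?gtail_ge0 ?ltW//.
apply: le_lt_trans (HK t t0) _; rewrite ltr_pdivrMr// mulrC -ltr_pdivrMr//.
by near: t; apply: nbhs_pinfty_gt; exact: num_real.
Unshelve. all: by end_near. Qed.

Lemma is_derive_cvg_right (f : R -> R) (x df : R) : is_derive x 1 f df ->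
  f t @[t --> x^'+] --> f x.
Proof.
move=> h; apply: cvg_at_right_filter.
by apply: differentiable_continuous; apply/derivable1_diffP; have [] := h.
Qed.

Lemma is_derive_cvg_left (f : R -> R) (x df : R) : is_derive x 1 f df ->
  f t @[t --> x^'-] --> f x.
Proof.
move=> h; apply: cvg_at_left_filter.
by apply: differentiable_continuous; apply/derivable1_diffP; have [] := h.
Qed.

Lemma Gamma_nat k : Gamma (k.+1%:R : R) = (k`!)%:R.
Proof.
pose f t : R := t ^+ k * expR (- t).
have df t : is_derive t 1 (fun t => - (k`!)%:R * gtail k.+1 t) (f t).
  apply: (is_derive_eq (is_derive_scalef (- (k`!)%:R) (is_derive_gtail k t))).
  have f0 : (k`!%:R : R) != 0 by rewrite pnatr_eq0 -lt0n fact_gt0.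
  by rewrite /f; field.
have cf : continuous f.
  move=> t; apply: differentiable_continuous; apply/derivable1_diffP.
  have e : is_derive t 1 (fun y : R => expR (- y)) (expR (- t) * -1).
    exact: is_derive_expRf.
  by have [] := is_deriveMf (is_derive_powf k t) e.
have E : (\int[mu]_(t in `[0%R, +oo[) (f t)%:E = ((k`!)%:R)%:E)%E.
  rewrite (@ge0_continuous_FTC2y _ f (fun t => - (k`!)%:R * gtail k.+1 t) 0 0).
  - by rewrite /gtail oppr0 expR0 mul1r big_ord_recl expr0 divr1 big1
      ?addr0 ?mulr1 ?opprK -?EFinB ?sub0r ?opprK// => i _; rewrite expr0n mul0r.
  - by move=> x x0; rewrite /f mulr_ge0 ?exprn_ge0 ?expR_ge0.
  - exact: continuous_subspaceT.
  - rewrite -[X in _ --> X](mulr0 (- (k`!)%:R)); apply: cvgM; last exact: gtail_cvg.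
    exact: cvg_cst.
  - by move=> x _; have [] := df x.
  - exact: is_derive_cvg_right.
  - by move=> x _; rewrite derive1E; have [_ ->] := df x.
rewrite /Gamma /Rintegral -[RHS]/(fine ((k`!)%:R)%:E) -E; congr fine.
(* [Gamma] integrates over the open half-line, the computation above over the closed one. *)
rewrite -integral_itv_obnd_cbnd; last first.
  apply/measurable_realfun.measurable_EFinP; apply: measurable_funTS.
  exact: measurable_realfun.continuous_measurable_fun.
apply: eq_integral => t; rewrite inE /= in_itv /= andbT => t0.
by rewrite /f -natr1 addrK powR_mulrn// ltW.
Qed.

Lemma GG_pdfE k t : GG_pdf (2 * k.+1)%:R 2 t =
  if 0 < t then dens k.+1 t else 0.
Proof.
rewrite /GG_pdf; case: ltP => // t0.
have -> : (2 * k.+1)%:R / 2 = k.+1%:R :> R by rewrite natrM; field.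
rewrite Gamma_nat /dens [k.+1.-1]/=.
have -> : (2 * k.+1)%:R - 1 = (2 * k.+1 - 1)%:R :> R by rewrite natrB//; lia.
rewrite !powR_mulrn ?(ltW t0)//.
by ring.
Qed.

Lemma GG_cdf k x : fine (GG (2 * k.+1)%:R 2 `]-oo, x]%classic) =
  if 0 <= x then 1 - tail k.+1 x else 0.
Proof.
rewrite /GG integral_mkcond.
have E : ((fun t : R => (GG_pdf (2 * k.+1)%:R 2 t)%:E) \_ `]-oo, x]) =
    ((EFin \o dens k.+1) \_ `[0, x]).
  apply/funext => t; rewrite !patchE GG_pdfE.
  rewrite !mem_setE !in_itv /=.
  case: (ltgtP t 0) => [t0|t0|->] /=; first by rewrite if_same.
  - by [].
  (* At t = 0 the strict inequality in [GG_pdf] agrees with [dens], which vanishes there because its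
     exponent 2k + 1 is positive. *)
  - rewrite if_same /dens expr0n; case: ifP => //= _.
    rewrite (_ : (_ == _)%N = false) ?mul0r ?mulr0//; lia.
rewrite E -integral_mkcond.
have [x0|x0|<-] := ltgtP 0 x.
- have cd : {within `[0, x], continuous dens k.+1}.
    exact: is_derive_continuous (@is_derive_dens R k.+1).
  have dF t : is_derive t 1 (fun t => - tail k.+1 t) (dens k.+1 t).
    by have := is_deriveN (is_derive_tail k t); rewrite opprK.
  rewrite (continuous_FTC2 (F := fun t => - tail k.+1 t) x0 cd).
  + by rewrite -EFinB /= tail0; ring.
  + split; first by move=> y _; have [] := dF y.
      exact: is_derive_cvg_right (dF 0).
    exact: is_derive_cvg_left (dF x).
  + by move=> y _; rewrite derive1E; have [_ ->] := dF y.
- by rewrite set_itv_ge ?integral_set0// bnd_simp -ltNge.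
- by rewrite set_itv1 integral_set1 tail0 subrr.
Qed.

End generalized_gamma.

(** * Kolmogorov distance *)

Section convergence.
Variable R : realType.
Implicit Types (x y lam K : R).

Lemma partial_sums_close k K : 0 <= K -> exists2 K', 0 <= K' &
  forall lam (h : nat -> R), 0 < lam <= 1 ->
  (forall s, `|h s - lam * dens k.+1 (lam * s%:R)|
     <= K * lam ^+ 2 * expR (- (lam * s%:R))) ->
  forall J, `|\sum_(s < J) h s - (1 - tail k.+1 (lam * J%:R))| <= K' * lam.
Proof.
move=> K0; have [Kq Kq0 Hq] := tail_step R k.
exists (2 * (K + Kq)); first by rewrite mulr_ge0// addr_ge0.
move=> lam h /andP[lam0 lam1] Hh J.
have -> : 1 - tail k.+1 (lam * J%:R) =
    \sum_(s < J) (tail k.+1 (lam * s%:R) - tail k.+1 (lam * s.+1%:R)).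
  elim: J => [|J IH]; first by rewrite big_ord0 mulr0 tail0 subrr.
  by rewrite big_ord_recr /= -IH; ring.
rewrite -sumrB; apply: le_trans (ler_norm_sum _ _ _) _.
apply: (@le_trans _ _ (\sum_(s < J) (K + Kq) * lam * (lam * expR (- (lam * s%:R))))).
  apply: ler_sum => s _; set d := lam * dens k.+1 (lam * s%:R).
  rewrite (_ : h s - _ = (h s - d) -
    (tail k.+1 (lam * s%:R) - tail k.+1 (lam * s.+1%:R) - d)); last by ring.
  apply: le_trans (ler_normB _ _) _; apply: le_trans (lerD (Hh s) (Hq lam s lam0)) _.
  by rewrite le_eqVlt; apply/orP; left; apply/eqP; ring.
rewrite -mulr_sumr [2 * _]mulrC -!mulrA ler_wpM2l ?addr_ge0// mulrC.
rewrite ler_wpM2r ?(ltW lam0)//.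
by apply: le_trans (sum_exp_bound J lam0) _; lra.
Qed.

Lemma tail_le1 k x : 0 <= x -> tail k.+1 x <= 1.
Proof.
move=> x0; have [c /andP[c0 _] e] := tail_increment k x0.
rewrite -(tail0 R k) -subr_ge0 e mulr_ge0 ?subr_ge0//.
exact: dens_ge0.
Qed.

Lemma normalized_sums_close k K : 0 <= K -> exists2 K', 0 <= K' &
  exists2 lam0, 0 < lam0 & forall lam (h : nat -> R) S, 0 < lam <= lam0 ->
  (forall s, `|h s - lam * dens k.+1 (lam * s%:R)|
     <= K * lam ^+ 2 * expR (- (lam * s%:R))) ->
  (forall s, (S <= s)%N -> h s = 0) ->
  0 < \sum_(s < S) h s /\ forall J,
  `|(\sum_(s < J) h s) / (\sum_(s < S) h s) - (1 - tail k.+1 (lam * J%:R))|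
    <= K' * lam.
Proof.
move=> K0; have [K1 K10 H1] := partial_sums_close k K0.
have [Kt Kt0 Ht] := tail_bound R k.+1.
exists (2 * (2 * K1 + 1)); first by rewrite mulr_ge0// addr_ge0// mulr_ge0.
(* Forces T >= 1/2, whence the outer factor 2 in the constant. *)
exists (2 * (K1 + 1))^-1; first by rewrite invr_gt0; lra.
move=> lam h S /andP[lam0 lamle] Hh hS.
have lamK : lam * (2 * (K1 + 1)) <= 1 by rewrite -ler_pdivlMr ?mul1r//; lra.
have lam1 : lam <= 1 by nra.
have {}H1 := H1 lam h _ Hh; rewrite lam0 lam1 in H1.
have {}H1 J := H1 isT J.
set T := \sum_(s < S) h s.
have sumT J : (S <= J)%N -> \sum_(s < J) h s = T.
  move=> SJ; rewrite -(subnKC SJ) big_split_ord /= [X in _ + X]big1 ?addr0// => i _.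
  by rewrite hS// leq_addr.
have T1 : `|T - 1| <= (K1 + 1) * lam.
  (* From S on the partial sums equal T, and once J >= Kt / lam^2 the tail is at most Kt / (lam J)
     <= lam. *)
  pose J := maxn S (Num.bound (Kt / lam ^+ 2)).
  have J0 : Kt / lam ^+ 2 <= J%:R.
    have h0 : 0 <= Kt / lam ^+ 2 by rewrite divr_ge0// sqr_ge0.
    by apply: le_trans (ltW (archi_boundP h0)) _; rewrite ler_nat leq_maxr.
  have tJ : tail k.+1 (lam * J%:R) <= lam.
    have y0 : 0 <= lam * J%:R by rewrite mulr_ge0// ltW.
    apply: le_trans (Ht _ y0) _.
    rewrite expRN ler_pdivrMr ?expR_gt0//.
    have := expR_ge1Dx (lam * J%:R); rewrite ler_pdivrMr ?exprn_gt0// in J0.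
    by nra.
  have := H1 J; rewrite sumT ?leq_maxl// => h1.
  rewrite (_ : T - 1 = T - (1 - tail k.+1 (lam * J%:R)) - tail k.+1 (lam * J%:R)); last by ring.
  apply: le_trans (ler_normB _ _) _; rewrite mulrDl mul1r lerD//.
  by rewrite ger0_norm ?tail_ge0.
have T2 : 2^-1 <= T.
  by move: T1; rewrite ler_norml => /andP[h1 _]; lra.
have T0 : 0 < T by lra.
split=> // J.
have y0 : 0 <= lam * J%:R by rewrite mulr_ge0// ltW.
have := H1 J; have := tail_ge0 k.+1 (lam * J%:R); have := tail_le1 k y0.
move: (tail k.+1 _) (\sum_(s < J) h s) => t H t1 t0 HJ.
rewrite (_ : H / T - _ = ((H - (1 - t)) - (1 - t) * (T - 1)) / T); last first.
  by field; rewrite gt_eqF.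
rewrite normrM normfV (gtr0_norm T0) ler_pdivrMr//.
apply: (@le_trans _ _ ((2 * K1 + 1) * lam)).
  apply: le_trans (ler_normB _ _) _.
  rewrite (_ : (2 * K1 + 1) * lam = K1 * lam + 1 * ((K1 + 1) * lam)); last by ring.
  apply: lerD => //; rewrite normrM ler_pM// ger0_norm; lra.
have : 0 <= (2 * K1 + 1) * lam by rewrite mulr_ge0 ?addr_ge0 ?mulr_ge0// ltW.
by nra.
Qed.

Definition weighted_law lam (N : nat -> R) S : set R -> \bar R :=
  fun B => ((\sum_(s < S) N s * \1_B (lam * s%:R)) / \sum_(s < S) N s)%:E.

(** The unknown factor kappa cancels in the normalized law, so the counts need to be known up to
    proportionality only. The absolute value is the form in which the O-estimate uses the
    distance. *)
Lemma kolmogorov_close k K : 0 <= K -> exists2 K', 0 <= K' &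
  exists2 lam0, 0 < lam0 & forall lam kappa (h N : nat -> R) S,
  0 < lam <= lam0 -> 0 < kappa ->
  (forall s, `|h s - lam * dens k.+1 (lam * s%:R)|
     <= K * lam ^+ 2 * expR (- (lam * s%:R))) ->
  (forall s, (S <= s)%N -> h s = 0) -> (forall s, N s = kappa * h s) ->
  `|kolmogorov (weighted_law lam N S) (GG (2 * k.+1)%:R 2)| <= K' * lam.
Proof.
move=> K0; have [K1 K10 [lam0 lam0_gt0 H1]] := normalized_sums_close k K0.
have [Kd Kd0 Hd] := dens_bound R k.+1.
exists (K1 + Kd); first exact: addr_ge0.
exists lam0 => // lam kappa h N S lamle kappa0 Hh hS NE.
have [T0 {}H1] := H1 lam h S lamle Hh hS.
have /andP[lam_gt0 _] := lamle.
rewrite /kolmogorov; set A := (X in sup X).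
have ubA : ubound A ((K1 + Kd) * lam).
  move=> _ [x _ <-]; rewrite GG_cdf /weighted_law /=.
  rewrite (eq_bigr (fun s : 'I_S =>
    kappa * (h s * \1_`]-oo, x]%classic (lam * s%:R)))); last first.
    by move=> s _; rewrite NE mulrA.
  rewrite [X in _ / X](eq_bigr (fun s : 'I_S => kappa * h s)) => [|s _]; last exact: NE.
  rewrite -!mulr_sumr -mulf_div divff ?mul1r ?gt_eqF//.
  have [x0|x0] := leP 0 x; last first.
    rewrite big1 => [|s _]; first by rewrite mul0r subr0 normr0 mulr_ge0 ?addr_ge0 ?(ltW lam_gt0).
    rewrite indicE (_ : _ \in _ = false) ?mulr0//.
    apply/negbTE; rewrite mem_setE in_itv /= -ltNge (lt_le_trans x0)//.
    by rewrite mulr_ge0// ltW.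
  (* The distribution function at x is the partial sum below J, and lam J exceeds x by at most lam;
     moving from lam J to x costs at most Kd lam, as Kd bounds the density. *)
  pose J := (Num.trunc (x / lam)).+1.
  have xl : 0 <= x / lam by rewrite divr_ge0// ltW.
  have /andP[Jlo Jhi] := truncn_itv xl.
  have inJ s : (lam * s%:R \in `]-oo, x]%classic) = (s < J)%N.
    rewrite mem_setE in_itv /= mulrC -ler_pdivlMr// /J ltnS.
    apply/idP/idP => [sx|sJ]; last by apply: le_trans Jlo; rewrite ler_nat.
    by rewrite -ltnS -(ltr_nat R); exact: le_lt_trans Jhi.
  have -> : \sum_(s < S) h s * \1_`]-oo, x]%classic (lam * s%:R) = \sum_(s < J) h s.
    transitivity (\sum_(s < maxn S J | (s < J)%N) h s).
      rewrite (big_ord_widen_cond (maxn S J) xpredT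
        (fun s => h s * \1_`]-oo, x]%classic (lam * s%:R))) ?leq_maxl//=.
      rewrite big_mkcond [RHS]big_mkcond; apply: eq_bigr => s _.
      rewrite indicE inJ; case: ltnP => [_|/hS ->]; last by rewrite if_same.
      by case: ifP; rewrite ?mulr1 ?mulr0.
    by rewrite -(big_ord_widen _ h) ?leq_maxr.
  rewrite -[X in X - _](subrK (1 - tail k.+1 (lam * J%:R))) -addrA.
  apply: le_trans (ler_normD _ _) _; rewrite mulrDl lerD//.
  have xJ : x <= lam * J%:R by rewrite mulrC -ler_pdivrMr// ltW.
  have [c /andP[xc cJ] e] := tail_increment k xJ.
  rewrite (_ : _ - _ = dens k.+1 c * (lam * J%:R - x)); last by rewrite -e; ring.
  have c0 : 0 <= c by exact: le_trans xc.
  rewrite normrM !ger0_norm ?subr_ge0 ?dens_ge0//; apply: ler_pM; rewrite ?subr_ge0 ?dens_ge0//.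
    apply: le_trans (Hd c c0) _; rewrite ler_piMr// -expR0 ler_expR; lra.
  by move: Jlo; rewrite /J ler_pdivlMr// -natr1; lra.
have A0 : A !=set0.
  by eexists; exists 0.
rewrite ger0_norm; first exact: ge_sup.
have hA : has_ubound A by exists ((K1 + Kd) * lam).
case: A0 => a Aa; apply: le_trans (ub_le_sup hA Aa).
by case: Aa => x _ <-; exact: normr_ge0.
Qed.

End convergence.

(** * Asymptotics of the counts *)

Section weights_asymptotics.
Variable R : realType.
Implicit Types (lam c K : R) (u v W : nat -> R).

(* u s = s^a (1 + O(1/s)) *)
Definition power_approx a u := exists2 K : R, 0 <= K & forall s, (0 < s)%N ->
  `|u s - s%:R ^+ a| * s%:R <= K * s%:R ^+ a.

Lemma power_approxM a b u v : power_approx a u -> power_approx b v ->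
  power_approx (a + b) (fun s => u s * v s).
Proof.
move=> [K K0 HK] [L L0 HL]; exists (K * (1 + L) + L).
  by rewrite addr_ge0// mulr_ge0// addr_ge0.
move=> s s0; have {}HK := HK s s0; have {}HL := HL s s0.
have s1 : (1 : R) <= s%:R by rewrite ler1n.
have s00 : (0 : R) <= s%:R by [].
have [A0 B0] : 0 <= (s%:R : R) ^+ a /\ 0 <= (s%:R : R) ^+ b by rewrite !exprn_ge0.
rewrite exprD; move: A0 B0 s1 s00 HK HL.
move: ((s%:R : R) ^+ a) ((s%:R : R) ^+ b) => A B; move: (s%:R : R) (u s) (v s).
move=> t p q A0 B0 t1 t0 hA hB.
have hq : `|q| <= (1 + L) * B.
  rewrite -[q](subrK B); apply: le_trans (ler_normD _ _) _.
  by have := normr_ge0 (q - B); rewrite (ger0_norm B0); nra.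
rewrite (_ : p * q - A * B = (p - A) * q + A * (q - B)); last by ring.
apply: (@le_trans _ _ (`|p - A| * t * `|q| + A * (`|q - B| * t))).
  rewrite (_ : _ + _ = (`|p - A| * `|q| + A * `|q - B|) * t); last by ring.
  rewrite ler_wpM2r//; apply: le_trans (ler_normD _ _) _.
  by rewrite !normrM (ger0_norm A0).
rewrite (_ : _ * (A * B) = (K * A) * ((1 + L) * B) + A * (L * B)); last by ring.
by apply: lerD; [apply: ler_pM => //; rewrite mulr_ge0|rewrite ler_wpM2l].
Qed.

Lemma power_approx_ext a u v : (forall s, (0 < s)%N -> u s = v s) ->
  power_approx a u -> power_approx a v.
Proof. by move=> uv [K K0 HK]; exists K => // s s0; rewrite -uv// HK. Qed.

Lemma power_approx0 : power_approx 0 (fun=> 1).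
Proof.
by exists 0 => // s _; rewrite expr0 subrr normr0 !mul0r.
Qed.

Lemma power_approx_shift a b : power_approx 1 (fun s => (s + a - b)%:R).
Proof.
exists (a + b)%:R => // s _; rewrite expr1 ler_wpM2r//.
have -> : `|(s + a - b)%:R - s%:R| = (`|s + a - b - s|%N)%:R :> R.
  have [h|h] := leqP s (s + a - b).
    by rewrite -natrB// normr_nat; congr _%:R; lia.
  by rewrite distrC -natrB ?(ltnW h)// normr_nat; congr _%:R; lia.
by rewrite ler_nat; lia.
Qed.

Lemma power_approx_half : power_approx 1 (fun s => (2 * s - 1)%:R / 2).
Proof.
exists 1 => // s s0; rewrite expr1 mul1r natrB ?natrM; last by lia.
rewrite (_ : _ - s%:R = - (2^-1)); last by field.
by rewrite normrN ger0_norm// ler_piMl//; lra.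
Qed.

Lemma power_approx_ffact a b m : power_approx m (fun s => ((s + a - b) ^_ m)%:R).
Proof.
elim: m => [|m IH].
  by apply: power_approx_ext power_approx0 => s _; rewrite ffactn0.
rewrite -addn1; apply: power_approx_ext (power_approxM IH (power_approx_shift a (b + m))) => s _.
by rewrite -natrM addn1 ffactnSr subnDA.
Qed.

Lemma power_approx_strong d u : power_approx d.+1 u ->
  exists2 K : R, 0 <= K & forall s, (0 < s)%N ->
    `|u s - s%:R ^+ d.+1| <= K * s%:R ^+ d.
Proof.
move=> [K K0 HK]; exists K => // s s0; have := HK s s0.
by rewrite [X in _ <= K * X]exprSr mulrA ler_pM2r// ltr0n.
Qed.

Lemma profile_upper Kg : 0 <= Kg -> exists2 K : R, 0 <= K &
  forall lam x g, 0 < lam <= 1 -> 0 <= x ->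
  `|g - expR (- x ^+ 2)| <= Kg * lam * expR (- (2 * x)) ->
  `|g| <= K * expR (- (2 * x)).
Proof.
move=> Kg0; have [K K0 HK] := @pow_gauss_bound1 R 0 2.
exists (K + Kg); first exact: addr_ge0.
move=> lam x g /andP[lam0 lam1] x0 hg.
rewrite -[g](subrK (expR (- x ^+ 2))) addrC mulrDl.
apply: le_trans (ler_normD _ _) _; apply: lerD.
  by have := HK x x0; rewrite expr0 mul1r ger0_norm ?expR_ge0.
by apply: le_trans hg _; rewrite ler_wpM2r ?expR_ge0// ler_piMr.
Qed.

(** The error of the weight gains one factor lam since it has degree d against lam^(d+1), that of
    the profile has its own. One of the two factors exp(-x) absorbs x^d or x^(d+1), the other is
    kept. *)
Lemma main_term d Kg Kw : 0 <= Kg -> 0 <= Kw -> exists2 K : R, 0 <= K &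
  forall lam s w g, 0 < lam <= 1 -> (0 < s)%N ->
  `|g - expR (- (lam * s%:R) ^+ 2)| <= Kg * lam * expR (- (2 * (lam * s%:R))) ->
  `|w - s%:R ^+ d.+1| <= Kw * s%:R ^+ d ->
  `|lam ^+ d.+1 * w * g - (lam * s%:R) ^+ d.+1 * expR (- (lam * s%:R) ^+ 2)|
    <= K * lam * expR (- (lam * s%:R)).
Proof.
move=> Kg0 Kw0; have [K1 K10 H1] := profile_upper Kg0.
have [K2 K20 H2] := pow_le_exp R d; have [K3 K30 H3] := pow_le_exp R d.+1.
exists (Kw * K2 * K1 + Kg * K3).
  by rewrite addr_ge0// !mulr_ge0.
move=> lam s w g lam1 s0 hg hw; have /andP[lam0 _] := lam1.
set x := lam * s%:R in hg *; have x0 : 0 <= x by rewrite mulr_ge0// ltW.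
have g1 := H1 lam x g lam1 x0 hg.
have e2 : expR (- (2 * x)) = expR (- x) * expR (- x) by rewrite -expRD; congr expR; ring.
have ex : expR x * expR (- x) = 1 by rewrite -expRD addrN expR0.
have E0 := expR_ge0 (- x).
have h2 : x ^+ d * expR (- (2 * x)) <= K2 * expR (- x).
  rewrite e2 mulrA ler_wpM2r// -[leRHS]mulr1 -ex mulrA ler_wpM2r//.
  exact: H2.
have h3 : x ^+ d.+1 * expR (- (2 * x)) <= K3 * expR (- x).
  rewrite e2 mulrA ler_wpM2r// -[leRHS]mulr1 -ex mulrA ler_wpM2r//.
  exact: H3.
rewrite (_ : _ - _ = (lam ^+ d.+1 * w - x ^+ d.+1) * g +
  x ^+ d.+1 * (g - expR (- x ^+ 2))); last by ring.
apply: le_trans (ler_normD _ _) _.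
rewrite (mulrDl _ _ lam) (mulrDl _ _ (expR (- x))); apply: lerD; rewrite normrM.
  have hw' : `|lam ^+ d.+1 * w - x ^+ d.+1| <= Kw * lam * x ^+ d.
    rewrite /x exprMn -mulrBr normrM (ger0_norm (exprn_ge0 _ (ltW lam0))).
    apply: (@le_trans _ _ (lam ^+ d.+1 * (Kw * s%:R ^+ d))).
      by rewrite ler_wpM2l// exprn_ge0// ltW.
    by rewrite exprMn exprS le_eqVlt; apply/orP; left; apply/eqP; ring.
  apply: (@le_trans _ _ (Kw * lam * x ^+ d * (K1 * expR (- (2 * x))))).
    exact: ler_pM.
  rewrite (_ : _ * (K1 * _) = Kw * K1 * lam * (x ^+ d * expR (- (2 * x)))); last by ring.
  rewrite [leRHS](_ : _ = Kw * K1 * lam * (K2 * expR (- x))); last by ring.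
  by rewrite ler_wpM2l// !mulr_ge0// ltW.
rewrite ger0_norm ?exprn_ge0//.
apply: (@le_trans _ _ (x ^+ d.+1 * (Kg * lam * expR (- (2 * x))))).
  by rewrite ler_wpM2l// exprn_ge0.
rewrite (_ : _ * (_ * _) = Kg * lam * (x ^+ d.+1 * expR (- (2 * x)))); last by ring.
rewrite [leRHS](_ : _ = Kg * lam * (K3 * expR (- x))); last by ring.
by rewrite ler_wpM2l// mulr_ge0// ltW.
Qed.

(** A weight of degree d, one below that of the leading term, leaves a factor lam to spare. *)
Lemma minor_term d Kg Kw : 0 <= Kg -> 0 <= Kw -> exists2 K : R, 0 <= K &
  forall lam s w g, 0 < lam <= 1 -> (0 < s)%N ->
  `|g - expR (- (lam * s%:R) ^+ 2)| <= Kg * lam * expR (- (2 * (lam * s%:R))) ->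
  `|w| <= Kw * s%:R ^+ d ->
  `|lam ^+ d.+1 * w * g| <= K * lam * expR (- (lam * s%:R)).
Proof.
move=> Kg0 Kw0; have [K1 K10 H1] := profile_upper Kg0.
have [K2 K20 H2] := pow_le_exp R d.
exists (Kw * K2 * K1); first by rewrite !mulr_ge0.
move=> lam s w g lam1 s0 hg hw; have /andP[lam0 _] := lam1.
set x := lam * s%:R in hg *; have x0 : 0 <= x by rewrite mulr_ge0// ltW.
have g1 := H1 lam x g lam1 x0 hg.
have e2 : expR (- (2 * x)) = expR (- x) * expR (- x) by rewrite -expRD; congr expR; ring.
have ex : expR x * expR (- x) = 1 by rewrite -expRD addrN expR0.
have h2 : x ^+ d * expR (- (2 * x)) <= K2 * expR (- x).
  rewrite e2 mulrA ler_wpM2r ?expR_ge0// -[leRHS]mulr1 -ex mulrA.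
  by rewrite ler_wpM2r ?expR_ge0// H2.
rewrite !normrM (ger0_norm (exprn_ge0 _ (ltW lam0))).
apply: (@le_trans _ _ (lam ^+ d.+1 * (Kw * s%:R ^+ d) * (K1 * expR (- (2 * x))))).
  apply: ler_pM => //; first by rewrite mulr_ge0// exprn_ge0// ltW.
  by rewrite ler_wpM2l// exprn_ge0// ltW.
rewrite (_ : _ * (K1 * _) = Kw * K1 * lam * (x ^+ d * expR (- (2 * x)))); last first.
  by rewrite /x exprMn exprS; ring.
rewrite [leRHS](_ : _ = Kw * K1 * lam * (K2 * expR (- x))); last by ring.
by rewrite ler_wpM2l// !mulr_ge0// ltW.
Qed.

End weights_asymptotics.

(** * Gaussian approximation of the profiles *)

Section profiles.
Variable R : realType.
Implicit Types (lam c K v : R).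

Lemma sum_ord_natr j : \sum_(r < j) (r%:R : R) = j%:R * (j%:R - 1) / 2.
Proof.
elim: j => [|j IH]; first by rewrite big_ord0 !mul0r.
by rewrite big_ord_recr /= IH -natr1; field.
Qed.

(** Here v = r / M. The lower bound combines (1 - v^2)(1 - v/2) <= (1 - v)(1 + v/2) with exp(-v/2)(1
    + v/2) <= 1; the upper one follows from 1 - v <= (1 - v/2)^2. *)
Lemma binary_factor v : 0 <= v <= 1 ->
  expR (- (v / 2)) * (1 - v ^+ 2) <= (1 - v) / (1 - v / 2) <= expR (- (v / 2)).
Proof.
move=> /andP[v0 v1]; have d0 : 0 < 1 - v / 2 by lra.
have e1 := expR_ge1Dx (- (v / 2)); have e2 := expR_ge1Dx (v / 2).
have ee : expR (- (v / 2)) * expR (v / 2) = 1 by rewrite -expRD addNr expR0.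
have e0 := expR_gt0 (- (v / 2)).
apply/andP; split.
  rewrite ler_pdivlMr//; have h : expR (- (v / 2)) * (1 + v / 2) <= 1 by nra.
  apply: (@le_trans _ _ (expR (- (v / 2)) * (1 + v / 2) * (1 - v))); last by nra.
  rewrite -!mulrA ler_wpM2l ?(ltW e0)//.
  have : 0 <= (1 - v) * v ^+ 2 by rewrite mulr_ge0 ?sqr_ge0//; lra.
  by nra.
rewrite ler_pdivrMr//; nra.
Qed.

(** Here v = (r + 1) / n. The lower bound follows from exp(-2v)(1 + v)^2 <= 1 and 1 - 2 v^2 <= (1 -
    v)(1 + v); the upper one amounts to artanh v >= v. *)
Lemma plane_factor v : 0 <= v <= 1 ->
  expR (- (2 * v)) * (1 - 2 * v ^+ 2) <= (1 - v) / (1 + v) <= expR (- (2 * v)).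
Proof.
move=> /andP[v0 v1]; have d0 : 0 < 1 + v by lra.
have e1 : expR (- v) * (1 + v) <= 1.
  have := expR_ge1Dx v; have := expR_gt0 (- v).
  by have : expR (- v) * expR v = 1; [rewrite -expRD addNr expR0|nra].
have e0 := expR_gt0 (- v).
have ee : expR (- (2 * v)) = expR (- v) * expR (- v) by rewrite -expRD; congr expR; ring.
apply/andP; split.
  rewrite ler_pdivlMr// ee.
  have [h|h] := leP (1 - 2 * v ^+ 2) 0.
    apply: (@le_trans _ _ 0); last lra.
    by rewrite mulr_le0_ge0 ?(ltW d0)// mulr_ge0_le0// mulr_ge0// ltW.
  have h2 : expR (- v) * expR (- v) * (1 + v) ^+ 2 <= 1.
    have : 0 <= expR (- v) * (1 + v) by rewrite mulr_ge0// ltW.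
    by nra.
  rewrite -(ler_pM2r d0).
  apply: (@le_trans _ _ (1 - 2 * v ^+ 2)); last by nra.
  rewrite [leLHS](_ : _ = expR (- v) * expR (- v) * (1 + v) ^+ 2 * (1 - 2 * v ^+ 2));
    last by ring.
  by rewrite ler_piMl// ltW.
(* (1 + v) e^-v - (1 - v) e^v vanishes at 0 and has derivative v (e^v - e^-v). *)
pose phi (t : R) : R := (1 + t) * expR (- t) + (t - 1) * expR t.
pose dphi (t : R) : R := t * (expR t - expR (- t)).
have dP (t : R) : is_derive t 1 phi (dphi t).
  have d1 : is_derive t 1 (fun y : R => expR (- y)) (expR (- t) * -1).
    exact: is_derive_expRf.
  have d2 : is_derive t 1 (fun y : R => 1 + y) 1.
    have := is_deriveD (is_derive_cst (1 : R) t 1) (is_derive_id t 1).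
    by move=> /is_derive_eq; apply; rewrite add0r.
  have d3 : is_derive t 1 (fun y : R => y - 1) 1.
    have := is_deriveD (is_derive_id t 1) (is_derive_cst (- 1 : R) t 1).
    by move=> /is_derive_eq; apply; rewrite addr0.
  apply: (is_derive_eq (is_deriveD (is_deriveMf d2 d1) (is_deriveMf d3 (is_derive_expR t)))).
  by rewrite /dphi; ring.
have cont := is_derive_continuous (A := `[0, v]) dP.
have [t] := MVT_segment v0 (fun z _ => dP z) cont.
rewrite in_itv /= => /andP[t0 tv] e.
have phi0 : phi 0 = 0 by rewrite /phi oppr0 expR0; ring.
have phiv : 0 <= phi v.
  rewrite phi0 !subr0 in e; rewrite e /dphi mulr_ge0// mulr_ge0// subr_ge0 ler_expR.
  lra.
rewrite ler_pdivrMr// ee.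
have e3 : expR v * expR (- v) = 1 by rewrite -expRD addrN expR0.
move: phiv; rewrite /phi => phiv.
have := mulr_ge0 (ltW e0) phiv.
rewrite mulrDr (_ : expR (- v) * ((v - 1) * _) = (v - 1) * (expR v * expR (- v))); last by ring.
by rewrite e3; lra.
Qed.

Lemma binary_profile_bounds M (c0 : nat) s : (0 < M)%N -> (0 < s)%N ->
  let j : R := (s - c0)%:R in
  expR (- ((4 * M%:R)^-1 * (j * (j - 1)))) *
    (1 - 16 * (4 * M%:R)^-1 ^+ 2 * s%:R ^+ 3) <= binary_profile R M (s - c0)
  <= expR (- ((4 * M%:R)^-1 * (j * (j - 1)))).
Proof.
move=> M0 s0 /=; have M1 : (1 : R) <= M%:R by rewrite ler1n.
have Mn0 : (M%:R : R) != 0 by rewrite gt_eqF//; lra.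
have s1 : (1 : R) <= s%:R by rewrite ler1n.
(* The defect is at most s times the bound (s/M)^2 on each term; 16 comes from writing it with tau =
   1/(4M). *)
have E16 : 16 * (4 * M%:R)^-1 ^+ 2 * s%:R ^+ 3 = s%:R * (s%:R / M%:R) ^+ 2 :> R by field.
rewrite E16.
have [jM|jM] := leqP (s - c0) M; last first.
  (* Beyond M the product is 0, and the lower bound is not positive because s > M. *)
  rewrite binary_profile0// expR_ge0 andbT.
  rewrite mulr_ge0_le0 ?expR_ge0// subr_le0.
  have : (1 : R) <= s%:R / M%:R by rewrite ler_pdivlMr ?mul1r ?ler_nat ?ltr0n//; lia.
  move: (s%:R / M%:R : R) => w w1; have w2 : 1 <= w ^+ 2 by nra.
  by nra.
pose rho r : R := 2 * (M%:R - r%:R) / (2 * M%:R - r%:R).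
pose u r : R := r%:R / M%:R / 2; pose v r : R := (r%:R / M%:R) ^+ 2.
have H r : (r < s - c0)%N -> [/\ 0 <= rho r, 0 <= v r &
    expR (- u r) * (1 - v r) <= rho r <= expR (- u r)].
  move=> rj; have rM : (r%:R : R) <= M%:R by rewrite ler_nat ltnW// (leq_trans rj).
  have r0 : (0 : R) <= r%:R by [].
  have v01 : 0 <= (r%:R / M%:R : R) <= 1.
    by rewrite divr_ge0//= ler_pdivrMr ?mul1r// ltr0n.
  split; [by rewrite divr_ge0//; lra|exact: sqr_ge0|].
  rewrite /u /v; have -> : rho r =
      (1 - r%:R / M%:R) / (1 - r%:R / M%:R / 2) :> R; last exact: binary_factor.
  have d1 : 2 * M%:R - r%:R != 0 :> R by rewrite gt_eqF//; lra.
  by rewrite /rho; field; rewrite Mn0 mulrC d1.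
have := prod_bounds H; rewrite -/(binary_profile R M (s - c0)).
have -> : \sum_(r < s - c0) u r =
   (4 * M%:R)^-1 * ((s - c0)%:R * ((s - c0)%:R - 1)).
  by rewrite /u -!mulr_suml sum_ord_natr; field.
move=> /andP[lo ->]; rewrite andbT; apply: le_trans lo.
rewrite ler_wpM2l ?expR_ge0// lerD2l lerN2.
apply: (@le_trans _ _ (\sum_(r < s - c0) (s%:R / M%:R : R) ^+ 2)).
  apply: ler_sum => r _; rewrite lerXn2r ?nnegrE ?divr_ge0// ler_wpM2r ?invr_ge0//.
  by rewrite ler_nat (leq_trans (ltnW (ltn_ord r)))// leq_subr.
rewrite sumr_const card_ord -[leLHS]mulr_natl ler_wpM2r ?sqr_ge0// ler_nat.
exact: leq_subr.
Qed.

Lemma plane_profile_bounds n s : (0 < n)%N -> (0 < s)%N ->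
  expR (- (n%:R^-1 * (s%:R * (s%:R - 1)))) *
    (1 - 2 * n%:R^-1 ^+ 2 * s%:R ^+ 3) <= plane_profile R n (s - 1)
  <= expR (- (n%:R^-1 * (s%:R * (s%:R - 1)))).
Proof.
move=> n0 s0; have n1 : (1 : R) <= n%:R by rewrite ler1n.
have nn0 : (n%:R : R) != 0 by rewrite gt_eqF//; lra.
have s1 : (1 : R) <= s%:R by rewrite ler1n.
have E2 : 2 * n%:R^-1 ^+ 2 * s%:R ^+ 3 = s%:R * (2 * (s%:R / n%:R) ^+ 2) :> R by field.
rewrite E2.
have [jn|jn] := ltnP (s - 1) n; last first.
  rewrite plane_profile0 ?n0// expR_ge0 andbT.
  rewrite mulr_ge0_le0 ?expR_ge0// subr_le0.
  have : (1 : R) <= s%:R / n%:R by rewrite ler_pdivlMr ?mul1r ?ler_nat ?ltr0n//; lia.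
  move: (s%:R / n%:R : R) => w w1; have w2 : 1 <= w ^+ 2 by nra.
  by nra.
pose rho r : R := (n%:R - r.+1%:R) / (n%:R + r.+1%:R).
pose u r : R := 2 * (r.+1%:R / n%:R).
pose v r : R := 2 * (r.+1%:R / n%:R) ^+ 2.
have H r : (r < s - 1)%N -> [/\ 0 <= rho r, 0 <= v r &
    expR (- u r) * (1 - v r) <= rho r <= expR (- u r)].
  move=> rj; have rM : (r.+1%:R : R) <= n%:R by rewrite ler_nat (leq_trans rj)// ltnW.
  have r0 : (0 : R) <= r.+1%:R by [].
  have v01 : 0 <= (r.+1%:R / n%:R : R) <= 1.
    by rewrite divr_ge0//= ler_pdivrMr ?mul1r// ltr0n.
  split; [by rewrite divr_ge0//; lra|by rewrite mulr_ge0 ?sqr_ge0|].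
  rewrite /u /v; have -> : rho r =
      (1 - r.+1%:R / n%:R) / (1 + r.+1%:R / n%:R) :> R; last exact: plane_factor.
  have d1 : n%:R + r.+1%:R != 0 :> R by rewrite gt_eqF//; lra.
  by rewrite /rho; move: (r.+1%:R : R) d1 => t d1; field; rewrite nn0 d1.
have := prod_bounds H; rewrite -/(plane_profile R n (s - 1)).
have -> : \sum_(r < s - 1) u r =
   n%:R^-1 * (s%:R * (s%:R - 1)).
  rewrite /u -mulr_sumr -mulr_suml; case: s s0 {s1 E2 jn H} => // s _.
  rewrite subn1 /=; under eq_bigr do rewrite -natr1.
  by rewrite big_split /= sum_ord_natr sumr_const card_ord -natr1; field.
move=> /andP[lo ->]; rewrite andbT; apply: le_trans lo.
rewrite ler_wpM2l ?expR_ge0// lerD2l lerN2.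
apply: (@le_trans _ _ (\sum_(r < s - 1) (2 * (s%:R / n%:R) ^+ 2 : R))).
  apply: ler_sum => r _; rewrite ler_wpM2l// lerXn2r ?nnegrE ?divr_ge0//.
  rewrite ler_wpM2r ?invr_ge0// ler_nat.
  by rewrite (leq_trans (ltn_ord r))// leq_subr.
rewrite sumr_const card_ord -[leLHS]mulr_natl ler_wpM2r//.
by rewrite ler_nat leq_subr.
Qed.

Lemma binary_profile_close (c0 : nat) c : 0 <= c -> exists2 K, 0 <= K &
  exists2 lam0, 0 < lam0 & forall lam M s, 0 < lam <= lam0 -> (0 < M)%N ->
    `|(4 * M%:R)^-1 - lam ^+ 2| <= c * lam ^+ 3 -> (0 < s)%N ->
    `|binary_profile R M (s - c0) - expR (- (lam * s%:R) ^+ 2)|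
      <= K * lam * expR (- (2 * (lam * s%:R))).
Proof.
(* One constant for the three hypotheses of [profile_close]: c for tau, 2 c0 + 1 for replacing j(j -
   1) by s^2, and 16 for the defect of the product. *)
move=> c_ge0; pose C : R := c + 16 + (2 * c0 + 1)%:R.
have C0 : 0 <= C by rewrite /C addr_ge0// addr_ge0.
have [K K0 [lam0 lam00 H]] := profile_close C0.
exists K => //; exists lam0 => // lam M s lamle M0 hM s0.
have lam_gt0 : 0 < lam by case/andP: lamle.
have s1 : (1 : R) <= s%:R by rewrite ler1n.
have /andP[lo hi] := binary_profile_bounds c0 M0 s0.
have c1 : c <= C by rewrite /C; have : (0 : R) <= (2 * c0 + 1)%:R by []; lra.
apply: (H lam (4 * M%:R)^-1 _ s%:R _ lamle s1 _ _ _ _).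
- by rewrite invr_ge0 mulr_ge0.
- by apply: le_trans hM _; rewrite ler_wpM2r// exprn_ge0// ltW.
- have h : `|(s - c0)%:R * ((s - c0)%:R - 1) - s%:R ^+ 2| <= (2 * c0 + 1)%:R * s%:R :> R.
    have j0 : (0 : R) <= (s - c0)%:R by [].
    have js : ((s - c0)%:R : R) <= s%:R by rewrite ler_nat leq_subr.
    have sj : (s%:R : R) <= (s - c0)%:R + c0%:R by rewrite -natrD ler_nat addnC -leq_subLR.
    have c00 : (0 : R) <= c0%:R by [].
    rewrite natrD natrM; move: ((s - c0)%:R : R) (c0%:R : R) (s%:R : R) j0 js sj c00 s1.
    move=> j d t j0 js sj d0 t1; rewrite ler_norml; apply/andP; split; nra.
  apply: le_trans h _; rewrite ler_wpM2r// /C; lra.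
apply/andP; split=> //; apply: le_trans lo.
rewrite ler_wpM2l ?expR_ge0// lerD2l lerN2 -!mulrA ler_wpM2r//.
by rewrite /C; have : (0 : R) <= (2 * c0 + 1)%:R by []; lra.
Qed.

Lemma plane_profile_close c : 0 <= c -> exists2 K, 0 <= K &
  exists2 lam0, 0 < lam0 & forall lam n s, 0 < lam <= lam0 -> (0 < n)%N ->
    `|n%:R^-1 - lam ^+ 2| <= c * lam ^+ 3 -> (0 < s)%N ->
    `|plane_profile R n (s - 1) - expR (- (lam * s%:R) ^+ 2)|
      <= K * lam * expR (- (2 * (lam * s%:R))).
Proof.
move=> c_ge0; pose C : R := c + 2.
have C0 : 0 <= C by rewrite /C addr_ge0.
have [K K0 [lam0 lam00 H]] := profile_close C0.
exists K => //; exists lam0 => // lam n s lamle n0 hn s0.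
have lam_gt0 : 0 < lam by case/andP: lamle.
have s1 : (1 : R) <= s%:R by rewrite ler1n.
have /andP[lo hi] := plane_profile_bounds n0 s0.
apply: (H lam n%:R^-1 (s%:R * (s%:R - 1)) s%:R _ lamle s1 _ _ _ _).
- by rewrite invr_ge0.
- by apply: le_trans hn _; rewrite ler_wpM2r ?exprn_ge0 ?(ltW lam_gt0)// /C; lra.
- rewrite (_ : _ - _ = - s%:R); last by ring.
  by rewrite normrN ger0_norm// /C ler_peMl//; lra.
apply/andP; split=> //; apply: le_trans lo.
rewrite ler_wpM2l ?expR_ge0// lerD2l lerN2 -!mulrA ler_wpM2r//.
by rewrite /C; lra.
Qed.

End profiles.

(** * Kolmogorov bounds for the three families of counts *)

Section closeness.
Variable R : realType.
Implicit Types (lam c K A : R) (H N : nat -> R).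

Lemma count_close k K : 0 <= K -> exists2 K', 0 <= K' &
  exists2 lam0, 0 < lam0 & forall lam A H N S,
  0 < lam <= lam0 -> 0 < A -> H 0%N = 0 ->
  (forall s, (0 < s)%N ->
     `|lam ^+ (2 * k).+1 * H s
       - (lam * s%:R) ^+ (2 * k).+1 * expR (- (lam * s%:R) ^+ 2)|
     <= K * lam * expR (- (lam * s%:R))) ->
  (forall s, (S <= s)%N -> N s = 0) -> (forall s, N s = A * H s) ->
  `|kolmogorov (weighted_law lam N S) (GG (2 * k.+1)%:R 2)| <= K' * lam.
Proof.
move=> K0; pose a : R := 2 / k`!%:R.
have a0 : 0 < a by rewrite divr_gt0// ltr0n fact_gt0.
have aK : 0 <= a * K by rewrite mulr_ge0// ltW.
have [K' K'0 [lam0 lam00 HH]] := kolmogorov_close k aK.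
exists K' => //; exists lam0 => // lam A H N S lamle A0 H0 Hs NS NE.
have lam_gt0 : 0 < lam by case/andP: lamle.
(* [al] turns H into an approximation of lam times the density, [a] being the constant of [dens];
   then N is A / al times that approximation. *)
pose al : R := a * lam * lam ^+ (2 * k).+1.
have al0 : 0 < al by rewrite !mulr_gt0// exprn_gt0.
apply: (HH lam (A / al) (fun s => al * H s) N S lamle) => [||s sS|s].
- by rewrite divr_gt0.
- move=> s; have [->|s0] := posnP s.
    rewrite H0 mulr0 mulr0 /dens (_ : (2 * k.+1 - 1 = (2 * k).+1)%N); last by lia.
    rewrite expr0n /= !(mul0r, mulr0) subrr normr0.
    by rewrite mulr_ge0 ?expR_ge0// mulr_ge0// exprn_ge0// ltW.
  have := Hs s s0; rewrite /dens (_ : (2 * k.+1 - 1 = (2 * k).+1)%N) /=; last by lia.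
  move: (expR _) (expR _) => E1 E2 h.
  rewrite (_ : _ - _ = a * lam * (lam ^+ (2 * k).+1 * H s - (lam * s%:R) ^+ (2 * k).+1 * E2)).
    rewrite normrM (ger0_norm (ltW _)) ?mulr_gt0//.
    rewrite [leRHS](_ : _ = a * lam * (K * lam * E1)); last by ring.
    by rewrite ler_wpM2l// mulr_ge0// ltW.
  by rewrite /al /a; ring.
- have /eqP := NS s sS; rewrite NE mulf_eq0 gt_eqF//= => /eqP ->.
  by rewrite mulr0.
by rewrite NE mulrA divfK// gt_eqF.
Qed.

Lemma ballot_gt0 n : (0 < ballot n 1)%N.
Proof.
have := ballotE n 1; rewrite mul1n => h.
have : (0 < 'C(2 * n + 1, n))%N by rewrite bin_gt0; lia.
by rewrite -h muln_gt0 => /andP[].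
Qed.

(** With k + 1 marks the count is A W(s) g(s). The binomial C(s - 1, 2k) is a falling factorial over
    (2k)!, and [ballot_binary] with m = n - k - 1 and i = s - (2k + 1) yields the last factor of W
    and the profile at n - k - 2 and s - (2k + 2). *)
Lemma leaf_close k c : 0 <= c -> exists2 K, 0 <= K &
  exists2 lam0, 0 < lam0 & forall lam n, 0 < lam <= lam0 -> (k.+2 < n)%N ->
  `|(4 * (n - k - 2)%:R)^-1 - lam ^+ 2| <= c * lam ^+ 3 ->
  forall S, (n + k < S)%N ->
  `|kolmogorov (weighted_law lam (tree_count R (btree_list n false) k.+1) S)
     (GG (2 * k.+1)%:R 2)| <= K * lam.
Proof.
move=> c0; have [Kg Kg0 [lam1 lam10 Hg]] := binary_profile_close (2 * k + 2) c0.
pose W s : R := ((s - 1) ^_ (2 * k) * (s - (2 * k).+1))%:R.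
have /power_approx_strong[Kw Kw0 HW] : power_approx (2 * k).+1 W.
  rewrite -addn1; apply: power_approx_ext (power_approxM
    (power_approx_ffact R 0 1 (2 * k)) (power_approx_shift R 0 (2 * k).+1)).
  by move=> s s0; rewrite /W natrM !addn0.
have [K K0 HK] := main_term (2 * k) Kg0 Kw0.
have [K' K'0 [lam2 lam20 HC]] := count_close k K0.
exists K' => //; exists (Num.min (Num.min lam1 lam2) 1).
  by rewrite !lt_min lam10 lam20 ltr01.
move=> lam n /andP[lam0]; rewrite !le_min => /andP[/andP[le1 le2] le3] nk htau S SE.
pose c_m : R := (2 * ballot (n - k - 2) 1)%:R.
pose A : R := (ballot k 1)%:R * c_m / (2 * k)`!%:R.
pose g s := binary_profile R (n - k - 2) (s - (2 * k + 2)).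
have mk : (n - k - 1 - 1 = n - k - 2)%N by rewrite -!subnDA; congr (_ - _)%N; lia.
apply: (HC lam A (fun s => W s * g s)) => [||||s sS|s].
- by rewrite lam0.
- by rewrite divr_gt0 ?mulr_gt0// ltr0n ?muln_gt0 ?ballot_gt0 ?fact_gt0.
- by rewrite /W sub0n muln0 mul0r.
- move=> s s0; rewrite mulrA; apply: HK => //; first by rewrite lam0.
    by apply: Hg => //; [rewrite lam0|clear -nk; lia].
  exact: HW.
- rewrite leaf_count// ifF//; apply/negbTE; rewrite negb_and -!ltnNge.
  by apply/orP; right; clear -sS SE; lia.
rewrite leaf_count//.
have m0 : (0 < n - k - 1)%N by clear -nk; lia.
have := ballot_binary R (s - (2 * k).+1) m0; rewrite mk.
rewrite (_ : (s - (2 * k).+1 - 1 = s - (2 * k + 2))%N); last by clear; lia.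
rewrite -/(g s) -/c_m => hb.
have -> : A * (W s * g s) = (ballot k 1 * 'C(s - 1, 2 * k))%:R * ((s - (2 * k).+1)%:R * c_m * g s).
  rewrite /A /W natrM -bin_ffact !natrM; move: (fact_gt0 (2 * k)).
  rewrite -(ltr0n R); move: ((2 * k)`!%:R : R) => F F0; field.
  by rewrite gt_eqF.
have [h|h] := leqP (2 * k).+1 s; last first.
  rewrite ifF; last by apply/negbTE; rewrite negb_and -ltnNge; apply/orP; left; clear -h; lia.
  rewrite (_ : (s - (2 * k).+1 = 0)%N) ?mul0r ?mulr0//.
  by apply/eqP; rewrite subn_eq0 ltnW.
rewrite -hb (_ : (2 * k.+1 - 1 <= s)%N); last by clear -h; lia.
rewrite (_ : (s - k.+1 + 1 <= n)%N = (s - (2 * k).+1 <= n - k - 1)%N); last by clear -h nk; lia.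
rewrite andTb; case: ifP => _; last by rewrite mulr0.
rewrite -natrM (_ : (s + 1 - 2 * k.+1 = s - (2 * k).+1)%N); last by clear -h; lia.
rewrite (_ : (k.+1 - 1 = k)%N); last by clear; lia.
rewrite (_ : (2 * k.+1 - 2 = 2 * k)%N); last by clear; lia.
rewrite (_ : (n - (s - k.+1 + 1) = n - k - 1 - (s - (2 * k).+1))%N); last by clear -h nk; lia.
by rewrite !mulnA.
Qed.

(** W joins the falling factorial of C(s + k - 1, 2k) with the factor 2s - 1 of [ballot_plane],
    halved to have leading coefficient 1; A takes the missing 2. *)
Lemma plane_close k c : 0 <= c -> exists2 K, 0 <= K &
  exists2 lam0, 0 < lam0 & forall lam n, 0 < lam <= lam0 -> (0 < n)%N ->
  `|n%:R^-1 - lam ^+ 2| <= c * lam ^+ 3 ->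
  forall S, (n < S)%N ->
  `|kolmogorov (weighted_law lam (tree_count R (plane_list n) k.+1) S)
     (GG (2 * k.+1)%:R 2)| <= K * lam.
Proof.
move=> c0; have [Kg Kg0 [lam1 lam10 Hg]] := plane_profile_close c0.
pose W s : R := ((s + k - 1) ^_ (2 * k))%:R * ((2 * s - 1)%:R / 2).
have /power_approx_strong[Kw Kw0 HW] : power_approx (2 * k).+1 W.
  rewrite -addn1.
  exact: power_approxM (power_approx_ffact R k 1 (2 * k)) (power_approx_half R).
have [K K0 HK] := main_term (2 * k) Kg0 Kw0.
have [K' K'0 [lam2 lam20 HC]] := count_close k K0.
exists K' => //; exists (Num.min (Num.min lam1 lam2) 1).
  by rewrite !lt_min lam10 lam20 ltr01.
move=> lam n /andP[lam0]; rewrite !le_min => /andP[/andP[le1 le2] le3] n0 htau S SE.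
pose b_n : R := (ballot (n - 1) 1)%:R.
pose A : R := 2 * (ballot k 1)%:R * b_n / (2 * k)`!%:R.
pose g s := plane_profile R n (s - 1).
apply: (HC lam A (fun s => W s * g s)) => [||||s sS|s].
- by rewrite lam0.
- by rewrite divr_gt0 ?mulr_gt0// ltr0n ?ballot_gt0 ?fact_gt0.
- by rewrite /W muln0 sub0n mul0r mulr0 mul0r.
- move=> s s0; rewrite mulrA; apply: HK => //; first by rewrite lam0.
    by apply: Hg => //; rewrite lam0.
  exact: HW.
- rewrite plane_count// ifF//; apply/negbTE; rewrite negb_and -!ltnNge.
  by apply/orP; right; exact: leq_trans sS.
rewrite plane_count//; have [->|s0] := posnP s.
  by rewrite /= /W muln0 sub0n mul0r mulr0 mul0r mulr0.
have -> : A * (W s * g s) = (ballot k 1 * 'C(s + k - 1, 2 * k))%:R * ((2 * s - 1)%:R * b_n * g s).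
  rewrite /A /W -bin_ffact !natrM; move: (fact_gt0 (2 * k)).
  rewrite -(ltr0n R); move: ((2 * k)`!%:R : R) => F F0; field.
  by rewrite gt_eqF.
rewrite -ballot_plane//.
rewrite (_ : (s + k.+1 - 2 = s + k - 1)%N); last by clear; lia.
rewrite (_ : (k.+1 - 1 = k)%N); last by clear; lia.
rewrite (_ : (2 * k.+1 - 2 = 2 * k)%N); last by clear; lia.
have [h|h] := ltnP k s; last first.
  by rewrite bin_small ?muln0 ?mul0r//; clear -h s0; lia.
by rewrite /=; case: ifP => _; rewrite ?mulr0// -natrM.
Qed.

Lemma bin_le_pow n m : ('C(n, m) <= n ^ m)%N.
Proof.
elim: n m => [|n IH] [|m]; rewrite ?bin0 ?expn0//.
rewrite binS; apply: (@leq_trans (n ^ m.+1 + n ^ m)); first by rewrite leq_add.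
have h : (n ^ m <= n.+1 ^ m)%N by case: (m) => // m'; rewrite leq_exp2r.
by rewrite !expnS addnC -mulSn leq_mul.
Qed.

(** Serves for the terms of [node_count] with fewer ends than possible; they have different profile
    shifts, so each is estimated on its own. *)
Lemma minor_sum d c (W : nat -> nat -> R) (e Kw : nat -> R) j :
  0 <= c -> (forall l, 0 <= Kw l) ->
  (forall l s, (l < j)%N -> (0 < s)%N -> `|W l s| <= Kw l * s%:R ^+ d) ->
  exists2 K, 0 <= K & exists2 lam0, 0 < lam0 & forall lam M s,
  0 < lam <= lam0 -> (0 < M)%N ->
  `|(4 * M%:R)^-1 - lam ^+ 2| <= c * lam ^+ 3 -> (0 < s)%N ->
  `|lam ^+ d.+1 * \sum_(l < j) e l * (W l s * binary_profile R M (s - l.+1))|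
    <= K * lam * expR (- (lam * s%:R)).
Proof.
move=> c0 Kw0; elim: j => [|j IH] hW.
  exists 0 => //; exists 1 => // lam M s _ _ _ _.
  by rewrite big_ord0 mulr0 normr0 !mul0r.
have [|K K0 [lam1 lam10 H]] := IH; first by move=> l s lj; apply: hW; exact: ltnW.
have [Kg Kg0 [lam2 lam20 Hg]] := binary_profile_close j.+1 c0.
have [L L0 HL] := minor_term d Kg0 (Kw0 j).
exists (K + `|e j| * L); first by rewrite addr_ge0// mulr_ge0.
exists (Num.min (Num.min lam1 lam2) 1).
  by rewrite !lt_min lam10 lam20 ltr01.
move=> lam M s /andP[lam0]; rewrite !le_min => /andP[/andP[le1 le2] le3] M0 hM s0.
rewrite big_ord_recr/= mulrDr (mulrDl K) (mulrDl _ _ (expR _)).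
apply: le_trans (ler_normD _ _) _; apply: lerD; first by apply: H; rewrite ?lam0.
rewrite mulrCA normrM -!mulrA ler_wpM2l// !mulrA.
apply: HL => //; rewrite ?lam0//; last exact: hW.
by apply: Hg; rewrite ?lam0.
Qed.

(** With k + 1 marks the weight of the term l has degree 2l + (k - l) + 1 = k + l + 1. This is 2k +
    1 for l = k, where every mark is an end of the span, and at most 2k for l < k. *)
Lemma node_close k c : 0 <= c -> exists2 K, 0 <= K &
  exists2 lam0, 0 < lam0 & forall lam n, 0 < lam <= lam0 -> (k.+1 < n)%N ->
  `|(4 * (n - 1)%:R)^-1 - lam ^+ 2| <= c * lam ^+ 3 ->
  forall S, (n + k < S)%N ->
  `|kolmogorov (weighted_law lam (tree_count R (btree_list n true) k.+1) S)
     (GG (2 * k.+1)%:R 2)| <= K * lam.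
Proof.
move=> c0.
pose W l s : R := ('C(s - 1, 2 * l) * 'C(s - l - 1, k - l) * (s - l))%:R.
pose F : R := (2 * k)`!%:R.
have F0 : 0 < F by rewrite ltr0n fact_gt0.
pose b l : R := (ballot l 1)%:R.
have b0 l : 0 < b l by rewrite ltr0n ballot_gt0.
(* Coefficients relative to the term l = k, so that [e k] is F. The power of 2 arises from
   2^(s-2l-1) = 2^(s-l) / 2^(l+1), as [ballot_binary] needs 2^(s-l). *)
pose e l : R := F * b l / b k * 2 ^+ (k - l).
have [||K1 K10 [lam1 lam10 H1]] := @minor_sum (2 * k) c W e (fun=> 1) k c0.
- by [].
- move=> l s lk s0; rewrite mul1r ger0_norm// /W -natrX ler_nat.
  apply: (@leq_trans (s ^ (2 * l) * s ^ (k - l) * s)).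
    apply: leq_mul; last exact: leq_subr.
    apply: leq_mul; apply: leq_trans (bin_le_pow _ _) _.
      by case: (2 * l)%N => // i; rewrite leq_exp2r// leq_subr.
    by case: (k - l)%N => // i; rewrite leq_exp2r// -subnDA leq_subr.
  by rewrite -expnD -expnSr leq_pexp2l//; lia.
have [Kg Kg0 [lam2 lam20 Hg]] := binary_profile_close k.+1 c0.
have /power_approx_strong[Kw Kw0 HW] : power_approx (2 * k).+1 (fun s => F * W k s).
  rewrite -addn1; apply: power_approx_ext (power_approxM
    (power_approx_ffact R 0 1 (2 * k)) (power_approx_shift R 0 k)).
  move=> s s0; rewrite /W subnn bin0 muln1 -bin_ffact !addn0 !natrM /F.
  by rewrite mulrAC mulrC.
have [K2 K20 H2] := main_term (2 * k) Kg0 Kw0.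
have KK : 0 <= K1 + K2 by rewrite addr_ge0.
have [K' K'0 [lam3 lam30 HC]] := count_close k KK.
exists K' => //; exists (Num.min (Num.min (Num.min lam1 lam2) lam3) 1).
  by rewrite !lt_min lam10 lam20 lam30 ltr01.
move=> lam n /andP[lam0]; rewrite !le_min => /andP[/andP[/andP[le1 le2] le3] le4].
move=> nk htau S SE.
have n1 : (0 < n - 1)%N by clear -nk; lia.
have n0 : (0 < n)%N by clear -nk; lia.
have kn : (0 < k.+1 <= n)%N by rewrite /= ltnW.
pose c_n : R := (2 * ballot (n - 1) 1)%:R.
pose A : R := b k * c_n / (2 ^+ k.+1 * F).
pose g l s := binary_profile R (n - 1) (s - l.+1).
have ek : e k = F by rewrite /e subnn expr0 mulr1 mulfK// gt_eqF.
apply: (HC lam A (fun s => \sum_(l < k.+1) e l * (W l s * g l s))) => [||||s sS|s].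
- by rewrite lam0.
- by rewrite divr_gt0 ?mulr_gt0 ?exprn_gt0 ?b0// ltr0n muln_gt0 ballot_gt0.
- by apply: big1 => l _; rewrite /W sub0n muln0 mul0r mulr0.
- move=> s s0; rewrite big_ord_recr/= ek mulrDr -addrA (mulrDl K1) (mulrDl (K1 * lam)).
  apply: le_trans (ler_normD _ _) _; apply: lerD; first by apply: H1; rewrite ?lam0.
  rewrite (mulrA F) mulrA; apply: H2 => //; rewrite ?lam0//; last exact: HW.
  by apply: Hg; rewrite ?lam0.
- rewrite node_count// big1// => -[l /= lk] _; rewrite ifF//.
  apply/negbTE; rewrite negb_and -!ltnNge.
  by apply/orP; right; clear -lk sS SE; lia.
rewrite node_count// mulr_sumr; apply: eq_bigr => -[l /= lk] _.
have := ballot_binary R (s - l) n0.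
rewrite (_ : (s - l - 1 = s - l.+1)%N) -/(g l s) -/c_n; last by clear; lia.
move=> hb; have -> : A * (e l * (W l s * g l s)) =
   (ballot l 1 * 'C(s - 1, 2 * l) * 'C(s - l - 1, k - l))%:R / 2 ^+ l.+1 *
   ((s - l)%:R * c_n * g l s).
  rewrite /A /e /W !natrM -/(b l).
  rewrite (_ : 2 ^+ k.+1 = 2 ^+ (k - l) * 2 ^+ l.+1); last first.
    by rewrite -exprD; congr (_ ^+ _); clear -lk; lia.
  have p1 : (2 ^+ (k - l) : R) != 0 by rewrite expf_neq0.
  have p2 : (2 ^+ l.+1 : R) != 0 by rewrite expf_neq0.
  have := b0 k; have := F0; rewrite !lt0r => /andP[f0 _] /andP[bk0 _].
  move: (2 ^+ (k - l)) (2 ^+ l.+1) (b k) p1 p2 bk0 => p q u p1 p2 bk0.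
  by field; rewrite p1 p2 f0 bk0.
rewrite -hb.
have [h|h] := ltnP (2 * l) s; last first.
  rewrite addn1 ltnNge h /=.
  have [s0|s0] := posnP s.
    by rewrite hb s0 sub0n !mul0r mulr0.
  by rewrite bin_small ?muln0 ?mul0r//; clear -h s0; lia.
rewrite addn1 h /=; case: ifP => _; last by rewrite mulr0.
rewrite (_ : (k.+1 - l - 1 = k - l)%N); last by clear -lk; lia.
rewrite (_ : (2 ^ (s - l) = 2 ^ (s - 2 * l - 1) * 2 ^ l.+1)%N); last first.
  by rewrite -expnD; congr (_ ^ _)%N; clear -h; lia.
rewrite !natrM (natrX _ _ l.+1) -[(s - l - 1)%N]subnDA addn1.
by field; rewrite expf_neq0.
Qed.

End closeness.

(** * Laws of the spanning sizes *)

Section tree_laws.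
Variable R : realType.
Implicit Types (lam : R) (L : seq tree).

Lemma sum_by_span L k S (F : nat -> R) :
  (forall t, t \in L -> (tree_span t < S)%N) ->
  \sum_(t <- L | tree_marks t == k) F (tree_span t) =
  \sum_(s < S) tree_count R L k s * F s.
Proof.
move=> hS; under [RHS]eq_bigr do rewrite /tree_count mulr_suml big_mkcond.
rewrite exchange_big/= [LHS]big_mkcond; apply: eq_big_seq => t /hS tS.
case: eqP => _ /=; last by rewrite big1.
rewrite (bigD1 (Ordinal tS))//= eqxx mul1r big1 ?addr0// => s.
by rewrite -val_eqE eq_sym /= => /negbTE ->.
Qed.

Lemma sp_law_weighted V k v Ts L lam g m :
  (0 < k)%N -> uniq L ->
  (forall t, t \in L <->
     node_set t \in Ts /\ fsubset (mark_set t) (V (node_set t))) ->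
  (forall T, T \in Ts -> plane_tree T) ->
  (forall T, T \in Ts -> fsubset (V T) T) ->
  (forall T, T \in Ts -> #|` V T| = v) -> (forall s, g s = lam * s%:R) ->
  exists2 S, (m < S)%N &
    sp_law V k g Ts = weighted_law lam (tree_count R L k) S.
Proof.
move=> k0 uL memL plane Vsub cardV gE.
(* Exceeds every span in L, so that no tree is lost, and m, the threshold from which the count
   formulas give 0. *)
exists (m + \sum_(t <- L) tree_span t).+1; first by rewrite ltnS leq_addr.
apply/funext => B; rewrite (sp_law_list k0 uL memL plane Vsub cardV).
have hS t : t \in L -> (tree_span t < (m + \sum_(t <- L) tree_span t).+1)%N.
  by move=> tL; rewrite (big_rem t)//= ltnS addnCA leq_addr.
rewrite (sum_by_span k (fun s => \1_B (g s)) hS) (sum_by_span k (fun=> 1) hS).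
rewrite /weighted_law; congr ((_ / _)%:E); apply: eq_bigr => s _.
  by rewrite gE.
by rewrite mulr1.
Qed.

Lemma leaves_sub T : fsubset (leaves T) T.
Proof. by apply/fsubsetP => u; rewrite mem_leaves => /andP[]. Qed.

Lemma card_binary_leaves n T : (0 < n)%N ->
  T \in binary_trees (2 * n - 1) -> #|` leaves T| = n.
Proof.
move=> n0 /binary_treesP[pT bT]; rewrite /nodes => cT.
have [t [tT _]] := tree_surj pT (fsubset_refl T).
rewrite -tT leaves_node_set; move: cT bT; rewrite -tT card_node_set => cT.
by move/binary_node_set/tree_size_binary; rewrite cT; lia.
Qed.

Lemma leaf_law k n lam g m : (0 < k)%N -> (0 < n)%N ->
  (forall s, g s = lam * s%:R) -> exists2 S, (m < S)%N &
  sp_law leaves k g (binary_trees (2 * n - 1)) =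
    weighted_law lam (tree_count R (btree_list n false) k) S.
Proof.
move=> k0 n0; apply: (@sp_law_weighted _ _ n) => //.
- by rewrite filter_uniq// btrees_uniq.
- exact: mem_btree_list.
- by move=> T /binary_treesP[].
- by move=> T _; exact: leaves_sub.
- by move=> T; exact: card_binary_leaves.
Qed.

Lemma node_law k n lam g m : (0 < k)%N -> (0 < n)%N ->
  (forall s, g s = lam * s%:R) -> exists2 S, (m < S)%N &
  sp_law nodes k g (binary_trees (2 * n - 1)) =
    weighted_law lam (tree_count R (btree_list n true) k) S.
Proof.
move=> k0 n0; apply: (@sp_law_weighted _ _ (2 * n - 1)) => //.
- by rewrite filter_uniq// btrees_uniq.
- exact: mem_btree_list.
- by move=> T /binary_treesP[].
- by move=> T /binary_treesP[].
Qed.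

Lemma plane_law k n lam g m : (0 < k)%N -> (0 < n)%N ->
  (forall s, g s = lam * s%:R) -> exists2 S, (m < S)%N &
  sp_law nodes k g (plane_trees n) =
    weighted_law lam (tree_count R (plane_list n) k) S.
Proof.
move=> k0 n0; apply: (@sp_law_weighted _ _ n) => //.
- by rewrite filter_uniq// trees_of_uniq// forests_uniq.
- exact: mem_plane_list.
- by move=> T /plane_treesP[].
- by move=> T /plane_treesP[].
Qed.

End tree_laws.

(** * The urn *)

Section urn.
Variable R : realType.
Implicit Types f g : nat -> R.

(** For l = 1 every draw is followed by an additional black ball, so the recursion does not depend
    on the number of earlier draws. *)
Fixpoint urn_mean f n b w : R :=
  if n is n'.+1 then
    b%:R / (b + w)%:R * urn_mean f n' (b + 1 + 1) w +
    w%:R / (b + w)%:R * urn_mean f n' (b + 1) (w + 1)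
  else f w.

Lemma integral_urn f i n b w : (forall m, 0 <= f m) ->
  (\int[urn_from 1 i n b w]_N (f N)%:E = (urn_mean f n b w)%:E)%E.
Proof.
move=> f0; elim: n i b w => [|n IH] i b w /=.
  by rewrite integral_dirac//= diracT mul1e.
rewrite ge0_integral_measure_add//=; last by move=> x _; rewrite lee_fin.
rewrite dvd1n !ge0_integral_mscale//=; try by move=> x _; rewrite lee_fin.
by rewrite !IH.
Qed.

Lemma urn_mean_lin f g a c n b w :
  urn_mean (fun m => a * f m + c * g m) n b w =
  a * urn_mean f n b w + c * urn_mean g n b w.
Proof. by elim: n b w => //= n IH b w; rewrite !IH; ring. Qed.

Lemma urn_mean_le f g n b w : (forall m, f m <= g m) ->
  urn_mean f n b w <= urn_mean g n b w.
Proof.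
move=> fg; elim: n b w => //= n IH b w.
by apply: lerD; rewrite ler_wpM2l// divr_ge0.
Qed.

Lemma urn_mean1 n b w : (0 < b + w)%N -> urn_mean (fun=> 1) n b w = 1.
Proof.
elim: n b w => //= n IH b w bw; rewrite !IH ?mulr1; try lia.
by rewrite -mulrDl -natrD divff// pnatr_eq0 -lt0n.
Qed.

(* A draw from t balls multiplies the mean of N (N + 1) by (t + 2) / t, and
   t then becomes t + 2. *)
Lemma urn_mean_rising n b w : (0 < b + w)%N ->
  urn_mean (fun m => m%:R ^+ 2 + m%:R) n b w =
  w%:R * (w%:R + 1) * (b%:R + w%:R + 2 * n%:R) / (b%:R + w%:R).
Proof.
elim: n b w => [|n IH] b w bw.
  have t0 : b%:R + w%:R != 0 :> R by rewrite -natrD pnatr_eq0 -lt0n.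
  by rewrite /= mulr0 addr0 mulfK//; ring.
have t0 : b%:R + w%:R != 0 :> R by rewrite -natrD pnatr_eq0 -lt0n.
have t2 : b%:R + w%:R + 2 != 0 :> R by rewrite gt_eqF// ltr_wpDl// addr_ge0.
rewrite /= !IH; try lia.
rewrite -[n.+1]addn1 !natrD; field.
have -> : b%:R + 1 + (w%:R + 1) = b%:R + w%:R + 2 :> R by ring.
by rewrite t0 t2.
Qed.

(** E N^2 is E N(N + 1) minus E N, and no second exact recursion is needed for E N: averaging 2 r N
    <= N^2 + r^2 with r = sqrt n bounds it by O(k sqrt n). *)
Lemma urn_norm_sqr k n : (0 < k < n)%N -> let mu : R := urn_norm (n - k - 1) 1 (2 * k) in
  `|mu ^+ 2 - 4 * n%:R| <= 5 * Num.sqrt n%:R.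
Proof.
move=> /andP[k0 kn] /=; set mu : R := urn_norm _ _ _.
pose X := urn_mean (fun m => m%:R ^+ 2) (n - k - 1) 1 (2 * k).
pose Y := urn_mean (fun m => m%:R) (n - k - 1) 1 (2 * k).
have Y0 : 0 <= Y.
  rewrite (_ : 0 = 0 * urn_mean (fun=> 1) (n - k - 1) 1 (2 * k) + 0 * X); last by ring.
  by rewrite -urn_mean_lin; apply: urn_mean_le => m; rewrite !mul0r addr0.
have X0 : 0 <= X.
  rewrite (_ : 0 = 0 * urn_mean (fun=> 1) (n - k - 1) 1 (2 * k) + 0 * X); last by ring.
  by rewrite -urn_mean_lin; apply: urn_mean_le => m; rewrite !mul0r addr0 exprn_ge0.
have XE : mu = Num.sqrt (X / k%:R).
  rewrite /mu /urn_norm integral_urn/=; last by move=> m; rewrite exprn_ge0.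
  rewrite -/X natrM invfM mulrA mulfV// mul1r mulrC powR12_sqrt//.
  by rewrite divr_ge0// X0.
have kR : (0 : R) < k%:R by rewrite ltr0n.
have XY : X + Y = 2 * k%:R * (2 * n%:R - 1).
  rewrite -[X]mul1r -[Y]mul1r -urn_mean_lin.
  have := @urn_mean_rising (n - k - 1) 1 (2 * k) isT.
  rewrite (_ : (fun m : nat => 1 * m%:R ^+ 2 + 1 * m%:R) =
    (fun m => m%:R ^+ 2 + m%:R :> R)) => [->|]; last first.
    by apply/funext => m; rewrite !mul1r.
  have -> : (n - k - 1)%:R = n%:R - k%:R - 1 :> R by rewrite !natrB//; lia.
  have t0 : 1 + 2 * k%:R != 0 :> R by rewrite gt_eqF//; lra.
  by rewrite natrM; field.
set r := Num.sqrt n%:R.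
have rr : r ^+ 2 = n%:R by rewrite sqr_sqrtr.
have r1 : 1 <= r.
  by rewrite -sqrtr1 ler_wsqrtr// ler1n; lia.
have XYr : 2 * r * Y <= X + r ^+ 2.
  have := @urn_mean1 (n - k - 1) 1 (2 * k) isT => e1.
  rewrite [leRHS](_ : _ = 1 * X + r ^+ 2 * urn_mean (fun=> 1) (n - k - 1) 1 (2 * k)); last first.
    by rewrite e1 mul1r mulr1.
  rewrite -urn_mean_lin.
  rewrite [leLHS](_ : _ = 2 * r * Y + 0 * X); last by ring.
  rewrite -urn_mean_lin; apply: urn_mean_le => m.
  have := sqr_ge0 (m%:R - r); move: (m%:R : R) => x; nra.
have k1 : (1 : R) <= k%:R by rewrite ler1n.
have -> : mu ^+ 2 = X / k%:R by rewrite XE sqr_sqrtr// divr_ge0.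
rewrite -rr in XY *; move: XY XYr => /eqP; rewrite -subr_eq0 => /eqP XY XYr.
(* 2 r Y <= X + r^2 <= 4 k r^2 + r^2 <= 5 k r^2. *)
have Yr : Y <= 5 / 2 * k%:R * r.
  have h : 2 * r * Y <= (5 * k%:R) * r ^+ 2 by nra.
  by move: h; rewrite expr2 mulrA -(ler_pM2r (lt_le_trans ltr01 r1)); nra.
rewrite (_ : X / k%:R - 4 * r ^+ 2 = - (Y / k%:R + 2)); last first.
  have -> : X = 2 * k%:R * (2 * r ^+ 2 - 1) - Y by lra.
  by field; rewrite gt_eqF.
rewrite normrN ger0_norm; last by rewrite addr_ge0// divr_ge0.
have : Y / k%:R <= 5 / 2 * r by rewrite ler_pdivrMr//; lra.
by nra.
Qed.

Lemma urn_norm_range k n : (0 < k < n)%N -> (4 <= n)%N ->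
  let mu : R := urn_norm (n - k - 1) 1 (2 * k) in
  Num.sqrt n%:R <= mu <= 3 * Num.sqrt n%:R.
Proof.
move=> kn n4 /=; set mu : R := urn_norm _ _ _; have := urn_norm_sqr kn; rewrite /= -/mu.
have rr : Num.sqrt n%:R ^+ 2 = n%:R :> R by rewrite sqr_sqrtr.
have r2 : 2 <= Num.sqrt n%:R :> R.
  rewrite (_ : 2 = Num.sqrt (2 ^+ 2)); last by rewrite sqrtr_sqr ger0_norm.
  by rewrite ler_wsqrtr// -natrX ler_nat.
have mu0 : 0 <= mu by exact: powR_ge0.
rewrite ler_norml; move: (Num.sqrt n%:R : R) rr r2 => r <- r2 /andP[h1 h2].
have r0 : 0 <= r by lra.
by apply/andP; split; rewrite -(ler_pXn2r (ltn0Sn 1)) ?nnegrE ?mulr_ge0//; nra.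
Qed.

(** [n - j] is the parameter of the binary profile. In the constant, 5 comes from [urn_norm_sqr], 4j
    from replacing n by n - j, and the factor 2 from mu <= 3 sqrt n and 2j < n. *)
Lemma binary_scale k n j : (0 < k < n)%N -> (4 <= n)%N -> (2 * j < n)%N ->
  let mu : R := urn_norm (n - k - 1) 1 (2 * k) in
  `|(4 * (n - j)%:R)^-1 - mu^-1 ^+ 2| <= (2 * (5 + 4 * j%:R)) * mu^-1 ^+ 3.
Proof.
move=> kn n4 jn /=; set mu : R := urn_norm _ _ _; have := urn_norm_sqr kn; rewrite /= -/mu.
have /andP[] := urn_norm_range kn n4; rewrite -/mu.
have rr : Num.sqrt n%:R ^+ 2 = n%:R :> R by rewrite sqr_sqrtr.
have jR : 2 * j%:R <= n%:R :> R by rewrite -natrM ler_nat ltnW.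
have j0 : (0 : R) <= j%:R by [].
rewrite natrB; last by lia.
have r1 : 1 <= Num.sqrt n%:R :> R.
  by rewrite -[leLHS]sqrtr1 ler_wsqrtr// ler1n; lia.
move: (Num.sqrt n%:R : R) rr r1 jR => r <- r1; move: (j%:R : R) j0 => q q0 jR h1 h2 h3.
have mu0 : 0 < mu by lra.
have d0 : 0 < r ^+ 2 - q by nra.
rewrite (_ : _ - _ = (mu ^+ 2 - 4 * (r ^+ 2 - q)) / (4 * (r ^+ 2 - q)) * mu^-1 ^+ 2); last first.
  by field; rewrite !gt_eqF.
rewrite normrM (ger0_norm (sqr_ge0 _)) (exprS _ 2) mulrA ler_wpM2r ?sqr_ge0//.
rewrite normrM normfV [ `|4 * _|]gtr0_norm ?mulr_gt0// ler_pdivrMr ?mulr_gt0//.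
have h4 : `|mu ^+ 2 - 4 * (r ^+ 2 - q)| <= (5 + 4 * q) * r.
  rewrite (_ : _ - _ = (mu ^+ 2 - 4 * r ^+ 2) + 4 * q); last by ring.
  apply: le_trans (ler_normD _ _) _; rewrite [ `|4 * q|]ger0_norm ?mulr_ge0//; nra.
apply: le_trans h4 _.
have h5 : r <= mu^-1 * (3 * r ^+ 2).
  by rewrite mulrC ler_pdivlMr//; nra.
have h6 : mu^-1 * (3 * r ^+ 2) <= 2 * mu^-1 * (4 * (r ^+ 2 - q)).
  rewrite (_ : 2 * mu^-1 * _ = mu^-1 * (8 * (r ^+ 2 - q))); last by ring.
  by rewrite ler_wpM2l ?invr_ge0 ?(ltW mu0)//; lra.
rewrite (_ : 2 * (5 + 4 * q) * mu^-1 * _ =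
  (5 + 4 * q) * (2 * mu^-1 * (4 * (r ^+ 2 - q)))); last by ring.
by rewrite ler_wpM2l//; lra.
Qed.

Lemma plane_scale k n : (0 < k < n)%N -> (4 <= n)%N ->
  let mu : R := urn_norm (n - k - 1) 1 (2 * k) in
  `|n%:R^-1 - (2 / mu) ^+ 2| <= 2 * (2 / mu) ^+ 3.
Proof.
move=> kn n4 /=; set mu : R := urn_norm _ _ _; have := urn_norm_sqr kn; rewrite /= -/mu.
have /andP[] := urn_norm_range kn n4; rewrite -/mu.
have rr : Num.sqrt n%:R ^+ 2 = n%:R :> R by rewrite sqr_sqrtr.
have r1 : 1 <= Num.sqrt n%:R :> R.
  by rewrite -[leLHS]sqrtr1 ler_wsqrtr// ler1n; lia.
move: (Num.sqrt n%:R : R) rr r1 => r <- r1 h1 h2 h3.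
have mu0 : 0 < mu by lra.
have r0 : 0 < r by lra.
rewrite (_ : _ - _ = (mu ^+ 2 - 4 * r ^+ 2) / (4 * r ^+ 2) * (2 / mu) ^+ 2); last first.
  by field; rewrite !gt_eqF.
rewrite normrM (ger0_norm (sqr_ge0 _)) (exprS _ 2) mulrA ler_wpM2r ?sqr_ge0//.
rewrite normrM normfV [ `|4 * _|]gtr0_norm ?mulr_gt0// ?exprn_gt0//.
rewrite ler_pdivrMr ?mulr_gt0 ?exprn_gt0//.
apply: le_trans h3 _.
rewrite (_ : 2 * (2 / mu) * _ = 16 * r ^+ 2 / mu); last by ring.
by rewrite ler_pdivlMr//; nra.
Qed.

End urn.

(** * Rates in terms of n *)

Section rate.
Variable R : realType.

(** [2 / mu <= lam0] serves both scalings, 1/mu and 2/mu. The threshold 2k + 8 covers all size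
    conditions met later, and the rate follows from mu >= sqrt n. *)
Lemma eventually_scale (lam0 : R) k : 0 < lam0 -> (0 < k)%N ->
  \forall n \near \oo, (2 * k + 8 < n)%N /\
    let mu : R := urn_norm (n - k - 1) 1 (2 * k) in
    [/\ 0 < mu, 2 / mu <= lam0 & mu^-1 <= n%:R `^ (- 2^-1)].
Proof.
move=> lam00 k0; near=> n.
have nk : (2 * k + 8 < n)%N by near: n; exact: nbhs_infty_gt.
split=> //=; set mu : R := urn_norm _ _ _.
have kn : (0 < k < n)%N by lia.
have n4 : (4 <= n)%N by lia.
have /andP[lo _] := urn_norm_range R kn n4; rewrite -/mu in lo.
have nR : (0 : R) < n%:R by rewrite ltr0n; lia.
have s0 : (0 : R) < Num.sqrt n%:R by rewrite sqrtr_gt0.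
have mu0 : 0 < mu by exact: lt_le_trans lo.
split=> //.
  rewrite ler_pdivrMr// mulrC -ler_pdivrMr//; apply: le_trans lo.
  rewrite -[leLHS](@ger0_norm _ _) ?divr_ge0 ?(ltW lam00)// -sqrtr_sqr ler_wsqrtr//.
  by near: n; exact: nbhs_infty_ger.
by rewrite powRN powR12_sqrt// lef_pV2 ?posrE.
Unshelve. all: by end_near.
Qed.

End rate.

Theorem theorem1p8 (R : realType) (k : nat) (hk : (1 <= k)%N) :
  let mu (n : nat) : R := urn_norm (n - k - 1) 1 (2 * k) in
  let limit_law : set R -> \bar R := GG (2 * k)%:R 2 in
  [/\ (fun n : nat => kolmogorov
         (sp_law leaves k (fun s => s%:R / mu n) (binary_trees (2 * n - 1)))
         limit_law : R^o)
        =O_\oo (fun n : nat => n%:R `^ (- 2^-1) : R^o),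
      (fun n : nat => kolmogorov
         (sp_law nodes k (fun s => s%:R / mu n) (binary_trees (2 * n - 1)))
         limit_law : R^o)
        =O_\oo (fun n : nat => n%:R `^ (- 2^-1) : R^o)
    & (fun n : nat => kolmogorov
         (sp_law nodes k (fun s => 2 * s%:R / mu n) (plane_trees n))
         limit_law : R^o)
        =O_\oo (fun n : nat => n%:R `^ (- 2^-1) * ln n%:R : R^o)].
Proof.
case: k hk => // k hk mu limit_law; split; apply/eqO_exP.
- have cge0 : (0 : R) <= 2 * (5 + 4 * (k + 2)%:R) by rewrite mulr_ge0 ?addr_ge0 ?mulr_ge0.
  have [K K0 [lam0 lam00 H]] := leaf_close k cge0.
  exists (K + 1); first by rewrite ltr_wpDl.
  have := eventually_scale lam00 (ltn0Sn k); apply: filterS => n [nk [mu0 le1 le2]].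
  have n0 : (0 < n)%N by lia.
  have gE s : s%:R / mu n = (mu n)^-1 * s%:R by rewrite mulrC.
  have [S nS ->] := @leaf_law R k.+1 n _ _ (n + k) (ltn0Sn k) n0 gE.
  rewrite [ `|_ `^ _|]ger0_norm ?powR_ge0//.
  have l0 : 0 < (mu n)^-1 by rewrite invr_gt0.
  apply: (@le_trans _ _ (K * (mu n)^-1)); last by apply: ler_pM; rewrite ?(ltW l0)// lerDl.
  apply: H => //; first by rewrite l0/=; apply: le_trans le1; rewrite ler_peMl ?(ltW l0)// ler1n.
  + lia.
  rewrite -subnDA; apply: binary_scale; lia.
- have cge0 : (0 : R) <= 2 * (5 + 4 * 1%:R) by [].
  have [K K0 [lam0 lam00 H]] := node_close k cge0.
  exists (K + 1); first by rewrite ltr_wpDl.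
  have := eventually_scale lam00 (ltn0Sn k); apply: filterS => n [nk [mu0 le1 le2]].
  have n0 : (0 < n)%N by lia.
  have gE s : s%:R / mu n = (mu n)^-1 * s%:R by rewrite mulrC.
  have [S nS ->] := @node_law R k.+1 n _ _ (n + k) (ltn0Sn k) n0 gE.
  rewrite [ `|_ `^ _|]ger0_norm ?powR_ge0//.
  have l0 : 0 < (mu n)^-1 by rewrite invr_gt0.
  apply: (@le_trans _ _ (K * (mu n)^-1)); last by apply: ler_pM; rewrite ?(ltW l0)// lerDl.
  apply: H => //; first by rewrite l0/=; apply: le_trans le1; rewrite ler_peMl ?(ltW l0)// ler1n.
  + lia.
  apply: binary_scale; lia.
have [K K0 [lam0 lam00 H]] := plane_close k (ler0n R 2).
exists (2 * K + 1); first by rewrite ltr_wpDl// mulr_ge0.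
have := eventually_scale lam00 (ltn0Sn k); apply: filterS => n [nk [mu0 le1 le2]].
have n0 : (0 < n)%N by lia.
have gE s : 2 * s%:R / mu n = (2 / mu n) * s%:R by rewrite mulrAC.
have [S nS ->] := @plane_law R k.+1 n _ _ n (ltn0Sn k) n0 gE.
have l0 : 0 < 2 / mu n by rewrite divr_gt0.
(* The estimate for plane trees is of order 2/mu; it is compared with the stated rate through ln n
   >= 1, which holds because exp(1/2) <= 2 and n >= 4. *)
have ln1 : 1 <= ln n%:R :> R.
  have h2 : expR (2^-1) <= 2 :> R.
    rewrite -[2^-1]opprK expRN -[leRHS]invrK lef_pV2 ?posrE ?expR_gt0//.
    by apply: le_trans (expR_ge1Dx _); lra.
  rewrite -ler_expR lnK ?posrE ?ltr0n//; apply: (@le_trans _ _ 4); last by rewrite ler_nat; lia.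
  have -> : expR 1 = expR (2^-1) ^+ 2 :> R by rewrite expr2 -expRD; congr expR; lra.
  by have := expR_gt0 (2^-1 : R); nra.
apply: (@le_trans _ _ (K * (2 / mu n))).
  apply: H => //; first by rewrite l0.
  apply: plane_scale; lia.
rewrite normrM [ `|_ `^ _|]ger0_norm ?powR_ge0// mulrA.
apply: (@le_trans _ _ ((2 * K + 1) * n%:R `^ (- 2^-1))).
  by apply: ler_pM; rewrite ?mulr_ge0 ?invr_ge0 ?(ltW mu0)// mulrC lerDl.
rewrite mulrA ler_peMr ?mulr_ge0 ?addr_ge0 ?mulr_ge0 ?powR_ge0//.
by rewrite ger0_norm// (le_trans _ ln1).
Qed.
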